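(* For $n=2k+q\ge 4$ ($k,q\geq 0$ integers), every ordinary layer $\Phi_k=\mathrm{Ind}_{C_k\times S_q}^{D_n}(\mathbf 1\boxtimes\mathrm{sgn}_{S_q})$ defines a linear Gelfand triple, i.e. $(D_n,C_k\times S_q,\mathbf 1\boxtimes\mathrm{sgn}_{S_q})$ is one. In particular, $(D_{2m},C_m)$ is an ordinary Gelfand pair for every $m\ge 2$. For the even-special subgroup $E_m$ ($m\geq 2$), \[ (D_{2m},E_m)\text{ is a Gelfand pair}\iff m\text{ is odd}. \] More precisely, set \[ a_m=\sum_{i=0}^mp(i)p(m-i),\qquad d_m=\begin{cases}0,&m\text{ odd},\\ p(m/2),&m\text{ even},\end{cases}\qquad r_m=\frac{a_m+2p(m)-3d_m}{2}. \] Then \[ \mathscr A(D_{2m},E_m,\mathbf 1)\cong\mathbb C^{r_m}\times\mathrm{Mat}_2(\mathbb C)^{d_m},\qquad |E_m\backslash D_{2m}/E_m|=\frac{a_m+2p(m)+5d_m}{2}. \] Thus the failure in type $D_{4r}$ consists of exactly $p(r)$ matrix blocks of size two.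
   Context: $f_i$ is the sign change of coordinate $i$ among $n$ coordinates; $D_n=N_n^+\rtimes S_n$ is the group of signed permutations with an even number of sign changes. On the first $2k$ coordinates put $a_i=(2i-1,2i)$, $c_i=f_{2i-1}f_{2i}$ ($1\le i\le k$), $b_i=(2i-1,2i+1)(2i,2i+2)$ ($1\le i<k$), $C_k=\langle a_i,c_i,b_i\rangle\cong(C_2\times C_2)\wr S_k$, $C_0=1$. Let $\eta_k:C_k\to\{\pm1\}$ be the character with $\eta_k(a_i)=\eta_k(b_i)=1$, $\eta_k(c_i)=-1$, and $E_k=\ker\eta_k$. $S_q$ permutes the last $q$ coordinates without signs (for $k=0$ the source is the unsigned $S_n$). $p(i)$ is the number of partitions of $i$, $p(0)=1$. For finite groups $H\le G$ and a linear complex character $\lambda$ of $H$, $(G,H,\lambda)$ is a linear Gelfand triple if $\mathrm{Ind}_H^G\lambda$ is multiplicity-free; if $\lambda=\mathbf 1$ one says $(G,H)$ is a Gelfand pair. $\mathscr A(G,H,\lambda)=e_\lambda\mathbb CGe_\lambda$, $e_\lambda=|H|^{-1}\sum_{h\in H}\lambda(h^{-1})h$. *)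

(* Defs.v *)
From HB Require Import structures.
From mathcomp Require Import all_boot all_order all_algebra all_fingroup.
From mathcomp Require Import all_solvable all_field all_character.
From mathcomp Require Import reals complex.

Set Implicit Arguments.
Unset Strict Implicit.
Unset Printing Implicit Defensive.

Import GroupScope Order.TTheory GRing.Theory Num.Theory.

Local Open Scope ring_scope.

Section LinearCharacter.
Variables (gT : finGroupType) (G : {group gT}) (f : gT -> algC).
Hypothesis f1 : f 1%g = 1.
Hypothesis fM : {in G &, {morph f : x y / (x * y)%g >-> x * y}}.

Lemma lin_mx_repr : mx_repr G (fun x => (f x)%:M : 'M[algC]_1).
Proof.
split=> [|x y Gx Gy]; first by rewrite f1.
by rewrite fM // scalar_mxM.
Qed.

Definition lin_cfun : 'CF(G) := cfRepr (MxRepresentation lin_mx_repr).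

Lemma lin_cfunE x : x \in G -> lin_cfun x = f x.
Proof. by move=> Gx; rewrite /lin_cfun cfunE Gx mulr1n /= mxtrace_scalar. Qed.

Lemma lin_cfun_lin : lin_cfun \is a linear_char.
Proof.
by apply/andP; split; [apply: cfRepr_char | rewrite lin_cfunE // f1].
Qed.

End LinearCharacter.

(* Values of complex characters of finite groups are algebraic, so 'CF(G), with
   values in algC, loses nothing over the complex numbers. *)
Section Gelfand.
Variables (gT : finGroupType) (G H : {group gT}).

Definition multiplicity_free (phi : 'CF(G)) : Prop :=
  forall i : Iirr G, '[phi, 'chi_i] <= 1.

Definition linear_gelfand_triple (lambda : 'CF(H)) : Prop :=
  [/\ H \subset G, lambda \is a linear_char
    & multiplicity_free ('Ind[G] lambda)].

Definition gelfand_pair : Prop := linear_gelfand_triple (1 : 'CF(H)).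

Definition double_cosets : {set {set gT}} := [set (H :* g * H)%g | g in G].

End Gelfand.

(* The Hecke algebra e_lambda F[G] e_lambda.  The group algebra F[G] is
   group_ring F G, the span of the matrices regular_repr F G g, g \in G. *)
Section Hecke.
Variables (F : fieldType) (gT : finGroupType) (G H : {group gT}).
Variable lambda : gT -> F.

Definition hecke_idem : 'M[F]_#|G| :=
  #|H|%:R^-1 *: \sum_(h in H) lambda (h^-1)%g *: regular_repr F G h.

Definition in_hecke (A : 'M[F]_#|G|) : Prop :=
  exists2 B, (B \in group_ring F G)%MS & A = hecke_idem *m B *m hecke_idem.

(* F-algebra isomorphism, read as an injective map from F^r x Mat_2(F)^d into
   F[G] with image the Hecke algebra, whose unit is hecke_idem. *)
Definition hecke_isomorphic_to (r d : nat) : Prop :=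
  exists psi : {linear ({ffun 'I_r -> F^o} * {ffun 'I_d -> 'M[F]_2})%type
                       -> 'M[F]_#|G|},
    [/\ injective psi,
        psi 1 = hecke_idem,
        {morph psi : x y / x * y >-> x *m y}
      & forall A, in_hecke A <-> exists x, psi x = A].

End Hecke.

(* A signed permutation of n coordinates is a permutation of 'I_n * bool that
   commutes with sneg; (i, false) stands for +i and (i, true) for -i. *)
Notation sperm n := {perm 'I_n * bool}.

Definition sneg n (x : 'I_n * bool) : 'I_n * bool := (x.1, ~~ x.2).

Definition is_signed n (w : sperm n) : bool :=
  [forall x, w (sneg x) == sneg (w x)].

Definition sign_changes n (w : sperm n) : nat :=
  #|[set i : 'I_n | (w (i, false)).2]|.

Section SignedPerm.
Variable n : nat.
Implicit Types (v w : sperm n) (s t : 'S_n).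

Lemma is_signedP w : reflect (forall i b, w (i, ~~ b) = sneg (w (i, b)))
                             (is_signed w).
Proof.
apply: (iffP forallP) => [h i b|h [i b]]; first exact/eqP/(h (i, b)).
exact/eqP/h.
Qed.

Lemma signedE w i b : is_signed w ->
  w (i, b) = ((w (i, false)).1, b (+) (w (i, false)).2).
Proof.
move/is_signedP=> h; case: b => /=; last by case: (w _).
by rewrite -[true]/(~~ false) h.
Qed.

Lemma signed1 : is_signed (1%g : sperm n).
Proof. by apply/is_signedP=> i b; rewrite !permE. Qed.

Lemma signedM v w : is_signed v -> is_signed w -> is_signed (v * w)%g.
Proof.
move=> /is_signedP hv /forallP hw; apply/is_signedP=> i b.
by rewrite !permM hv; apply/eqP/hw.
Qed.

Lemma signed_abs_inj w : is_signed w -> injective (fun i => (w (i, false)).1).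
Proof.
move=> hw i j /= e; case: (boolP ((w (i, false)).2 == (w (j, false)).2)) => [/eqP e2|ne].
  have: w (i, false) = w (j, false).
    by rewrite [LHS]surjective_pairing [RHS]surjective_pairing e e2.
  by move/perm_inj=> [].
have: w (i, false) = w (j, true).
  rewrite (signedE j true hw) [LHS]surjective_pairing e.
  by case: (w (i, false)).2 (w (j, false)).2 ne => [] [].
by move/perm_inj.
Qed.

Lemma sign_changesE w : sign_changes w = (\sum_(i < n) (w (i, false)).2)%N.
Proof.
rewrite /sign_changes cardE -sum1_size big_enum /= big_mkcond /=.
by apply: eq_bigr => i _; rewrite inE; case: ifP.
Qed.

Lemma odd_sum (I : finType) (F : I -> nat) :
  odd (\sum_i F i)%N = \big[addb/false]_i odd (F i).
Proof. exact: (big_morph odd oddD). Qed.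

Lemma sign_changesM v w : is_signed v -> is_signed w ->
  odd (sign_changes (v * w)%g) = odd (sign_changes v) (+) odd (sign_changes w).
Proof.
move=> hv hw; rewrite !sign_changesE !odd_sum.
rewrite [X in _ = _ (+) X](reindex_inj (signed_abs_inj hv)) -big_split /=.
apply: eq_bigr => i _; rewrite !oddb permM.
by rewrite [v _]surjective_pairing signedE.
Qed.

Definition Dset : {set sperm n} :=
  [set w | is_signed w & ~~ odd (sign_changes w)].

Lemma Dset_group : group_set Dset.
Proof.
apply/group_setP; split=> [|v w].
  rewrite inE signed1 sign_changesE big1 // => i _.
  by rewrite perm1.
rewrite !inE => /andP[hv ev] /andP[hw ew].
by rewrite signedM // sign_changesM // (negPf ev) (negPf ew).
Qed.

Definition Dgroup : {group sperm n} := Group Dset_group.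

Lemma cperm_inj s : injective (fun x : 'I_n * bool => (s x.1, x.2)).
Proof. by move=> [i b] [j c] [/perm_inj -> ->]. Qed.

Definition cperm s : sperm n := perm (@cperm_inj s).

Lemma cpermE s i b : cperm s (i, b) = (s i, b).
Proof. by rewrite permE. Qed.

Lemma cpermM : {in [set: 'S_n] &, {morph cperm : s t / (s * t)%g}}.
Proof.
by move=> s t _ _; apply/permP=> -[i b]; rewrite permM !cpermE permM.
Qed.

Canonical cperm_morphism := Morphism cpermM.

Lemma cpermI : injective cperm.
Proof.
move=> s t /permP e; apply/permP=> i.
by have := e (i, false); rewrite !cpermE => -[].
Qed.

Lemma signed_cperm s : is_signed (cperm s).
Proof. by apply/is_signedP=> i b; rewrite !cpermE. Qed.

(* Coordinates are numbered from 0; coord_tperm i j and flip i are the identity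
   if an index is out of range. *)
Definition coord_tperm (i j : nat) : 'S_n :=
  if (insub i, insub j) is (Some x, Some y) then tperm x y else 1%g.

Definition flip (i : nat) : sperm n :=
  if insub i is Some x then tperm (x, false) (x, true) else 1%g.

(* With coordinates numbered from 0, the pair of index i is {2i, 2i+1}. *)
Definition gen_a (i : nat) : sperm n := cperm (coord_tperm (2 * i) (2 * i).+1).

Definition gen_c (i : nat) : sperm n := (flip (2 * i) * flip (2 * i).+1)%g.

Definition gen_b (i : nat) : sperm n :=
  cperm (coord_tperm (2 * i) (2 * i.+1)
         * coord_tperm (2 * i).+1 (2 * i.+1).+1)%g.

Definition Cgroup (k : nat) : {group sperm n} :=
  <<[set gen_a i | i : 'I_k] :|: [set gen_c i | i : 'I_k]
    :|: [set gen_b i | i : 'I_k & (i.+1 < k)%N]>>%G.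

(* The coordinates after the first 2k; there are q of them if n = 2k + q. *)
Definition tail (k : nat) : {set 'I_n} := [set x : 'I_n | (2 * k <= x)%N].

(* perm.Sym A is the group of permutations supported on A (the unqualified name
   is shadowed by the full symmetric group of a type). *)
Definition tail_sym (k : nat) : {group sperm n} :=
  (cperm_morphism @* perm.Sym (tail k))%G.

Definition perm_sign (s : 'S_n) : algC := (-1) ^+ (s : bool).

Lemma perm_sign1 : perm_sign 1%g = 1.
Proof. by rewrite /perm_sign odd_perm1. Qed.

Lemma perm_signM k : {in perm.Sym (tail k) &,
  {morph perm_sign : s t / (s * t)%g >-> s * t}}.
Proof. by move=> s t _ _; rewrite /perm_sign odd_permM signr_addb. Qed.

Definition sgn_unsigned (k : nat) : 'CF(perm.Sym (tail k)) :=
  lin_cfun perm_sign1 (@perm_signM k).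

Lemma tail_isom k : isom (perm.Sym (tail k)) (tail_sym k)
                         (restrm (subsetT (perm.Sym (tail k))) cperm).
Proof.
apply/isomP; split; last by rewrite morphim_restrm setIid.
by apply/injmP=> s t _ _; apply: cpermI.
Qed.

Definition sgn_tail (k : nat) : 'CF(tail_sym k) :=
  cfIsom (tail_isom k) (sgn_unsigned k).

Lemma sgn_tailE k s : s \in perm.Sym (tail k) ->
  sgn_tail k (cperm s) = (-1) ^+ (s : bool).
Proof.
by move=> Ss; rewrite /sgn_tail (cfIsomE (tail_isom k)) // lin_cfunE.
Qed.

Definition head_fix (k : nat) : {set 'I_n * bool} := [set x : 'I_n * bool | (x.1 < 2 * k)%N].

Lemma coord_tpermD i j (x : 'I_n) : x != i :> nat -> x != j :> nat -> coord_tperm i j x = x.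
Proof.
rewrite /coord_tperm; case: insubP => [y _ <-|_]; last by rewrite perm1.
case: insubP => [z _ <-|_]; last by rewrite perm1.
by move=> ny nz; rewrite tpermD // eq_sym.
Qed.

Lemma flipD i (x : 'I_n * bool) : x.1 != i :> nat -> flip i x = x.
Proof.
rewrite /flip; case: insubP => [y _ <-|_]; last by rewrite perm1.
case: x => x b /= ne; rewrite tpermD // xpair_eqE negb_and.
  by rewrite [y == x]eq_sym ne.
by rewrite [y == x]eq_sym ne.
Qed.

Lemma C_head k : Cgroup k \subset perm.Sym (head_fix k).
Proof.
rewrite gen_subG; apply/subsetP=> w; rewrite inE => hw; rewrite inE.
apply/subsetP=> -[x b]; apply: contraR; rewrite inE /= -leqNgt => hx; apply/eqP.
have lt (i : 'I_k) : ((2 * i).+1 < x)%N.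
  by apply: leq_trans hx; rewrite -[(2 * i).+2]add2n -mulnS leq_mul2l /= ltn_ord.
have ne1 (i : 'I_k) : x != (2 * i)%N :> nat by rewrite neq_ltn (ltnW (lt i)) orbT.
have ne2 (i : 'I_k) : x != (2 * i).+1%N :> nat by rewrite neq_ltn (lt i) orbT.
case/orP: hw => [hw|].
  case/setUP: hw => /imsetP[i _ ->]; first by rewrite cpermE coord_tpermD.
  by rewrite permM !flipD.
case/imsetP=> i; rewrite inE => hi ->; have /= n1 := ne1 (Ordinal hi); have /= n2 := ne2 (Ordinal hi).
by rewrite cpermE permM !coord_tpermD.
Qed.

Lemma tail_sym_fix k w : w \in tail_sym k ->
  exists2 s, s \in perm.Sym (tail k) & w = cperm s.
Proof. by case/morphimP=> s _ Ss ->; exists s. Qed.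

Lemma C_tail_dprod k : Cgroup k \x tail_sym k = Cgroup k <*> tail_sym k.
Proof.
have fixC w (x : 'I_n) b : w \in Cgroup k -> (2 * k <= x)%N -> w (x, b) = (x, b).
  move/(subsetP (C_head k)); rewrite inE => hw hx.
  by apply: (out_perm hw); rewrite inE /= -leqNgt.
have fixS s (x : 'I_n) : s \in perm.Sym (tail k) -> (x < 2 * k)%N -> s x = x.
  by rewrite inE => hs hx; apply: (out_perm hs); rewrite inE -ltnNge.
apply: dprodEY.
  apply/centsP=> v /tail_sym_fix[s Ss ->] w Cw; apply/permP=> -[x b].
  have Hw := subsetP (C_head k) _ Cw; rewrite inE in Hw.
  rewrite !permM cpermE; have [hx|hx] := leqP (2 * k) x.
    rewrite (fixC _ _ _ Cw hx) cpermE fixC //.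
    by move: Ss; rewrite inE => hs; have := perm_closed x hs; rewrite !inE hx.
  rewrite fixS //; have := perm_closed (x, b) Hw; rewrite !inE /= hx.
  by case: (w (x, b)) => y c /= hy; rewrite cpermE fixS.
apply/trivgP/subsetP=> w /setIP[Cw /tail_sym_fix[s Ss ew]].
rewrite inE; apply/eqP/permP=> -[x b]; rewrite perm1.
have [hx|hx] := leqP (2 * k) x; first exact: fixC.
by rewrite ew cpermE fixS.
Qed.

Definition layer_char (k : nat) : 'CF(Cgroup k <*> tail_sym k) :=
  cfDprod (C_tail_dprod k) 1 (sgn_tail k).

End SignedPerm.

(* The character eta_m of C_m, as a subgroup of D_2m.  Sign changes of elements
   of C_m come in pairs {2i, 2i+1} and each gen_c contributes one such pair;
   see etaP for the defining properties. *)
Section Eta.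
Variable m : nat.
Local Notation n := (2 * m)%N.
Implicit Types v w : sperm n.

Definition eta_fun w : algC := (-1) ^+ (sign_changes w)./2.

Lemma partner_subproof (x : 'I_n) : ((if odd x then x.-1 else x.+1) < n)%N.
Proof.
case: x => x /=; case: ifP => ox hx; first exact: leq_ltn_trans (leq_pred x) hx.
rewrite ltn_neqAle hx andbT; apply/eqP=> e.
by have := congr1 odd e; rewrite /= ox oddM.
Qed.

Definition partner (x : 'I_n) : 'I_n := Ordinal (partner_subproof x).

Lemma partnerK : involutive partner.
Proof.
move=> x; apply: val_inj => /=; case: x => x _ /=.
by case ox: (odd x); rewrite /= ?ox //; case: x ox => //= y /negPf->.
Qed.

Lemma odd_partner x : odd (partner x) = ~~ odd x.
Proof.
by case: x => x _ /=; case ox: (odd x); rewrite /= ?ox //; case: x ox => //= y /negPf->.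
Qed.

Definition paired w := [forall x, [forall b,
  w (partner x, b) == (partner (w (x, b)).1, (w (x, b)).2)]].

Lemma pairedP w : reflect
  (forall x b, w (partner x, b) = (partner (w (x, b)).1, (w (x, b)).2)) (paired w).
Proof.
apply: (iffP forallP) => [h x b|h x]; first by have /forallP/(_ b)/eqP := h x.
by apply/forallP=> b; apply/eqP.
Qed.

Definition paired_set := [set w : sperm n | is_signed w & paired w].

Lemma paired_group_set : group_set paired_set.
Proof.
apply/group_setP; split=> [|v w].
  by rewrite inE signed1; apply/pairedP=> x b; rewrite !perm1.
rewrite !inE => /andP[hv pv] /andP[hw pw]; rewrite signedM //.
apply/pairedP=> x b; rewrite !permM (pairedP _ pv).
by case: (v (x, b)) => y c /=; rewrite (pairedP _ pw).
Qed.

Canonical paired_group := Group paired_group_set.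

Lemma sum_paired (F : 'I_n -> nat) : (forall x, F (partner x) = F x) ->
  (\sum_x F x = (\sum_(x | ~~ odd (x : 'I_n)) F x).*2)%N.
Proof.
move=> hF; rewrite (bigID (fun x : 'I_n => odd x)) /= addnC -addnn; congr addn.
rewrite (reindex_inj (inv_inj partnerK)) /=.
by apply: eq_big => x; [exact: odd_partner | rewrite hF].
Qed.

Definition half_changes w := (\sum_(x | ~~ odd (x : 'I_n)) (w (x, false)).2)%N.

Lemma half_changesE w : w \in paired_group -> sign_changes w = (half_changes w).*2.
Proof.
rewrite inE => /andP[_ /pairedP pw]; rewrite sign_changesE.
by rewrite sum_paired // => x; rewrite pw.
Qed.

Lemma eta_funE w : w \in paired_group -> eta_fun w = (-1) ^+ half_changes w.
Proof. by move=> Qw; rewrite /eta_fun half_changesE // doubleK. Qed.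

Lemma odd_half_changesM v w : v \in paired_group -> w \in paired_group ->
  odd (half_changes (v * w)%g) = odd (half_changes v) (+) odd (half_changes w).
Proof.
move=> Qv Qw; have := Qv; have := Qw; rewrite !inE.
move=> /andP[hw /pairedP pw] /andP[hv /pairedP pv].
pose F x : nat := (w ((v (x, false)).1, false)).2.
have -> : odd (half_changes w) = odd (\sum_(x | ~~ odd (x : 'I_n)) F x)%N.
  congr odd; apply: double_inj; rewrite -!sum_paired => [|x|x].
  - by rewrite [LHS](reindex_inj (signed_abs_inj hv)).
  - by rewrite pw.
  - by rewrite /F pv /= pw.
rewrite /half_changes.
have oddS (f : 'I_n -> nat) : odd (\sum_(x | ~~ odd (x : 'I_n)) f x)%N
    = \big[addb/false]_(x | ~~ odd (x : 'I_n)) odd (f x).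
  exact: (big_morph odd oddD).
rewrite !oddS -big_split /=; apply: eq_bigr => x _.
by rewrite !oddb permM [v _]surjective_pairing signedE.
Qed.

Lemma eta_funM_Q : {in paired_group &, {morph eta_fun : v w / (v * w)%g >-> v * w}}.
Proof.
move=> v w Qv Qw; rewrite !eta_funE ?groupM // -signr_odd odd_half_changesM //.
by rewrite signr_addb !signr_odd.
Qed.

Lemma cpermJ_eq (g w : sperm n) : (w ^ g)%g = w -> forall x, w (g x) = g (w x).
Proof. by move=> e x; rewrite -{1}e permJ. Qed.

Let pp : 'S_n := perm (inv_inj partnerK).
Let PP : sperm n := cperm pp.

Lemma sneg_inj : injective (@sneg n).
Proof. by move=> [x b] [y c] [-> /negb_inj ->]. Qed.
Let SN : sperm n := perm sneg_inj.

Lemma mem_Q w : (w ^ SN)%g = w -> (w ^ PP)%g = w -> w \in paired_group.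
Proof.
move=> /cpermJ_eq hs /cpermJ_eq hp; rewrite inE; apply/andP; split.
  by apply/is_signedP=> i b; have := hs (i, b); rewrite !permE.
apply/pairedP=> x b; have := hp (x, b); rewrite cpermE permE => ->.
by case: (w (x, b)) => y c; rewrite cpermE permE.
Qed.

Lemma mem_Q_cperm (s : 'S_n) : (s ^ pp)%g = s -> cperm s \in paired_group.
Proof.
move=> hs; apply: mem_Q; last first.
  by rewrite /PP -(morphJ (cperm_morphism n)) ?inE //= hs.
apply/conjg_fixP/commgP/permP=> -[i b].
by rewrite !permM !permE.
Qed.

Lemma ev_subproof (i : 'I_m) : (2 * i < n)%N.
Proof. by rewrite ltn_mul2l /=. Qed.
Definition ev i : 'I_n := Ordinal (ev_subproof i).

Lemma partner_ev i : partner (ev i) = (2 * i).+1 :> nat.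
Proof. by rewrite /= oddM. Qed.

Lemma coord_tpermE (x y : 'I_n) : coord_tperm n x y = tperm x y.
Proof. by rewrite /coord_tperm !valK. Qed.

Lemma flipE (x : 'I_n) : flip n x = tperm (x, false) (x, true).
Proof. by rewrite /flip valK. Qed.

Lemma gen_aE (i : 'I_m) : gen_a n i = cperm (tperm (ev i) (partner (ev i))).
Proof. by rewrite /gen_a -coord_tpermE partner_ev. Qed.

Lemma gen_bE (i j : 'I_m) : j = i.+1 :> nat -> gen_b n i =
  cperm (tperm (ev i) (ev j) * tperm (partner (ev i)) (partner (ev j)))%g.
Proof. by move=> e; rewrite /gen_b -!coord_tpermE !partner_ev /= e. Qed.

Lemma gen_cE (i : 'I_m) : gen_c n i =
  (tperm (ev i, false) (ev i, true)
   * tperm (partner (ev i), false) (partner (ev i), true))%g.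
Proof. by rewrite /gen_c -!flipE partner_ev. Qed.

Lemma tperm_comm (T : finType) (x y z t : T) :
  x != z -> x != t -> y != z -> y != t ->
  (tperm x y * tperm z t = tperm z t * tperm x y)%g.
Proof.
move=> xz xt yz yt; apply/commgP/conjg_fixP.
by rewrite tpermJ !tpermD // eq_sym.
Qed.

Lemma ev_partner i j : (ev i == partner (ev j)) = false.
Proof.
apply/negP=> /eqP e; have := odd_partner (ev j).
by rewrite -e /= !oddM.
Qed.

Lemma C_sub_Q : Cgroup n m \subset paired_group.
Proof.
rewrite gen_subG; apply/subsetP=> w; rewrite inE; case/orP=> [/setUP[]|].
- case/imsetP=> i _ ->; rewrite gen_aE; apply: mem_Q_cperm.
  by rewrite tpermJ !permE partnerK tpermC.
- case/imsetP=> i _ ->; rewrite gen_cE; apply: mem_Q.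
    by rewrite conjMg !tpermJ !permE /sneg /= ![tperm (_, true) _]tpermC.
  rewrite conjMg !tpermJ !cpermE !permE partnerK.
  by apply: tperm_comm; rewrite xpair_eqE eq_sym ev_partner.
case/imsetP=> i; rewrite inE => hi ->; rewrite (@gen_bE i (Ordinal hi)) //.
apply: mem_Q_cperm; rewrite conjMg !tpermJ !permE !partnerK.
by apply: tperm_comm; rewrite eq_sym ev_partner.
Qed.

Lemma eta_fun1 : eta_fun 1%g = 1.
Proof. by rewrite /eta_fun sign_changesE big1 // => i _; rewrite perm1. Qed.

Lemma eta_funM : {in Cgroup n m &, {morph eta_fun : v w / (v * w)%g >-> v * w}}.
Proof. exact: (sub_in2 (subsetP C_sub_Q)) eta_funM_Q. Qed.

Definition eta : 'CF(Cgroup n m) := lin_cfun eta_fun1 eta_funM.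

Lemma eta_cperm s : eta_fun (cperm s) = 1.
Proof. by rewrite /eta_fun sign_changesE big1 // => i _; rewrite cpermE. Qed.

Lemma gen_aC (i : 'I_m) : gen_a n i \in Cgroup n m.
Proof. by apply: mem_gen; rewrite !inE (imset_f (fun i : 'I_m => gen_a n i)). Qed.

Lemma gen_cC (i : 'I_m) : gen_c n i \in Cgroup n m.
Proof. by apply: mem_gen; rewrite !inE (imset_f (fun i : 'I_m => gen_c n i)) ?orbT. Qed.

Lemma gen_bC (i : 'I_m) : (i.+1 < m)%N -> gen_b n i \in Cgroup n m.
Proof.
move=> hi; apply: mem_gen; rewrite !inE.
by rewrite (imset_f (fun i : 'I_m => gen_b n i)) ?inE ?hi ?orbT.
Qed.

Lemma sign_changes_c (i : 'I_m) : sign_changes (gen_c n i) = 2.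
Proof.
have ne : ev i != partner (ev i) by rewrite ev_partner.
rewrite /sign_changes -[RHS]/(true.+1)%N -ne -cards2; congr #|pred_of_set _|.
apply/setP=> x; rewrite !inE gen_cE permM.
have [->|nx] := eqVneq x (ev i).
  by rewrite tpermL tpermD // xpair_eqE eq_sym ev_partner.
rewrite [X in (tperm _ _ X).2]tpermD ?xpair_eqE ?[ev i == _]eq_sym ?(negPf nx) //.
have [->|np] := eqVneq x (partner (ev i)); first by rewrite tpermL.
by rewrite tpermD // xpair_eqE eq_sym (negPf np).
Qed.

(* The generators of C_m determine a linear character, so eta is the character
   with eta(gen_a) = eta(gen_b) = 1 and eta(gen_c) = -1. *)
Lemma etaP :
  [/\ eta \is a linear_char,
      forall i, (i < m)%N -> eta (gen_a n i) = 1,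
      forall i, (i.+1 < m)%N -> eta (gen_b n i) = 1
    & forall i, (i < m)%N -> eta (gen_c n i) = -1].
Proof.
split=> [|i hi|i hi|i hi]; first exact: lin_cfun_lin.
- have /= Ca := gen_aC (Ordinal hi).
  by rewrite lin_cfunE // /gen_a eta_cperm.
- have /= Cb := @gen_bC (Ordinal (ltnW hi)) hi.
  by rewrite lin_cfunE // /gen_b eta_cperm.
have /= Cc := gen_cC (Ordinal hi).
by rewrite lin_cfunE // /eta_fun (sign_changes_c (Ordinal hi)) expr1.
Qed.

Definition Egroup : {group sperm n} := cfker_group eta.

End Eta.

(* Partitions of n, written as nonincreasing sequences of positive parts padded
   with zeros to length n. *)
Definition num_part (n : nat) : nat :=
  #|[set t : n.-tuple 'I_n.+1 |
      sorted geq (map val t) & (\sum_(x <- t) x)%N == n]|.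

Definition a_num (m : nat) : nat :=
  (\sum_(i < m.+1) num_part i * num_part (m - i))%N.

Definition d_num (m : nat) : nat := if odd m then 0%N else num_part m./2.

(* Rational valued, so that neither the subtraction nor the division by 2 is
   truncated. *)
Definition r_num (m : nat) : rat :=
  ((a_num m)%:R + 2 * (num_part m)%:R - 3 * (d_num m)%:R) / 2.

(* Main.v *)
(* For a character [(-1)^b] of [H], let [e_b] be its idempotent.  If every
   [g \in G] is either of the form [h^-1 z] with [h \in H] and [z] an involution,
   or satisfies [b h != b (h ^ g)] for some [h \in H :&: H :^ g^-1], then
   [e_b g e_b = e_b g^-1 e_b] for all [g], so the corner of [e_b] is commutative
   and every irreducible representation meets [e_b] in rank at most one.  For the
   layers this dichotomy is a statement about two involutions [s] and [t = s^g]
   of signed points, analysed on the orbits of the dihedral group they generate.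

   The idempotent of [E_m] is the sum of those of the trivial character and of
   [eta], both of rank at most one everywhere, so its rank in an irreducible
   representation is 0, 1 or 2.  The numbers of irreducibles of each kind follow
   from the identity [sum_i rank_i(e_b) rank_i(e_b') = #] of double cosets
   [C g C] with [b h = b' (h ^ g)] on [C :&: C :^ g^-1].  The double cosets of
   [C_m] in the hyperoctahedral group correspond to the conjugacy classes of the
   signed permutations [p] of [m] coordinates, that is to pairs of partitions
   (positive and negative cycles) of total size [m].  The one of [p] lies in the
   group of type D if the number of negative cycles is even; it supports
   [(eta, eta)] if there is no negative cycle, and [(1, eta)] if moreover all
   cycles have even length.  Counting these gives [(a_m + d_m) / 2], [p(m)] and
   [d_m] respectively. *)
Require Import Defs.
From HB Require Import structures.
From mathcomp Require Import all_boot all_order all_algebra all_fingroup.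
From mathcomp Require Import all_solvable all_field all_character.
From mathcomp Require Import reals complex ring.

Set Implicit Arguments.
Unset Strict Implicit.
Unset Printing Implicit Defensive.

Import GroupScope Order.TTheory GRing.Theory Num.Theory.

Local Open Scope ring_scope.

(** * Corners of the group algebra *)

(** Ranks of idempotents carry the argument because they make sense over any [numClosedFieldType]:
    the same lemmas give multiplicities over [algC] and the Hecke algebra over [R[i]], while the
    three counts of double cosets mention no field. The obstacle is the sign. The involutions [s]
    and [t = s ^ g] act on signed points, where a cycle of [t * s] may or may not contain the
    negatives of its points. Everything is therefore stated for permutations commuting with a
    fixed-point-free involution [nu], on orbits of the group generated by [t * s] and [nu]. The
    conditions [s x != nu x] and [t x != nu x] forbid a reflection to agree with [nu] at a point;
    all arguments at the midpoint of an orbit rest on them. The number [d_m] enters for two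
    different reasons: among the bipartitions with evenly many negative parts it counts partitions
    of [m] with all multiplicities even, and for the pair [(1, eta)] those with all parts even.
    Writing [N1], [N2], [N12] for the counts of the trivial character, of [eta] and of the mixed
    pair, the coefficients 5 and -3 of [d_m] come from [N1 + N2 + 2 N12] and [N1 + N2 - 2 N12]. *)

Section IdempotentRank.
Variables (F : fieldType) (n : nat).

(** Cancelling the full-rank factors on both sides of [P Q P Q = P Q] leaves [Q P = 1]. Hence
    [W |-> P W Q] identifies the matrices of size [\rank E] with the corner of [E]. *)
Lemma idem_factor (E : 'M[F]_n) : E *m E = E ->
  row_base E *m col_base E = 1%:M.
Proof.
move=> idE; have := mulmx_base E.
move: (row_base_free E) (col_base_full E).
move: (\rank E) (row_base E) (col_base E) => r Q P /row_freeP[X rX] /row_fullP[Y cY] defE.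
transitivity (Y *m (E *m E) *m X); last first.
  by rewrite idE -defE -!mulmxA rX mulmx1.
by rewrite -defE !mulmxA cY mul1mx -!mulmxA rX mulmx1.
Qed.

Lemma mxtrace_idem (E : 'M[F]_n) : E *m E = E -> \tr E = (\rank E)%:R.
Proof.
move=> idE; have := mulmx_base E; have := idem_factor idE.
move: (\rank E) (row_base E) (col_base E) => r Q P QP <-.
by rewrite mxtrace_mulC QP mxtrace1.
Qed.

(** The corner is a full matrix algebra of size [\rank E]; from size two on, the matrix units at
    [(0, 1)] and [(1, 0)] do not commute. *)
Lemma comm_corner_rank (E : 'M[F]_n) : E *m E = E ->
  (forall X Y : 'M_n, E *m X *m E *m (E *m Y *m E)
                      = E *m Y *m E *m (E *m X *m E)) ->
  (\rank E <= 1)%N.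
Proof.
move=> idE cE; have := idem_factor idE; have := mulmx_base E.
move: (\rank E) (row_base E) (col_base E) => r Q P defE QP.
have EP : E *m P = P by rewrite -defE -mulmxA QP mulmx1.
have QE : Q *m E = Q by rewrite -defE mulmxA QP mul1mx.
have cM (U V : 'M[F]_r) : U *m V = V *m U.
  have corner (W : 'M_r) : E *m (P *m W *m Q) *m E = P *m W *m Q.
    by rewrite !mulmxA EP -mulmxA QE.
  have cornerM (W W' : 'M_r) :
      P *m W *m Q *m (P *m W' *m Q) = P *m (W *m W') *m Q.
    by rewrite -!mulmxA (mulmxA Q) QP mul1mx.
  have := cE (P *m U *m Q) (P *m V *m Q); rewrite !corner !cornerM.
  move/(congr1 (fun Z => Q *m Z *m P)).
  by rewrite !mulmxA QP !mul1mx -!(mulmxA _ Q P) QP !mulmx1.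
rewrite leqNgt; apply/negP=> r2.
pose i0 := Ordinal (ltnW r2); pose i1 := Ordinal r2.
have /matrixP/(_ i0 i0) := cM (delta_mx i0 i1) (delta_mx i1 i0).
rewrite !mul_delta_mx !mxE !eqxx /=.
by move/eqP; rewrite oner_eq0.
Qed.

End IdempotentRank.

Lemma eq_sign_eq0 (F : numClosedFieldType) (V : lmodType F) (a b : bool) (v : V) :
  a != b -> (-1) ^+ a *: v = (-1) ^+ b *: v -> v = 0.
Proof.
have two_neq0 : (2 : F) != 0 by rewrite pnatr_eq0.
have opp_eq0 : v = - v -> v = 0.
  move=> e; have /eqP : v + v = 0 by rewrite {1}e addNr.
  by rewrite -mulr2n -scaler_nat scaler_eq0 (negPf two_neq0) => /eqP.
by case: a b => [] [] // _; rewrite expr1 expr0 scaleN1r scale1r; [move/esym|];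
  apply: opp_eq0.
Qed.

(** * Idempotents of sign characters and the Gelfand trick *)

Section SignIdempotent.
Variables (F : numClosedFieldType) (gT : finGroupType) (G H : {group gT}).
Variables (n : nat) (rG : mx_representation F G n).
Hypothesis sHG : H \subset G.

(** The idempotent of the character [h |-> (-1) ^+ b h], whose values are their own inverses;
    [sign_hom] below expresses its multiplicativity. *)
Definition sign_idem (b : gT -> bool) : 'M[F]_n :=
  locked (#|H|%:R^-1 *: \sum_(h in H) (-1) ^+ b h *: rG h).

Lemma sign_idemE b :
  sign_idem b = #|H|%:R^-1 *: \sum_(h in H) (-1) ^+ b h *: rG h.
Proof. by rewrite /sign_idem -lock. Qed.

Definition sign_hom (b : gT -> bool) : Prop :=
  {in H &, {morph b : x y / (x * y)%g >-> x (+) y}}.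

Lemma sign_hom1 b : sign_hom b -> b 1%g = false.
Proof. by move=> hb; have := hb 1%g 1%g (group1 H) (group1 H); rewrite mulg1; case: (b _). Qed.

Lemma sign_homV b : sign_hom b -> {in H, forall x, b x^-1%g = b x}.
Proof.
move=> hb x Hx; have := hb x x^-1%g Hx (groupVr Hx).
by rewrite mulgV sign_hom1 //; case: (b x); case: (b _).
Qed.

Lemma repr_sign_idem b x : sign_hom b -> x \in H ->
  rG x *m sign_idem b = (-1) ^+ b x *: sign_idem b.
Proof.
move=> hb Hx; rewrite sign_idemE -scalemxAr scalerA mulrC -scalerA; congr (_ *: _).
rewrite mulmx_sumr scaler_sumr [RHS](reindex_inj (mulgI x)) /=.
apply: eq_big => y; first by rewrite groupMl.
move=> Hy; rewrite -scalemxAr repr_mxM ?(subsetP sHG) // hb // signr_addb.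
by rewrite scalerA mulrA -expr2 sqrr_sign mul1r.
Qed.

Lemma sign_idem_repr b x : sign_hom b -> x \in H ->
  sign_idem b *m rG x = (-1) ^+ b x *: sign_idem b.
Proof.
move=> hb Hx; rewrite sign_idemE -scalemxAl scalerA mulrC -scalerA; congr (_ *: _).
rewrite mulmx_suml scaler_sumr [RHS](reindex_inj (mulIg x)) /=.
apply: eq_big => y; first by rewrite groupMr.
move=> Hy; rewrite -scalemxAl repr_mxM ?(subsetP sHG) // hb // signr_addb.
by rewrite scalerA mulrCA -expr2 sqrr_sign mulr1.
Qed.

Lemma natrG_neq0 : #|H|%:R != 0 :> F.
Proof. by rewrite pnatr_eq0 -lt0n cardG_gt0. Qed.

Lemma sign_idemK b : sign_hom b -> sign_idem b *m sign_idem b = sign_idem b.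
Proof.
move=> hb; rewrite {1}sign_idemE -scalemxAl mulmx_suml.
rewrite (eq_bigr (fun _ => sign_idem b)) => [|h Hh]; last first.
  by rewrite -scalemxAl repr_sign_idem // scalerA -expr2 sqrr_sign scale1r.
by rewrite sumr_const -scaler_nat scalerA mulVf ?natrG_neq0 // scale1r.
Qed.

(* Under these conditions [e g e = e g^-1 e] for every [g], where [e] is the
   idempotent of the character, so inversion is an anti-automorphism of the
   group algebra that fixes the corner of [e] pointwise: it is commutative. *)
Definition gelfand_trick (b : gT -> bool) : Prop := forall g, g \in G ->
  (exists2 h, h \in H & (h * g) * (h * g) = 1)%g \/
  (exists h, [/\ h \in H, (h ^ g)%g \in H & b h != b (h ^ g)%g]).

Variable b : gT -> bool.
Hypotheses (hb : sign_hom b) (gb : gelfand_trick b).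
Local Notation E := (sign_idem b).

(** If [h g] squares to 1, then [g = h^-1 g^-1 h^-1], and the outer idempotents absorb the two
    factors [h^-1] with equal signs. Otherwise [h g = g (h ^ g)] multiplies [e g e] by two different
    signs, so it vanishes, and [(h ^ g) g^-1 = g^-1 h] kills [e g^-1 e] likewise. *)
Lemma corner_inv g : g \in G -> E *m rG g *m E = E *m rG g^-1%g *m E.
Proof.
move=> Gg; have Ginv := groupVr Gg; case: (gb Gg) => [[h Hh hg1]|[h [Hh Hhg ne]]].
  have {1}-> : g = (h^-1 * g^-1 * h^-1)%g.
    apply: (mulgI h); rewrite !mulgA mulgV mul1g -invMg.
    by apply/eqP; rewrite eq_sym eq_invg_mul hg1.
  have Hh' := groupVr Hh; have Gh' := subsetP sHG _ Hh'.
  rewrite !repr_mxM ?groupM // !mulmxA sign_idem_repr //.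
  rewrite -!scalemxAl -!(mulmxA _ _ E) repr_sign_idem // -!scalemxAr scalerA.
  by rewrite -expr2 sqrr_sign scale1r mulmxA.
have Gh := subsetP sHG _ Hh; have Ghg := subsetP sHG _ Hhg.
have vanish x : x \in G -> E *m rG (h * x)%g *m E = E *m rG (x * h ^ g)%g *m E ->
    E *m rG x *m E = 0.
  move=> Gx; rewrite (repr_mxM rG Gh Gx) (repr_mxM rG Gx Ghg) !mulmxA (sign_idem_repr hb Hh).
  rewrite -!scalemxAl -!(mulmxA _ _ E) (repr_sign_idem hb Hhg) -!scalemxAr.
  by rewrite -!mulmxA; apply: (eq_sign_eq0 ne).
rewrite (vanish g Gg); last by rewrite -(conjgC h g).
have h0 : E *m rG (h ^ g)%g *m rG g^-1%g *m E = E *m rG g^-1%g *m rG h *m E.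
  rewrite -!(mulmxA E) -(repr_mxM rG Ghg Ginv) -(repr_mxM rG Ginv Gh).
  by rewrite conjgE -!mulgA mulgV mulg1.
move: h0; rewrite (sign_idem_repr hb Hhg) -!(mulmxA _ _ E) (repr_sign_idem hb Hh).
rewrite -!scalemxAl -!scalemxAr.
by rewrite -!mulmxA => e; rewrite (eq_sign_eq0 _ e) // eq_sym.
Qed.

(** The product of the corners of [x] and [y] is a signed average of the corners of [x h y].
    Inverting each of these by [corner_inv] reverses the order of the factors, and [h |-> h^-1]
    preserves both the average and the signs. *)
Lemma corner_comm x y : x \in G -> y \in G ->
  E *m rG x *m E *m (E *m rG y *m E) = E *m rG y *m E *m (E *m rG x *m E).
Proof.
have expand u v : u \in G -> v \in G -> E *m rG u *m E *m (E *m rG v *m E)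
    = #|H|%:R^-1 *: \sum_(h in H) (-1) ^+ b h *: (E *m rG (u * h * v)%g *m E).
  move=> Gu Gv; rewrite -!mulmxA (mulmxA E E) sign_idemK //.
  rewrite {2}sign_idemE -!scalemxAl -!scalemxAr mulmx_suml !mulmx_sumr.
  congr (_ *: _); apply: eq_bigr => h Hh; have Gh := subsetP sHG _ Hh.
  by rewrite -!scalemxAl -!scalemxAr !repr_mxM ?groupM // !mulmxA.
move=> Gx Gy; have Gx' := groupVr Gx; have Gy' := groupVr Gy.
rewrite [X in _ = X *m _]corner_inv // [X in _ = _ *m X]corner_inv // !expand //.
congr (_ *: _); rewrite [RHS](reindex_inj invg_inj) /=.
apply: eq_big => h; first by rewrite groupV.
move=> Hh; have Gh := subsetP sHG _ Hh; rewrite (sign_homV hb) // corner_inv ?groupM //.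
by rewrite !invMg mulgA.
Qed.

(** By Burnside's theorem the group elements span all matrices, so commutation of their corners
    makes the whole corner commutative. *)
Lemma gelfand_trick_rank : mx_absolutely_irreducible rG -> (\rank E <= 1)%N.
Proof.
case/mx_abs_irrP=> n_gt0 [a aE]; apply: comm_corner_rank; first exact: sign_idemK.
have expand X : E *m X *m E = \sum_(x in G) a x X *: (E *m rG x *m E).
  rewrite {1}[X]aE mulmx_sumr mulmx_suml; apply: eq_bigr => x Gx.
  by rewrite -scalemxAr -scalemxAl.
move=> X Y; rewrite !expand !mulmx_suml.
under eq_bigr => x Gx do rewrite mulmx_sumr.
under [RHS]eq_bigr => x Gx do rewrite mulmx_sumr.
rewrite exchange_big /=; apply: eq_bigr => y Gy; apply: eq_bigr => x Gx.
by rewrite -!scalemxAl -!scalemxAr corner_comm // !scalerA mulrC.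
Qed.

End SignIdempotent.

(** The simple components of the regular module index the irreducibles over an arbitrary closed
    field. *)
Definition closed_irrType (F : closedFieldType) (gT : finGroupType)
  (G : {group gT}) : irrType F G := DecSocleType (regular_repr F G).

(** * Fourier inversion on the group algebra *)

Section Fourier.
Variables (F : numClosedFieldType) (gT : finGroupType) (G : {group gT}).
Local Notation sG := (closed_irrType F G).
Implicit Type i : sG.
Local Notation aG := (regular_repr F G).
Local Notation R_G := (group_ring F G).
Local Notation "''n_' i" := (irr_degree i) : ring_scope.

Lemma pchar'_group : [pchar F]^'.-group G.
Proof.
by apply/pgroupP=> p p_pr _; rewrite inE /= (pchar_num F) .
Qed.
Let F'G := pchar'_group.

Lemma irr_abs_irr i : mx_absolutely_irreducible (irr_repr i).
Proof. exact/group_closure_closed_field/socle_irr. Qed.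

(** A section of the projection to block [i]: [pinvmx] picks some element of the group algebra
    acting as [Y] in [irr_repr i], and the central idempotent removes its action in all other
    irreducibles. *)
Definition fourier_inv i (Y : 'M[F]_('n_i)) : 'M[F]_#|G| :=
  Wedderburn_id i *m
    gring_mx aG (mxvec Y *m pinvmx (enveloping_algebra_mx (irr_repr i))).

Arguments fourier_inv : clear implicits.

Fact fourier_inv_is_linear i : linear (fourier_inv i).
Proof.
by move=> a X Y; rewrite /fourier_inv linearP mulmxDl -scalemxAl linearP
  mulmxDr -scalemxAr.
Qed.
HB.instance Definition _ i :=
  GRing.isLinear.Build F 'M[F]_('n_i) 'M[F]_#|G| _ (fourier_inv i)
    (@fourier_inv_is_linear i).

Lemma Wedderburn_id_gring i : (Wedderburn_id i \in R_G)%MS.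
Proof. by rewrite -(Wedderburn_sum sG F'G) (sumsmx_sup i) ?Wedderburn_id_mem. Qed.

Lemma fourier_inv_gring i Y : (fourier_inv i Y \in R_G)%MS.
Proof. by rewrite envelop_mxM ?Wedderburn_id_gring ?gring_mxP. Qed.

Lemma fourier_invK i Y : gring_op (irr_repr i) (fourier_inv i Y) = Y.
Proof.
rewrite gring_opM ?gring_mxP // (op_Wedderburn_id F'G) mul1mx gring_op_mx.
rewrite /gring_mx /= mulmxKpV ?mxvecK //.
by case/andP: (irr_abs_irr i) => _; rewrite -sub1mx => /(submx_trans (submx1 _)).
Qed.

Lemma fourier_inv_neq i j (Y : 'M_('n_i)) : i != j ->
  gring_op (irr_repr j) (fourier_inv i Y) = 0.
Proof.
move=> ne; rewrite gring_opM ?gring_mxP //.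
by rewrite (irr_repr'_op0 F'G ne) ?Wedderburn_id_mem ?mul0mx.
Qed.

(** The central idempotents sum to 1, and each Wedderburn block acts faithfully in its own
    irreducible representation. *)
Lemma fourier_inj A B : (A \in R_G)%MS -> (B \in R_G)%MS ->
  (forall i, gring_op (irr_repr i) A = gring_op (irr_repr i) B) -> A = B.
Proof.
move=> RA RB eqAB; rewrite -[A]mul1mx -[B]mul1mx -(Wedderburn_sum_id sG F'G).
rewrite !mulmx_suml; apply: eq_bigr => i _.
have Wi (C : 'M_#|G|) : (C \in R_G)%MS ->
    (Wedderburn_id i *m C \in Wedderburn_subring i)%MS.
  move=> RC; have /andP[_ /mulsmx_subP idr] := Wedderburn_ideal i.
  by apply: idr => //; apply: Wedderburn_id_mem.
have := regular_op_inj_pchar F'G (socle_irr i : mx_irreducible (irr_repr i)).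
move/(_ sG); rewrite (irr_reprK_pchar F'G).
by apply; rewrite ?inE ?Wi // !gring_opM // eqAB.
Qed.

Lemma fourier_sum A : (A \in R_G)%MS ->
  A = \sum_(i : sG) fourier_inv i (gring_op (irr_repr i) A).
Proof.
move=> RA; apply: fourier_inj => // [|j].
  by rewrite linear_sum summx_sub // => i _; apply: fourier_inv_gring.
rewrite linear_sum (bigD1 j) //= fourier_invK big1 ?addr0 // => i ne.
exact: fourier_inv_neq.
Qed.

Lemma gring_op_sum n (rG : mx_representation F G n) A : (A \in R_G)%MS ->
  gring_op rG A = \sum_(x in G) gring_row A 0 (gring_index G x) *: rG x.
Proof.
move=> RA; rewrite gring_opE /gring_mx /= mulmx_sum_row linear_sum /=.
rewrite (reindex_onto enum_val (gring_index G)) /= => [|x Gx]; last first.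
  by rewrite gring_indexK.
rewrite [RHS]big_mkcond /=; apply: eq_bigr => k _.
by rewrite enum_valP gring_valK eqxx linearZ /= rowK mxvecK.
Qed.

(* The trace of [x |-> A x B] on the group algebra, computed once on the basis
   of group elements and once on matrix units of the irreducible blocks. *)
Lemma trace_two_sided A B : (A \in R_G)%MS -> (B \in R_G)%MS ->
  \sum_(x in G) gring_row (A *m aG x *m B) 0 (gring_index G x)
  = \sum_(i : sG) \tr (gring_op (irr_repr i) A) * \tr (gring_op (irr_repr i) B).
Proof.
move=> RA RB.
have RAxB x : x \in G -> (A *m aG x *m B \in R_G)%MS.
  by move=> Gx; rewrite !envelop_mxM // envelop_mx_id.
transitivity (\sum_(x in G) \sum_(i : sG) \sum_p \sum_q irr_repr i x p q *
   gring_row (fourier_inv i (gring_op (irr_repr i) A *m delta_mx p q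
                             *m gring_op (irr_repr i) B)) 0 (gring_index G x)).
  apply: eq_bigr => x Gx; rewrite {1}[_ *m B]fourier_sum ?RAxB //.
  rewrite linear_sum summxE; apply: eq_bigr => i _.
  rewrite !gring_opM ?envelop_mx_id // gring_opG //.
  rewrite {1}[irr_repr i x]matrix_sum_delta mulmx_sumr mulmx_suml.
  rewrite !linear_sum summxE; apply: eq_bigr => p _.
  rewrite mulmx_sumr mulmx_suml !linear_sum summxE; apply: eq_bigr => q _.
  by rewrite -scalemxAr -scalemxAl !linearZ /= mxE.
rewrite exchange_big /=; apply: eq_bigr => i _.
rewrite exchange_big /= [\tr (gring_op _ A)]/mxtrace mulr_suml.
apply: eq_bigr => p _; rewrite exchange_big /= mulr_sumr; apply: eq_bigr => q _.
set Y := _ *m delta_mx p q *m _.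
(* Summing coefficient times matrix entry over [x] evaluates the inverse transform back in
   [irr_repr i]: the result is the entry [(p, q)] of [Y], that is [A_pp * B_qq] for the images of
   [A] and [B]. *)
transitivity (gring_op (irr_repr i) (fourier_inv i Y) p q).
  rewrite gring_op_sum ?fourier_inv_gring // summxE.
  by apply: eq_bigr => x Gx; rewrite [in RHS]mxE mulrC.
rewrite fourier_invK /Y -(mul_delta_mx (0 : 'I_1)) mulmxA -colE -mulmxA -rowE.
by rewrite mxE big_ord1 !mxE.
Qed.

End Fourier.

Arguments fourier_inv {F gT G} i Y.

(** * Double cosets supporting a pair of sign characters *)

Section DoubleCosetCount.
Variables (gT : finGroupType) (G H : {group gT}).
Hypothesis sHG : H \subset G.
Implicit Types b : gT -> bool.

(** Mackey's condition for [e_b1 g e_b2] to be nonzero: the two characters agree on the part of [H]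
    that [g] conjugates into [H]. *)
Definition supported b1 b2 (g : gT) : bool :=
  [forall h in H, ((h ^ g)%g \in H) ==> (b1 h == b2 (h ^ g)%g)].

Lemma supportedP b1 b2 g :
  reflect (forall h, h \in H -> (h ^ g)%g \in H -> b1 h = b2 (h ^ g)%g)
          (supported b1 b2 g).
Proof.
apply: (iffP forall_inP) => [h x Hx Hxg|h x Hx]; last first.
  by apply/implyP=> Hxg; apply/eqP/h.
by apply/eqP; apply: implyP (h x Hx) Hxg.
Qed.

Lemma double_coset_refl g : g \in (H :* g * H)%g.
Proof. by apply/mulsgP; exists g 1%g; rewrite ?rcoset_refl ?mulg1. Qed.

Lemma mem_double_cosetP g x :
  reflect (exists h k, [/\ h \in H, k \in H & x = (h * g * k)%g])
          (x \in (H :* g * H)%g).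
Proof.
apply: (iffP mulsgP) => [[_ k /rcosetP[h Hh ->] Hk ->]|[h [k [Hh Hk ->]]]].
  by exists h, k.
by exists (h * g)%g k => //; apply/rcosetP; exists h.
Qed.

Lemma double_coset_eq g x : (x \in (H :* g * H)%g) -> (H :* x * H = H :* g * H)%g.
Proof.
case/mem_double_cosetP=> h [k [Hh Hk ->]].
apply/setP=> y; apply/mem_double_cosetP/mem_double_cosetP=> -[u [v [Hu Hv ->]]].
  by exists (u * h)%g, (k * v)%g; rewrite !groupM // !mulgA.
exists (u * h^-1)%g, (k^-1 * v)%g; rewrite !groupM ?groupV // !mulgA.
by rewrite mulgKV mulgK.
Qed.

Lemma double_coset_eqE g x :
  ((H :* x * H)%g == (H :* g * H)%g) = (x \in (H :* g * H)%g).
Proof.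
by apply/eqP/idP=> [<-|/double_coset_eq //]; apply: double_coset_refl.
Qed.

Lemma supported_double_coset b1 b2 g x : sign_hom H b1 -> sign_hom H b2 ->
  x \in (H :* g * H)%g -> supported b1 b2 x = supported b1 b2 g.
Proof.
move=> hb1 hb2.
have bJ b u v : sign_hom H b -> u \in H -> v \in H -> b (u ^ v)%g = b u.
  move=> hb Hu Hv; rewrite conjgE !hb ?groupM ?groupV // (sign_homV hb) //.
  by rewrite addbCA addbb addbF.
have imp y z : y \in (H :* z * H)%g -> supported b1 b2 z -> supported b1 b2 y.
  case/mem_double_cosetP=> h [k [Hh Hk ->]] /supportedP sz.
  apply/supportedP=> u Hu; rewrite !conjgM => Huy.
  have Huy2 : ((u ^ h) ^ z)%g \in H by rewrite -(conjgK k ((u ^ h) ^ z)%g) groupJ ?groupV.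
  by rewrite -(bJ b1 u h) // (bJ b2 _ k) // sz // groupJ.
move=> xg; apply/idP/idP; last exact: imp xg.
by apply: imp; rewrite (double_coset_eq xg) double_coset_refl.
Qed.

Lemma double_coset_subset g : g \in G -> (H :* g * H)%g \subset G.
Proof. by move=> Gg; rewrite !mul_subG ?sub1set. Qed.

Lemma card_double_coset g :
  (#|(H :* g * H)%g| * #|H :&: H :^ g^-1| = #|H| ^ 2)%N.
Proof.
have -> : (H :* g * H = (H * H :^ g^-1) :* g)%g.
  by rewrite conjsgE invgK -!mulgA mulg_set1 mulVg mulg1 !mulgA.
by rewrite card_rcoset -(mul_cardG H (H :^ g^-1)) cardJg -mulnn.
Qed.

Lemma sum_sign_hom (F : numClosedFieldType) (K : {group gT}) b : sign_hom K b ->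
  \sum_(h in K) (-1) ^+ b h = (if [forall h in K, ~~ b h] then #|K|%:R else 0) :> F.
Proof.
move=> hb; case: ifPn => [/forall_inP triv|].
  rewrite -sum1_card natr_sum; apply: eq_bigr => h Kh.
  by rewrite (negPf (triv h Kh)) expr0.
rewrite negb_forall => /existsP[k]; rewrite negb_imply negbK => /andP[Kk bk].
set S := \sum_(h in K) _.
apply: (@eq_sign_eq0 F F^o true false) => //; rewrite expr1 expr0 scaleN1r scale1r.
rewrite -sumrN [RHS](reindex_inj (mulIg k)) /=.
apply: eq_big => h; first by rewrite groupMr.
by move=> Kh; rewrite hb // bk addbT signrN.
Qed.

End DoubleCosetCount.

(** * Rank products and double cosets *)

Section CornerDimension.
Variables (F : numClosedFieldType) (gT : finGroupType) (G H : {group gT}).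
Hypothesis sHG : H \subset G.
Local Notation sG := (closed_irrType F G).
Local Notation aG := (regular_repr F G).

Definition sign_rank (b : gT -> bool) (i : sG) : nat :=
  \rank (sign_idem H (irr_repr i) b).

Lemma sign_idem_gring b : (sign_idem H aG b \in group_ring F G)%MS.
Proof.
rewrite sign_idemE linearZ scalemx_sub // linear_sum summx_sub // => h Hh.
by rewrite linearZ scalemx_sub // envelop_mx_id // (subsetP sHG).
Qed.

Lemma gring_op_sign_idem n (rG : mx_representation F G n) b :
  gring_op rG (sign_idem H aG b) = sign_idem H rG b.
Proof.
rewrite !sign_idemE linearZ linear_sum; congr (_ *: _).
by apply: eq_bigr => h Hh; rewrite linearZ /= gring_opG ?(subsetP sHG).
Qed.

Lemma mxtrace_sign_idem b (i : sG) : sign_hom H b ->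
  \tr (sign_idem H (irr_repr i) b) = (sign_rank b i)%:R.
Proof. by move=> hb; rewrite mxtrace_idem ?sign_idemK. Qed.

Lemma gring_row_aG x y : x \in G -> y \in G ->
  gring_row (aG y) 0 (gring_index G x) = (x == y)%:R.
Proof.
move=> Gx Gy; rewrite /gring_row rowK gring_indexK // mul1g !mxE /=.
by rewrite -(inj_eq enum_val_inj) !gring_indexK.
Qed.

Lemma sign_idem_coef b1 b2 x : sign_hom H b2 -> x \in G ->
  gring_row (sign_idem H aG b1 *m aG x *m sign_idem H aG b2) 0 (gring_index G x)
  = #|H|%:R ^- 2 *
    \sum_(h in H :&: H :^ x^-1) (-1) ^+ (b1 h (+) b2 (h ^ x)%g).
Proof.
move=> hb2 Gx.
have -> : sign_idem H aG b1 *m aG x *m sign_idem H aG b2 = #|H|%:R ^- 2 *: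
    \sum_(h in H) \sum_(k in H) ((-1) ^+ b1 h * (-1) ^+ b2 k) *: aG (h * x * k)%g.
  rewrite !sign_idemE -!(scalemxAl, scalemxAr) scalerA -invfM -expr2.
  congr (_ *: _); rewrite !mulmx_suml; apply: eq_bigr => h Hh.
  rewrite mulmx_sumr; apply: eq_bigr => k Hk.
  have Gh := subsetP sHG _ Hh; have Gk := subsetP sHG _ Hk.
  rewrite -!(scalemxAl, scalemxAr) scalerA mulrC.
  by rewrite -(repr_mxM aG Gh Gx) -(repr_mxM aG _ Gk) ?groupM.
rewrite linearZ mxE linear_sum summxE; congr (_ * _).
transitivity (\sum_(h in H) \sum_(k in H)
   (-1) ^+ b1 h * (-1) ^+ b2 k * (x == h * x * k)%g%:R : F).
  apply: eq_bigr => h Hh; rewrite linear_sum summxE.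
  apply: eq_bigr => k Hk; have Gh := subsetP sHG _ Hh; have Gk := subsetP sHG _ Hk.
  by rewrite linearZ mxE gring_row_aG ?groupM.
(* The equation [x = h x k] determines [k = (h ^ x)^-1], so only those [h] with [h ^ x \in H]
   contribute, each once. *)
rewrite (big_setID (H :^ x^-1)) /= [X in _ + X]big1 ?addr0.
  apply: eq_bigr => h /setIP[Hh]; rewrite mem_conjgV => Hhx.
  rewrite (bigD1 (h ^ x)^-1%g) ?groupV //= big1 ?addr0 => [|k /andP[Hk ne]].
    rewrite (sign_homV hb2) // signr_addb.
    by rewrite (conjgC h x) mulgK eqxx mulr1.
  case: eqP => [e|_]; last by rewrite mulr0.
  case/eqP: ne; apply: (mulgI (h * x)%g).
  by rewrite -e (conjgC h x) mulgK.
move=> h /setDP[Hh]; rewrite mem_conjgV => nHhx; apply: big1 => k Hk.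
case: eqP => [e|_]; last by rewrite mulr0.
case/negP: nHhx; rewrite conjgE (_ : (_ * _)%g = k^-1%g) ?groupV //.
by apply: (mulIg k); rewrite mulVg -!mulgA (mulgA h) -e mulVg.
Qed.

(** The trace of an idempotent is its rank, so by [trace_two_sided] the left side is the sum over
    [x] of the coefficient of [x] in [e_b1 x e_b2]. For supported [x] this coefficient is the order
    of [H :&: H :^ x^-1] over the square of that of [H], the inverse of the size of the double coset
    of [x]; for the others the signs cancel. Each supported double coset therefore contributes 1. *)
Theorem sum_sign_rank b1 b2 : sign_hom H b1 -> sign_hom H b2 ->
  (\sum_(i : sG) sign_rank b1 i * sign_rank b2 i)%N
  = #|[set (H :* g * H)%g | g in G & supported H b1 b2 g]|.
Proof.
move=> hb1 hb2; set DC := imset _ _.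
have H0 : (#|H|%:R : F) != 0 by rewrite pnatr_eq0 -lt0n cardG_gt0.
apply/eqP; rewrite -(eqr_nat F) natr_sum; apply/eqP.
under eq_bigr => i _ do rewrite natrM -!mxtrace_sign_idem //
  -(gring_op_sign_idem (irr_repr i) b1) -(gring_op_sign_idem (irr_repr i) b2).
rewrite -trace_two_sided ?sign_idem_gring //.
transitivity (\sum_(x in G | supported H b1 b2 x)
                 (#|(H :* x * H)%g|%:R^-1 : F)).
  rewrite big_mkcondr; apply: eq_bigr => x Gx; rewrite sign_idem_coef //.
  rewrite (sum_sign_hom F (K := (H :&: H :^ x^-1)%G)) => [|h k]; last first.
    case/setIP=> Hh; rewrite mem_conjgV => Hhx.
    case/setIP=> Hk; rewrite mem_conjgV => Hkx.
    by rewrite conjMg hb1 // hb2 // !addbA; congr addb; rewrite addbAC.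
  have -> : [forall h in H :&: H :^ x^-1, ~~ (b1 h (+) b2 (h ^ x)%g)]
            = supported H b1 b2 x.
    apply/forall_inP/supportedP => [s h Hh Hhx|s h /setIP[Hh]].
      by apply/eqP; rewrite -negb_add s // inE Hh mem_conjgV.
    by rewrite mem_conjgV => Hhx; rewrite negb_add s.
  case: ifP => _; last by rewrite mulr0.
  have c0 : (#|(H :* x * H)%g|%:R : F) != 0.
    by rewrite pnatr_eq0 -lt0n card_gt0; apply/set0Pn; exists x; apply: double_coset_refl.
  apply: (mulfI c0); rewrite mulfV // mulrCA -natrM card_double_coset natrX.
  by rewrite mulVf ?expf_neq0.
rewrite (partition_big (fun x => H :* x * H)%g (mem DC)) /=; last first.
  by move=> x /andP[Gx sx]; apply: imset_f; rewrite inE Gx.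
rewrite -sum1_card natr_sum; apply: eq_bigr => D /imsetP[g].
rewrite inE => /andP[Gg sg] ->{D}.
rewrite (eq_bigl (mem (H :* g * H)%g)) => [|x]; last first.
  rewrite double_coset_eqE; apply/andP/idP=> [[]//|xg]; split=> //.
  by rewrite (subsetP (double_coset_subset sHG Gg)) // (supported_double_coset _ _ xg).
rewrite (eq_bigr (fun _ => #|(H :* g * H)%g|%:R^-1)) => [|x xg]; last first.
  by rewrite (double_coset_eq xg).
rewrite sumr_const -[_ *+ _]mulr_natl; apply: mulfV; rewrite pnatr_eq0 -lt0n card_gt0.
by apply/set0Pn; exists g; apply: double_coset_refl.
Qed.

End CornerDimension.

(** * The corner of an idempotent with all block ranks at most two *)

Section CornerIsomorphism.
Variables (F : numClosedFieldType) (gT : finGroupType) (G : {group gT}).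
Local Notation sG := (closed_irrType F G).
Local Notation aG := (regular_repr F G).
Local Notation R_G := (group_ring F G).
Variable A : 'M[F]_#|G|.
Hypotheses (RA : (A \in R_G)%MS) (idA : A *m A = A).

Definition block (i : sG) : 'M[F]_(irr_degree i) := gring_op (irr_repr i) A.

Lemma blockK i : block i *m block i = block i.
Proof. by rewrite /block -gring_opM // idA. Qed.

Definition rank_blocks (k : nat) : {set sG} := [set i | \rank (block i) == k].

Section FixedRank.
Variable k : nat.
Implicit Type j : 'I_#|rank_blocks k|.

Definition block_of j : sG := enum_val j.

Lemma rank_block_of j : \rank (block (block_of j)) = k.
Proof. by apply/eqP; have := enum_valP j; rewrite inE. Qed.

(** The full-rank factors of the block, cast along the rank equation so that all blocks of rank [k]
    share the matrix size [k]. *)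
Definition block_col j : 'M[F]_(irr_degree (block_of j), k) :=
  castmx (erefl, rank_block_of j) (col_base (block (block_of j))).
Definition block_row j : 'M[F]_(k, irr_degree (block_of j)) :=
  castmx (rank_block_of j, erefl) (row_base (block (block_of j))).

Lemma block_col_row j : block_col j *m block_row j = block (block_of j).
Proof.
rewrite -[RHS]mulmx_base /block_col /block_row.
by case: _ / (rank_block_of j); rewrite !castmx_id.
Qed.

Lemma block_row_col j : block_row j *m block_col j = 1%:M.
Proof.
have := idem_factor (blockK (block_of j)); rewrite /block_col /block_row.
by case: _ / (rank_block_of j); rewrite !castmx_id.
Qed.

Lemma rank_blocksP i : \rank (block i) = k -> exists j, block_of j = i.
Proof.
move=> ri; have Bi : i \in rank_blocks k by rewrite inE ri.
by exists (enum_rank_in Bi i); rewrite /block_of enum_rankK_in.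
Qed.

Lemma block_of_inj : injective block_of.
Proof. exact: enum_val_inj. Qed.

Definition block_embed j (U : 'M[F]_k) : 'M[F]_#|G| :=
  fourier_inv (block_of j) (block_col j *m U *m block_row j).

Lemma block_embed_linear j : linear (block_embed j).
Proof.
by move=> a U V; rewrite /block_embed mulmxDr mulmxDl -scalemxAr -scalemxAl linearP.
Qed.

Definition block_sum (U : 'I_#|rank_blocks k| -> 'M[F]_k) : 'M[F]_#|G| :=
  \sum_j block_embed j (U j).

Lemma block_sum_gring U : (block_sum U \in R_G)%MS.
Proof.
by rewrite /block_sum linear_sum summx_sub // => j _; apply: fourier_inv_gring.
Qed.

Lemma block_sum_op U j : gring_op (irr_repr (block_of j)) (block_sum U)
  = block_col j *m U j *m block_row j.
Proof.
rewrite linear_sum (bigD1 j) //= fourier_invK big1 ?addr0 // => j' ne.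
by rewrite /block_embed fourier_inv_neq // (inj_eq block_of_inj).
Qed.

Lemma block_sum_op0 U i : \rank (block i) != k ->
  gring_op (irr_repr i) (block_sum U) = 0.
Proof.
move=> ne; rewrite linear_sum big1 // => j _ /=; rewrite /block_embed fourier_inv_neq //.
by apply: contraNneq ne => <-; rewrite rank_block_of.
Qed.

End FixedRank.

Hypothesis rank_le2 : forall i, (\rank (block i) <= 2)%N.

Local Notation r := #|rank_blocks 1|.
Local Notation d := #|rank_blocks 2|.
Local Notation alg := ({ffun 'I_r -> F^o} * {ffun 'I_d -> 'M[F]_2})%type.

Definition corner_map (x : alg) : 'M[F]_#|G| :=
  block_sum (fun j => (x.1 j)%:M) + block_sum (fun j => x.2 j).

Fact corner_map_linear : linear corner_map.
Proof.
move=> a x y; rewrite /corner_map scalerDr addrACA; congr (_ + _).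
  rewrite /block_sum scaler_sumr -big_split; apply: eq_bigr => j _ /=.
  by rewrite -block_embed_linear !ffunE raddfD /= scale_scalar_mx.
rewrite /block_sum scaler_sumr -big_split; apply: eq_bigr => j _ /=.
by rewrite -block_embed_linear !ffunE.
Qed.
HB.instance Definition _ := GRing.isLinear.Build F alg 'M[F]_#|G| _
  corner_map corner_map_linear.

Lemma corner_map_gring x : (corner_map x \in R_G)%MS.
Proof. by rewrite /corner_map linearD addmx_sub // block_sum_gring. Qed.

Lemma corner_map_op1 x (j : 'I_r) :
  gring_op (irr_repr (block_of j)) (corner_map x)
  = block_col j *m (x.1 j)%:M *m block_row j.
Proof.
by rewrite /corner_map linearD /= block_sum_op block_sum_op0 ?addr0 // rank_block_of.
Qed.

Lemma corner_map_op2 x (j : 'I_d) :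
  gring_op (irr_repr (block_of j)) (corner_map x)
  = block_col j *m x.2 j *m block_row j.
Proof.
by rewrite /corner_map linearD /= block_sum_op block_sum_op0 ?add0r // rank_block_of.
Qed.

Lemma corner_map_op0 x (i : sG) : \rank (block i) = 0%N ->
  gring_op (irr_repr i) (corner_map x) = 0.
Proof.
by move=> r0; rewrite /corner_map linearD /= !block_sum_op0 ?addr0 // r0.
Qed.

Lemma fourier_ext B1 B2 : (B1 \in R_G)%MS -> (B2 \in R_G)%MS ->
  (forall i : sG, \rank (block i) = 0%N ->
     gring_op (irr_repr i) B1 = gring_op (irr_repr i) B2) ->
  (forall j : 'I_r, gring_op (irr_repr (block_of j)) B1
                    = gring_op (irr_repr (block_of j)) B2) ->
  (forall j : 'I_d, gring_op (irr_repr (block_of j)) B1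
                    = gring_op (irr_repr (block_of j)) B2) ->
  B1 = B2.
Proof.
move=> R1 R2 e0 e1 e2; apply: fourier_inj => // i.
case ri: (\rank (block i)) (rank_le2 i) => [|[|[|//]]] _; first exact: e0.
  by have [j <-] := rank_blocksP ri; apply: e1.
by have [j <-] := rank_blocksP ri; apply: e2.
Qed.

Lemma block_mid k (j : 'I_#|rank_blocks k|) U V :
  block_col j *m U *m block_row j *m (block_col j *m V *m block_row j)
  = block_col j *m (U *m V) *m block_row j.
Proof.
by rewrite -!mulmxA (mulmxA (block_row j)) block_row_col mul1mx.
Qed.

Lemma block_cancel k (j : 'I_#|rank_blocks k|) U :
  block_row j *m (block_col j *m U *m block_row j) *m block_col j = U.
Proof.
by rewrite -!mulmxA block_row_col mulmx1 mulmxA block_row_col mul1mx.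
Qed.

Lemma corner_map_inj : injective corner_map.
Proof.
move=> [f M] [f' M'] e; congr (_, _); apply/ffunP=> j.
  have := corner_map_op1 (f, M) j; rewrite e corner_map_op1 /=.
  move/(congr1 (fun Z => block_row j *m Z *m block_col j)).
  by rewrite !block_cancel => /matrixP/(_ 0 0); rewrite !mxE.
have := corner_map_op2 (f, M) j; rewrite e corner_map_op2 /=.
move/(congr1 (fun Z => block_row j *m Z *m block_col j)).
by rewrite !block_cancel.
Qed.

Lemma corner_map1 : corner_map 1 = A.
Proof.
apply: fourier_ext => [||i r0|j|j]; rewrite ?corner_map_gring //.
- rewrite corner_map_op0 //; apply/esym/eqP; rewrite -mxrank_eq0.
  exact/eqP.
- by rewrite corner_map_op1 ffunE mulmx1 block_col_row.
by rewrite corner_map_op2 ffunE mulmx1 block_col_row.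
Qed.

Lemma corner_mapM : {morph corner_map : x y / x * y >-> x *m y}.
Proof.
move=> x y; apply: fourier_ext => [||i r0|j|j].
- exact: corner_map_gring.
- by rewrite envelop_mxM ?corner_map_gring.
- by rewrite gring_opM ?corner_map_gring // !corner_map_op0 // mulmx0.
- by rewrite gring_opM ?corner_map_gring // !corner_map_op1 block_mid ffunE -scalar_mxM.
by rewrite gring_opM ?corner_map_gring // !corner_map_op2 block_mid ffunE.
Qed.

Lemma corner_map_image B :
  (exists2 B', (B' \in R_G)%MS & B = A *m B' *m A) <-> exists x, corner_map x = B.
Proof.
split=> [[B' RB' ->]|[x <-]]; last first.
  exists (corner_map x); first exact: corner_map_gring.
  by rewrite -corner_map1 -!corner_mapM mul1r mulr1.
exists ([ffun j => (block_row j *m gring_op (irr_repr (block_of j)) B' *m block_col j) 0 0],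
        [ffun j => block_row j *m gring_op (irr_repr (block_of j)) B' *m block_col j]).
have RABA : (A *m B' *m A \in R_G)%MS by rewrite !envelop_mxM.
have opABA (i : sG) : gring_op (irr_repr i) (A *m B' *m A)
    = block i *m gring_op (irr_repr i) B' *m block i.
  by rewrite !gring_opM.
apply: fourier_ext => [||i r0|j|j]; rewrite ?corner_map_gring // opABA.
- rewrite corner_map_op0 //; have /eqP -> : block i == 0 by rewrite -mxrank_eq0 r0.
  by rewrite mulmx0.
- rewrite corner_map_op1 /= ffunE -mx11_scalar -!block_col_row.
  by rewrite !mulmxA.
by rewrite corner_map_op2 /= ffunE -!block_col_row !mulmxA.
Qed.

Lemma corner_isomorphism : exists psi : {linear alg -> 'M[F]_#|G|},
  [/\ injective psi, psi 1 = A, {morph psi : x y / x * y >-> x *m y}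
    & forall B, (exists2 B', (B' \in R_G)%MS & B = A *m B' *m A)
                <-> exists x, psi x = B].
Proof.
by exists corner_map; split;
  [exact: corner_map_inj | exact: corner_map1 | exact: corner_mapM
  | exact: corner_map_image].
Qed.

End CornerIsomorphism.

(** * Multiplicities of induced sign characters *)

Section InducedSign.
Variables (gT : finGroupType) (G H : {group gT}).
Hypothesis sHG : H \subset G.

(** By Frobenius reciprocity the multiplicity is, up to complex conjugation, the trace of the
    idempotent in the representation. That trace is a rank, hence a natural number, which disposes
    of the conjugation. *)
Lemma cfdot_Ind_sign (lambda : 'CF(H)) (b : gT -> bool) (i : Iirr G) :
  sign_hom H b -> (forall h, h \in H -> lambda h = (-1) ^+ b h) ->
  '['Ind[G] lambda, 'chi_i] = (sign_rank H b (socle_of_Iirr i))%:R.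
Proof.
move=> hb lamE; rewrite -cfdot_Res_r -mxtrace_sign_idem //.
rewrite sign_idemE linearZ linear_sum /=.
set S := \sum_(h in H) \tr _.
have S_conj : S^* = S.
  have : #|H|%:R^-1 * S = (sign_rank H b (socle_of_Iirr i))%:R.
    by rewrite -mxtrace_sign_idem // sign_idemE linearZ linear_sum.
  move/(canRL (mulVKf (natrG_neq0 algC H))) ->.
  by rewrite rmorphM !rmorph_nat.
rewrite -S_conj cfdotE rmorph_sum; congr (_ * _); apply: eq_bigr => h Hh.
rewrite linearZ rmorphM /= rmorph_sign lamE // cfResE //.
by rewrite -irrRepr cfunE (subsetP sHG).
Qed.

Lemma gelfand_trick_multiplicity_free (lambda : 'CF(H)) (b : gT -> bool) :
  sign_hom H b -> (forall h, h \in H -> lambda h = (-1) ^+ b h) ->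
  gelfand_trick G H b -> multiplicity_free ('Ind[G] lambda).
Proof.
move=> hb lamE gb i; rewrite (cfdot_Ind_sign i hb lamE) lern1.
by rewrite gelfand_trick_rank // irr_abs_irr.
Qed.

End InducedSign.

(** * The kernel of a nontrivial sign character *)

Section IndexTwoKernel.
Variables (gT : finGroupType) (G C E : {group gT}) (b : gT -> bool).
Hypotheses (sCG : C \subset G) (hb : sign_hom C b).
Hypothesis memE : forall x, (x \in E) = (x \in C) && ~~ b x.
Hypothesis b_onto : exists2 c, c \in C & b c.
Local Notation triv := (fun=> false : bool).

Lemma kernel_sub : E \subset G.
Proof. by apply/subsetP=> x; rewrite memE => /andP[Cx _]; apply: (subsetP sCG). Qed.

Variable F : numClosedFieldType.

Lemma card_kernel : (#|C|%:R : F) = 2 * #|E|%:R.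
Proof.
have [c Cc bc] := b_onto.
have -> : #|C| = (#|E| + #|E|)%N.
  rewrite -(cardsID E) (setIidPr _); last first.
    by apply/subsetP=> x; rewrite memE => /andP[].
  congr (_ + _)%N; rewrite -[RHS](card_imset _ (mulIg c)); congr #|pred_of_set _|.
  apply/setP=> x; rewrite inE; apply/andP/imsetP => [[nEx Cx]|[y]].
    exists (x * c^-1)%g; last by rewrite mulgKV.
    move: nEx; rewrite !memE Cx groupM ?groupV //= negbK hb ?groupV //.
    by rewrite (sign_homV hb) // bc => ->.
  rewrite (memE y) => /andP[Cy by_] ->; rewrite memE groupM // hb // bc addbT.
  by rewrite by_.
by rewrite natrD -mulr2n mulr_natl.
Qed.

(** The sum of the two signs is 2 on [E] and 0 on the rest of [C], while [C] has twice the order of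
    [E]. *)
Lemma sign_idem_kernel n (rG : mx_representation F G n) :
  sign_idem E rG triv = sign_idem C rG triv + sign_idem C rG b.
Proof.
rewrite !sign_idemE -scalerDr -big_split /= card_kernel invfM mulrC.
rewrite -scalerA; congr (_ *: _); rewrite scaler_sumr.
rewrite [RHS](bigID b) /= [X in X + _]big1 ?add0r => [|x /andP[_ ->]]; last first.
  by rewrite -scalerDl expr0 expr1 subrr scale0r scaler0.
apply: eq_big => x; first by rewrite memE.
rewrite memE => /andP[_ /negPf->].
by rewrite !expr0 !scale1r -mulr2n -scaler_nat scalerA mulVf ?scale1r ?pnatr_eq0.
Qed.

Lemma sign_rank_kernel (i : closed_irrType F G) :
  sign_rank E triv i = (sign_rank C triv i + sign_rank C b i)%N.
Proof.
apply/eqP; rewrite -(eqr_nat F) natrD -!mxtrace_sign_idem ?kernel_sub //.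
by rewrite sign_idem_kernel raddfD.
Qed.

End IndexTwoKernel.

(** * The Hecke algebra of the kernel *)

Section HeckeOfIndexTwoKernel.
Variables (gT : finGroupType) (G C E : {group gT}) (b : gT -> bool).
Local Notation triv := (fun=> false : bool).
Hypotheses (sCG : C \subset G) (hb : sign_hom C b).
Hypothesis memE : forall x, (x \in E) = (x \in C) && ~~ b x.
Hypothesis b_onto : exists2 c, c \in C & b c.
Hypotheses (trick1 : gelfand_trick G C triv) (trickb : gelfand_trick G C b).

Definition supported_double_cosets (b1 b2 : gT -> bool) : {set {set gT}} :=
  [set (C :* g * C)%g | g in G & supported C b1 b2 g].

Local Notation N1 := #|supported_double_cosets triv triv|.
Local Notation N2 := #|supported_double_cosets b b|.
Local Notation N12 := #|supported_double_cosets triv b|.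

Section OverField.
Variable F : numClosedFieldType.
Local Notation sG := (closed_irrType F G).
Local Notation k1 := (@sign_rank F gT G C triv).
Local Notation kb := (@sign_rank F gT G C b).
Local Notation kE := (@sign_rank F gT G E triv).
Let sEG := kernel_sub sCG memE.

Lemma sign_rank_bool (i : sG) : (k1 i <= 1)%N /\ (kb i <= 1)%N.
Proof. by split; apply: gelfand_trick_rank => //; apply: irr_abs_irr. Qed.

Lemma kernel_rank (i : sG) : kE i = (k1 i + kb i)%N.
Proof. exact: sign_rank_kernel. Qed.

(** For ranks [k1], [kb] in {0, 1}, the indicator of [k1 + kb = 2] is [k1 * kb], which
    [sum_sign_rank] sums. *)
Lemma card_rank2 : #|[set i : sG | kE i == 2]| = N12.
Proof.
rewrite -(sum_sign_rank F sCG (b1 := triv)) // -sum1_card big_mkcond /=.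
apply: eq_bigr => i _; rewrite inE kernel_rank.
by have [] := sign_rank_bool i; case: (k1 i) (kb i) => [|[|?]] [|[|?]].
Qed.

(** For ranks in {0, 1}, the indicator of [k1 + kb = 1] plus [2 * k1 * kb] is [k1 ^ 2 + kb ^ 2]. *)
Lemma card_rank1 : (#|[set i : sG | kE i == 1%N]| + 2 * N12 = N1 + N2)%N.
Proof.
rewrite -(sum_sign_rank F sCG (b1 := triv) (b2 := b)) // -sum1_card big_mkcond /=.
rewrite -(sum_sign_rank F sCG (b1 := triv) (b2 := triv)) //.
rewrite -(sum_sign_rank F sCG (b1 := b) (b2 := b)) //.
rewrite big_distrr /= -!big_split; apply: eq_bigr => i _.
rewrite inE kernel_rank.
by have [] := sign_rank_bool i; case: (k1 i) (kb i) => [|[|?]] [|[|?]].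
Qed.

(** Every double coset of [E] supports a pair of trivial characters, so their number is the sum of
    [(k1 + kb) ^ 2]. *)
Lemma card_kernel_double_cosets : #|double_cosets G E| = (N1 + N2 + 2 * N12)%N.
Proof.
have -> : double_cosets G E = [set (E :* g * E)%g | g in G & supported E triv triv g].
  apply/setP=> D; apply/imsetP/imsetP=> -[g Gg ->]; exists g => //.
    by rewrite inE Gg; apply/supportedP.
  by move: Gg; rewrite inE => /andP[].
rewrite -(sum_sign_rank F sEG) //.
rewrite -(sum_sign_rank F sCG (b1 := triv) (b2 := b)) //.
rewrite -(sum_sign_rank F sCG (b1 := triv) (b2 := triv)) //.
rewrite -(sum_sign_rank F sCG (b1 := b) (b2 := b)) //.
rewrite big_distrr /= -!big_split; apply: eq_bigr => i _ /=.
rewrite kernel_rank.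
by have [] := sign_rank_bool i; case: (k1 i) (kb i) => [|[|?]] [|[|?]].
Qed.

(** The truncated subtraction is exact: by [card_rank1] the difference is the number of blocks of
    rank one. *)
Lemma kernel_hecke : hecke_isomorphic_to G E (fun=> 1 : F) (N1 + N2 - 2 * N12) N12.
Proof.
have idE : hecke_idem G E (fun=> 1 : F) = sign_idem E (regular_repr F G) triv.
  by rewrite sign_idemE.
have rk (i : sG) : \rank (block (sign_idem E (regular_repr F G) triv) i) = kE i.
  by rewrite /block gring_op_sign_idem.
have rkset k : rank_blocks (sign_idem E (regular_repr F G) triv) k
               = [set i : sG | kE i == k].
  by apply/setP=> i; rewrite !inE rk.
have homE : sign_hom E triv by [].
have := corner_isomorphism (sign_idem_gring F sEG triv) (sign_idemK _ sEG homE).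
rewrite !rkset card_rank2 -card_rank1 addnK; case=> [i|psi [inj one mor img]].
  rewrite rk kernel_rank.
  by have [] := sign_rank_bool i; case: (k1 i) (kb i) => [|[|?]] [|[|?]].
by exists psi; split; rewrite ?idE // => A; rewrite /in_hecke idE; apply: img.
Qed.

End OverField.

Lemma kernel_gelfand_pair : gelfand_pair G E <-> N12 = 0%N.
Proof.
have sEG := kernel_sub sCG memE.
have indE i : '['Ind[G] (1 : 'CF(E)), 'chi_i]
    = (sign_rank E triv (socle_of_Iirr i))%:R.
  by apply: (cfdot_Ind_sign sEG) => // h Eh; rewrite cfun1E Eh.
rewrite -(card_rank2 algC); split=> [[_ _ mf]|/eqP].
  apply/eqP; rewrite cards_eq0; apply/eqP/setP=> i; rewrite !inE.
  apply/negbTE/negP=> /eqP ki; have := mf (irr_of_socle i).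
  by rewrite indE irr_of_socleK ki lern1.
rewrite cards_eq0 => /eqP no2; split=> [//||i]; first exact: cfun1_lin_char.
rewrite indE lern1; have /setP/(_ (socle_of_Iirr i)) := no2; rewrite !inE kernel_rank.
have [] := sign_rank_bool (socle_of_Iirr i).
by case: (sign_rank C _ _) (sign_rank C _ _) => [|[|?]] [|[|?]].
Qed.

End HeckeOfIndexTwoKernel.

(** * Signed orbits of permutations commuting with a free involution *)

Section SignedOrbits.
Variables (X : finType) (c nu : {perm X}).
Hypotheses (nuK : (nu * nu = 1)%g) (nu_free : forall x, nu x != x).
Hypothesis cnu : commute c nu.
Implicit Types (i j : nat) (e : bool) (x y : X).

(** The general element of the abelian group generated by [c] and [nu]; this group is transitive on
    each [signed_orbit]. *)
Definition word i e : {perm X} := (c ^+ i * nu ^+ e)%g.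

(** The length of the cycle through [x], and whether the cycle is negative, that is, contains the
    negative of [x]. *)
Definition ctype x : nat * bool := (#|porbit c x|, nu x \in porbit c x).

Definition signed_orbit x : {set X} := porbit c x :|: porbit c (nu x).

(** A representative that depends only on the orbit, since [pick] depends only on the set. The
    default is never reached, because [x] lies in its own orbit. *)
Definition base x : X := odflt x [pick y in signed_orbit x].

Lemma nu_invol x : nu (nu x) = x.
Proof. by rewrite -permM nuK perm1. Qed.

Lemma commute_nuX i e : commute (c ^+ i) (nu ^+ e)%g.
Proof. exact/commuteX2. Qed.

Lemma nu_cX i x : nu ((c ^+ i)%g x) = (c ^+ i)%g (nu x).
Proof. by have /permP/(_ x) := commute_nuX i 1; rewrite !permM expg1. Qed.

Lemma wordM i e j e' : (word i e * word j e' = word (i + j) (e (+) e'))%g.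
Proof.
rewrite /word !expgD -!mulgA; congr (_ * _)%g.
rewrite (mulgA _ (c ^+ j)%g) -commute_nuX -mulgA; congr (_ * _)%g.
by case: e e' => [] []; rewrite ?mulg1 ?mul1g ?expg1 ?expg0 //= ?nuK ?mul1g ?mulg1.
Qed.

Lemma wordE i e x : word i e x = (nu ^+ e)%g ((c ^+ i)%g x).
Proof. by rewrite permM. Qed.

Lemma mem_signed_orbitP x y :
  reflect (exists i e, y = word i e x) (y \in signed_orbit x).
Proof.
apply: (iffP setUP) => [[/porbitP[i ->]|/porbitP[i ->]]|[i [e ->]]].
- by exists i, false; rewrite wordE expg0 perm1.
- by exists i, true; rewrite wordE expg1 nu_cX.
rewrite wordE; case: e; last by left; rewrite expg0 perm1 mem_porbit.
by right; rewrite expg1 nu_cX mem_porbit.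
Qed.

Lemma word0 x : word 0 false x = x.
Proof. by rewrite wordE !expg0 !perm1. Qed.

Lemma word_inv i e : exists j, (word j e * word i e = 1)%g.
Proof.
exists (i * #[c].-1)%N; rewrite wordM addbb addnC -mulnS prednK ?order_gt0 //.
by rewrite /word mulnC expgM expg_order expg1n mulg1.
Qed.

Lemma signed_orbit_refl x : x \in signed_orbit x.
Proof. by apply/mem_signed_orbitP; exists 0%N, false; rewrite word0. Qed.

Lemma signed_orbit_eq x y : y \in signed_orbit x -> signed_orbit y = signed_orbit x.
Proof.
case/mem_signed_orbitP=> i [e ->]; apply/setP=> z.
apply/mem_signed_orbitP/mem_signed_orbitP=> -[j [e' ->]].
  by exists (i + j)%N, (e (+) e'); rewrite -wordM permM.
have [k kP] := word_inv i e.
exists (k + j)%N, (e (+) e'); rewrite -wordM permM; congr (_ _).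
have [l lP] := word_inv k e.
rewrite -permM; suff -> : (word i e * word k e = 1)%g by rewrite perm1.
by move: kP; rewrite !wordM addnC.
Qed.

Lemma base_in x : base x \in signed_orbit x.
Proof.
rewrite /base; case: pickP => //= none.
by have := none x; rewrite signed_orbit_refl.
Qed.

Lemma base_eq x y : y \in signed_orbit x -> base y = base x.
Proof.
move=> yx; rewrite /base (signed_orbit_eq yx).
by case: pickP => //= none; have := none y; rewrite yx.
Qed.

Lemma base_word i e x : base (word i e x) = base x.
Proof. by apply: base_eq; apply/mem_signed_orbitP; exists i, e. Qed.

Lemma base_id x : base (base x) = base x.
Proof. exact/base_eq/base_in. Qed.

Lemma in_signed_orbit_base x : x \in signed_orbit (base x).
Proof. by rewrite (signed_orbit_eq (base_in x)) signed_orbit_refl. Qed.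

Lemma expg_porbit_eq i j x :
  ((c ^+ i)%g x == (c ^+ j)%g x) = (i == j %[mod #|porbit c x|]).
Proof.
have L0 : (0 < #|porbit c x|)%N by rewrite lt0n card_porbit_neq0.
have red k : (c ^+ k)%g x = (c ^+ (k %% #|porbit c x|))%g x.
  rewrite {1}(divn_eq k #|porbit c x|) expgD permM; congr (_ _).
  elim: (_ %/ _)%N => [|q IH]; first by rewrite mul0n expg0 perm1.
  by rewrite mulSn expgD permM [(c ^+ #|porbit c x|)%g x]permX iter_porbit.
rewrite red [X in _ == X]red; have := uniq_traject_porbit c x.
have nthE k : (k < #|porbit c x|)%N -> (c ^+ k)%g x = nth x (traject c x #|porbit c x|) k.
  by move=> lt; rewrite nth_traject // permX.
by move=> u; rewrite !nthE ?ltn_mod // nth_uniq ?size_traject ?ltn_mod.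
Qed.

(** If [nu x = c^k x] with [0 < k < L], applying [nu] again shows that [L] divides [2 k < 2 L], so
    [L = 2 k]: on a negative cycle [nu] is the half-turn. *)
Lemma nu_porbit x : nu x \in porbit c x ->
  nu x = (c ^+ (#|porbit c x|./2))%g x /\ ~~ odd #|porbit c x|.
Proof.
rewrite porbit_traject => /trajectP[k kL eqk].
have e2 : (c ^+ (k + k))%g x = (c ^+ 0)%g x.
  by rewrite expgD permM [(c ^+ k)%g x]permX -eqk -nu_cX permX -eqk nu_invol expg0 perm1.
move/eqP: e2; rewrite expg_porbit_eq mod0n -/(dvdn _ _) addnn => /dvdnP[q eq].
have k0 : (0 < k)%N.
  by rewrite lt0n; apply/eqP=> k0; have := nu_free x; rewrite eqk k0 eqxx.
have eL : k.*2 = #|porbit c x|.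
  rewrite eq; have : (q * #|porbit c x| < 2 * #|porbit c x|)%N.
    by rewrite -eq -mul2n ltn_mul2l.
  rewrite ltn_mul2r => /andP[_]; case: q eq => [|[|//]] eq _; last by rewrite mul1n.
  by move: eq k0; case: (k).
by rewrite -eL doubleK odd_double permX.
Qed.

(** The coincidences between words at [x] depend on [ctype x] alone; hence orbits of equal type are
    isomorphic. *)
Lemma word_eqE i e j e' x : (word i e x == word j e' x) =
  if e == e' then i == j %[mod (ctype x).1]
  else (ctype x).2 && (i == j + (ctype x).1./2 %[mod (ctype x).1]).
Proof.
have nu_inj y z : (nu y == nu z) = (y == z) := inj_eq perm_inj y z.
have cross k l : ((c ^+ k)%g x == nu ((c ^+ l)%g x))
    = (ctype x).2 && (k == l + (ctype x).1./2 %[mod (ctype x).1]).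
  rewrite /ctype /= nu_cX.
  case: (boolP (nu x \in porbit c x)) => [nx|nx] /=.
    have [-> _] := nu_porbit nx.
    by rewrite -permM -expgD expg_porbit_eq addnC.
  apply/negbTE; apply: contra nx => /eqP ek.
  by rewrite -eq_porbit_mem -(porbit_perm c l (nu x)) -ek porbit_perm.
rewrite !wordE; case: e e' => [] [] /=; rewrite ?expg1 ?expg0 ?perm1.
- by rewrite nu_inj expg_porbit_eq.
- rewrite -(cross i j) -[in RHS]nu_inj nu_invol //.
- by rewrite cross.
by rewrite expg_porbit_eq.
Qed.

End SignedOrbits.

Section SignedOrbitTypes.
Variables (X : finType) (c nu : {perm X}).
Hypotheses (nuK : (nu * nu = 1)%g) (nu_free : forall x, nu x != x).
Hypothesis cnu : commute c nu.

Lemma ctype_word i e x : ctype c nu (word c nu i e x) = ctype c nu x.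
Proof.
have typ1 y : ctype c nu ((c ^+ i)%g y) = ctype c nu y.
  by rewrite /ctype porbit_perm nu_cX // -!eq_porbit_mem porbit_perm.
rewrite wordE; case: e; last by rewrite expg0 perm1.
rewrite expg1 nu_cX // typ1 /ctype nu_invol // porbit_sym; congr (_, _).
have -> : porbit c (nu x) = [set nu y | y in porbit c x].
  apply/setP=> y; apply/porbitP/imsetP=> [[j ->]|[z /porbitP[j ->] ->]].
    by exists ((c ^+ j)%g x); rewrite ?mem_porbit ?nu_cX.
  by exists j; rewrite nu_cX.
by rewrite card_imset //; apply: perm_inj.
Qed.

Lemma ctype_signed_orbit x y : y \in signed_orbit c nu x ->
  ctype c nu y = ctype c nu x.
Proof. by case/mem_signed_orbitP=> // i [e ->]; apply: ctype_word. Qed.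

Lemma card_signed_orbit x :
  #|signed_orbit c nu x|
  = if (ctype c nu x).2 then (ctype c nu x).1 else (ctype c nu x).1.*2.
Proof.
have cardnu : #|porbit c (nu x)| = #|porbit c x|.
  by have := ctype_word 0 true x; rewrite wordE expg0 perm1 expg1 => -[].
rewrite /signed_orbit /ctype /=; case: ifPn => nx.
  by move: nx; rewrite -eq_porbit_mem => /eqP->; rewrite setUid.
rewrite cardsU cardnu addnn (_ : _ :&: _ = set0) ?cards0 ?subn0 //.
apply/setP=> y; rewrite !inE; apply/negbTE; apply: contra nx => /andP[].
by rewrite -!eq_porbit_mem => /eqP <- /eqP <-.
Qed.

(** Recovers the number of orbits of a type from the number of points of that type, which is easier
    to follow under conjugation and embedding than the chosen bases. *)
Lemma card_ctype t :
  #|[set x | ctype c nu x == t]|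
  = (#|[set x | (base c nu x == x) && (ctype c nu x == t)]|
     * (if t.2 then t.1 else t.1.*2))%N.
Proof.
rewrite -sum1_card (partition_big (base c nu)
  (mem [set x | (base c nu x == x) && (ctype c nu x == t)])) /=; last first.
  move=> x; rewrite !inE => /eqP <-; rewrite base_id // eqxx /=.
  by rewrite (ctype_signed_orbit (base_in cnu x)).
rewrite -sum_nat_const; apply: eq_bigr => b; rewrite inE => /andP[/eqP bb /eqP <-].
rewrite -card_signed_orbit -[RHS]sum1_card; apply: eq_bigl => x; rewrite in_set.
apply/andP/idP=> [[_ /eqP <-]|xb]; first exact: in_signed_orbit_base.
by rewrite (ctype_signed_orbit xb) (base_eq nuK cnu xb) bb !eqxx.
Qed.

Lemma word_surj x : exists i e, x = word c nu i e (base c nu x).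
Proof. exact/mem_signed_orbitP/in_signed_orbit_base. Qed.

End SignedOrbitTypes.

Section Lift.
Variables (X Y : finType) (c nu : {perm X}) (c' nu' : {perm Y}).
Hypotheses (nuK : (nu * nu = 1)%g) (nu_free : forall x, nu x != x).
Hypotheses (nuK' : (nu' * nu' = 1)%g) (nu_free' : forall x, nu' x != x).
Hypotheses (cnu : commute c nu) (cnu' : commute c' nu').

(** An equivariant map may be prescribed on bases: each point is a word at its base, and by
    [word_eqE] two words for the same point still agree after [phi], because [phi] preserves
    types. *)
Lemma lift_orbits (phi : X -> Y) :
  (forall b, base c nu b = b -> ctype c' nu' (phi b) = ctype c nu b) ->
  exists f : X -> Y, forall b i e, base c nu b = b ->
    f (word c nu i e b) = word c' nu' i e (phi b).
Proof.
move=> typ; have ex x : exists ie : nat * bool,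
    x == word c nu ie.1 ie.2 (base c nu x).
  by have [i [e ->]] := word_surj nuK cnu x; exists (i, e); rewrite base_word // base_id.
exists (fun x => word c' nu' (xchoose (ex x)).1 (xchoose (ex x)).2 (phi (base c nu x))).
move=> b i e bb; have := xchooseP (ex (word c nu i e b)).
move: (xchoose _) => [j e'] /=; rewrite base_word // bb eq_sym word_eqE // => h.
by apply/eqP; rewrite word_eqE // typ.
Qed.

End Lift.

Section Inverter.
Variables (X : finType) (c nu : {perm X}).
Hypotheses (nuK : (nu * nu = 1)%g) (nu_free : forall x, nu x != x).
Hypothesis cnu : commute c nu.

(** A permutation and its inverse have the same cycles, so the identity on bases lifts to
    [c^i nu^e b |-> c^-i nu^e b]. *)
Lemma exists_inverter : exists u : {perm X},
  [/\ (u * u = 1)%g, commute u nu, (u * c * u = c^-1)%g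
    & forall x, u x \in signed_orbit c nu x].
Proof.
have cnuV : commute c^-1%g nu by apply/commute_sym/commuteV/commute_sym.
have [f fE] : exists f : X -> X, forall b i e, base c nu b = b ->
    f (word c nu i e b) = word c^-1 nu i e b.
  by apply: lift_orbits => // b _; rewrite /ctype porbitV.
(* Exponents in [word] are natural numbers, so [c^-1] is rewritten as a positive or zero power of
   [c]. *)
pose k := #[c].-1; have ck : (c^-1 = c ^+ k)%g by rewrite invg_expg.
have wV i e : word c^-1 nu i e = word c nu (k * i) e by rewrite /word ck expgM.
have ckk i : (c ^+ (k * (k * i)) = c ^+ i)%g.
  by rewrite mulnA expgM expgM -ck expgVn -ck invgK.
have fK : involutive f.
  move=> x; have [i [e ->]] := word_surj nuK cnu x.
  by rewrite fE ?base_id // wV fE ?base_id // wV /word ckk.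
have uE x : perm (inv_inj fK) x = f x by rewrite permE.
exists (perm (inv_inj fK)); split=> [|||x].
- by apply/permP=> x; rewrite permM !uE fK perm1.
- apply/permP=> x; rewrite !permM !uE.
  have [i [e {1 2}->]] := word_surj nuK cnu x.
  have nuw (c0 : {perm X}) (cc : commute c0 nu) y :
      nu (word c0 nu i e y) = word c0 nu i (~~ e) y.
    have := wordM nuK cc i e 0 true; rewrite addbT addn0 => <-.
    by rewrite permM [in RHS]wordE expg0 perm1 expg1.
  by rewrite fE ?base_id // nuw // nuw // fE ?base_id.
- apply/permP=> x; rewrite !permM !uE.
  have [i [e ->]] := word_surj nuK cnu x; rewrite fE ?base_id // wV.
  rewrite -[c (word _ _ _ _ _)]permM.
  have -> : (word c nu (k * i) e * c = word c nu (k * i + 1) e)%g.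
    rewrite -[in RHS](addbF e) -wordM //; congr (_ * _)%g.
    by rewrite /word expg1 expg0 mulg1.
  rewrite fE ?base_id // wV -[RHS]permM; congr (fun_of_perm _ _).
  have -> : (word c nu i e * c^-1 = word c nu (i + k) e)%g.
    rewrite -[in RHS](addbF e) -wordM //; congr (_ * _)%g.
    by rewrite /word -ck expg0 mulg1.
  by rewrite /word mulnDr muln1 !expgD ckk.
have [i [e ->]] := word_surj nuK cnu x; rewrite uE fE ?base_id // wV.
have orb j e' y : word c nu j e' y \in signed_orbit c nu y.
  by apply/mem_signed_orbitP => //; exists j, e'.
by rewrite (signed_orbit_eq nuK cnu (orb i e _)).
Qed.

End Inverter.

Section ConjugacyByType.
Variables (X : finType) (c c' nu : {perm X}).
Hypotheses (nuK : (nu * nu = 1)%g) (nu_free : forall x, nu x != x).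
Hypotheses (cnu : commute c nu) (cnu' : commute c' nu).

Definition bases (c0 : {perm X}) (t : nat * bool) : {set X} :=
  [set x | (base c0 nu x == x) && (ctype c0 nu x == t)].

(** The signed form of conjugacy by cycle type: bases of equal type are matched by their position in
    the enumerations, and the matching is lifted to the orbits. *)
Lemma conj_by_type : (forall t, #|bases c t| = #|bases c' t|) ->
  exists2 f : {perm X}, commute f nu & (c ^ f = c')%g.
Proof.
move=> eqB; pose t x := ctype c nu x.
pose phi x := nth x (enum (bases c' (t x))) (index x (enum (bases c (t x)))).
have phiB x : base c nu x = x -> phi x \in bases c' (t x).
  move=> bx; rewrite -mem_enum mem_nth // -cardE -eqB cardE index_mem mem_enum.
  by rewrite inE bx !eqxx.
have phi_base x : base c nu x = x -> base c' nu (phi x) = phi x.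
  by move/phiB; rewrite inE => /andP[/eqP].
have phi_type x : base c nu x = x -> ctype c' nu (phi x) = ctype c nu x.
  by move/phiB; rewrite inE => /andP[_ /eqP].
have phi_inj x y : base c nu x = x -> base c nu y = y -> phi x = phi y -> x = y.
  move=> bx by_ e; have txy : t x = t y by rewrite /t -!phi_type // e.
  have mx : x \in enum (bases c (t x)) by rewrite mem_enum inE bx !eqxx.
  have my : y \in enum (bases c (t x)) by rewrite mem_enum inE by_ txy !eqxx.
  have szE : size (enum (bases c' (t x))) = size (enum (bases c (t x))).
    by rewrite -!cardE eqB.
  move/eqP: e; rewrite /phi -txy (set_nth_default x) ?szE ?index_mem //.
  rewrite nth_uniq ?enum_uniq ?szE ?index_mem // => /eqP.
  by move/(congr1 (nth x (enum (bases c (t x))))); rewrite !nth_index.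
have [f fE] := lift_orbits nuK nu_free nuK nu_free cnu cnu' phi_type.
have f_inj : injective f.
  move=> x y; have [i [e xE]] := word_surj nuK cnu x.
  have [j [e' yE]] := word_surj nuK cnu y.
  rewrite xE yE !fE ?base_id // => eqf.
  have eb : base c nu x = base c nu y.
    apply: phi_inj; rewrite ?base_id // -phi_base ?base_id //.
    rewrite -(base_word nuK cnu' i e) eqf base_word //.
    by rewrite phi_base ?base_id.
  move/eqP: eqf; rewrite eb word_eqE // phi_type ?base_id //.
  by move=> h; apply/eqP; rewrite word_eqE.
have pE x : perm f_inj x = f x by rewrite permE.
have wordS (d : {perm X}) i e (cd : commute d nu) y :
    d (word d nu i e y) = word d nu (i + 1) e y.
  rewrite -[e in RHS]addbF -(wordM nuK cd) permM.
  by rewrite [in RHS]wordE expg0 perm1 expg1.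
have nu_word (d : {perm X}) i e (cd : commute d nu) y :
    nu (word d nu i e y) = word d nu i (e (+) true) y.
  rewrite -[i in RHS]addn0 -(wordM nuK cd) permM.
  by rewrite [in RHS]wordE expg0 perm1 expg1.
exists (perm f_inj).
  apply/permP=> x; rewrite !permM !pE; have [i [e xE]] := word_surj nuK cnu x.
  by rewrite xE nu_word // !fE ?base_id // nu_word.
rewrite conjgE; apply: (mulgI (perm f_inj)); rewrite mulKVg.
apply/permP=> x; rewrite !permM !pE; have [i [e xE]] := word_surj nuK cnu x.
by rewrite xE wordS // !fE ?base_id // wordS.
Qed.

End ConjugacyByType.

(** * Two involutions of signed points and their dihedral group *)

Section TwoInvolutions.
Variables (X : finType) (nu s t : {perm X}).
Hypotheses (nuK : (nu * nu = 1)%g) (nu_free : forall x, nu x != x).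
Hypotheses (sK : (s * s = 1)%g) (tK : (t * t = 1)%g).
Hypotheses (snu : commute s nu) (tnu : commute t nu).
Hypotheses (s_nu : forall x, s x != nu x) (t_nu : forall x, t x != nu x).
Local Notation c := (t * s)%g.
Local Notation L x := #|porbit c x|.

Lemma two_inv_nu : commute c nu.
Proof. by apply/commute_sym/commuteM; apply/commute_sym. Qed.
Local Notation cnu := two_inv_nu.

Let sKx x : s (s x) = x. Proof. by rewrite -permM sK perm1. Qed.
Let tKx x : t (t x) = x. Proof. by rewrite -permM tK perm1. Qed.
Let s_nux x : s (nu x) = nu (s x).
Proof. by have /permP/(_ x) := snu; rewrite !permM. Qed.
Let t_nux x : t (nu x) = nu (t x).
Proof. by have /permP/(_ x) := tnu; rewrite !permM. Qed.

(** The dihedral relation: [s] inverts [c]. *)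
Lemma reflect_c i x : (c ^+ i)%g (s ((c ^+ i)%g x)) = s x.
Proof.
elim: i x => [|i IH] x; first by rewrite expg0 !perm1.
have e1 y : (c ^+ i.+1)%g y = c ((c ^+ i)%g y) by rewrite -permM -expgSr.
have e2 y : (c ^+ i.+1)%g y = (c ^+ i)%g (c y) by rewrite -permM -expgS.
by rewrite e1 e2 IH !permM sKx tKx.
Qed.

Lemma reflect_t x : t x = s (c x).
Proof. by rewrite permM sKx. Qed.

Lemma reflect_ct i x : (c ^+ i)%g (t ((c ^+ i)%g x)) = t x.
Proof.
rewrite !reflect_t (_ : c ((c ^+ i)%g x) = (c ^+ i)%g (c x)) ?reflect_c //.
by rewrite -[LHS]permM -[RHS]permM -expgS -expgSr.
Qed.

Lemma s_word i j b x : s x = x -> (L x %| i + j)%N ->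
  s (word c nu i b x) = word c nu j b x.
Proof.
move=> sx dv; have sc : s ((c ^+ i)%g x) = (c ^+ j)%g x.
  apply: (@perm_inj _ (c ^+ i)%g); rewrite reflect_c sx -permM -expgD.
  apply/eqP; rewrite -[x in x == _](perm1 x) -(expg0 c) expg_porbit_eq.
  by rewrite mod0n addnC eq_sym.
rewrite !wordE; case: b; last by rewrite expg0 !perm1.
by rewrite expg1 s_nux sc.
Qed.

Lemma t_word i j b x : s x = x -> (L x %| i.+1 + j)%N ->
  t (word c nu i b x) = word c nu j b x.
Proof.
move=> sx dv; rewrite reflect_t -(s_word b sx dv) -addn1 -[b in RHS]addbF.
by rewrite -(wordM nuK cnu) [in RHS]permM [in RHS]wordE expg0 perm1 expg1.
Qed.

Variables Ps Pt : {set X}.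
Hypothesis Ps_fix : forall x, x \in Ps -> s x = x.
Hypothesis Pt_fix : forall x, x \in Pt -> t x = x.
Hypothesis Ps_nu : forall x, s x = x -> (nu x \in Ps) = (x \notin Ps).
Hypothesis Pt_nu : forall x, t x = x -> (nu x \in Pt) = (x \notin Pt).

(** [h] restricts to a transposition of [P]; outside [P] it is arbitrary. *)
Definition transposes (h : {perm X}) (P : {set X}) : Prop :=
  exists x y, [/\ x \in P /\ y \in P, x != y, h x = y, h y = x
    & forall z, z \in P -> z != x -> z != y -> h z = z] .

(** The set [Ps] contains one point of each pair [x], [nu x] fixed by [s]. On a cycle of even length
    [2 e] through [x0], the half-turn [c^e] commutes with [s], [t] and [nu] and exchanges [x0] with
    the other fixed point of [s]; composing with [nu] if necessary brings that point into [Ps]. By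
    parity [t] has no fixed point there, so extending by the identity off the signed orbit leaves
    [Pt] fixed pointwise. *)
Lemma even_orbit_transposition x0 : x0 \in Ps -> ~~ odd (L x0) ->
  exists h, [/\ commute h s, commute h t, commute h nu, transposes h Ps
              & forall x, x \in Pt -> h x = x].
Proof.
move=> Px0 evL; have sx0 := Ps_fix Px0.
pose e := (L x0)./2; have eL : (e + e)%N = L x0.
  by rewrite addnn -[RHS]odd_double_half (negPf evL).
have L0 : (0 < L x0)%N by rewrite lt0n card_porbit_neq0.
have e0 : (0 < e)%N by move: L0; rewrite -eL; case: (e).
pose W i b := word c nu i b x0.
have W0 : W 0%N false = x0 by apply: word0.
have nuW i b : nu (W i b) = W i (~~ b).
  rewrite /W -[i in RHS]addn0 -addbT -(wordM nuK cnu) permM.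
  by rewrite [in RHS]wordE expg0 perm1 expg1.
have W_mod i j b : i = j %[mod L x0] -> W i b = W j b.
  by move=> eqij; apply/eqP; rewrite (word_eqE nuK nu_free cnu) eqxx eqij.
have sW i j b : (L x0 %| i + j)%N -> s (W i b) = W j b by apply: s_word.
have tW i j b : (L x0 %| i.+1 + j)%N -> t (W i b) = W j b by apply: t_word.
have sWe b : s (W e b) = W e b by apply: sW; rewrite eL.
have sW0 b : s (W 0%N b) = W 0%N b by apply: sW; rewrite dvdn0.
(* Were [c^e] to agree with [nu] at [x0], then at the point [c^(e/2) x0], exponent rounded down, [t]
   (for odd [e]) or [s] (for even [e]) would agree with [nu]. *)
have we_nu : W e false != nu x0.
  apply/eqP=> ew; have nuc k : nu (W k false) = W (k + e)%N false.
    rewrite addnC -[false in RHS]/(false (+) false) /W -(wordM nuK cnu) permM.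
    by rewrite -/(W e false) ew !wordE expg0 !perm1 (nu_cX cnu).
  case oe: (odd e).
    pose f := e./2; have ef : e = (f + f).+1.
      by rewrite addnn -[LHS]odd_double_half oe.
    have /eqP[] := t_nu (W f false); rewrite nuc; apply: tW.
    by rewrite addnA addSn -ef eL.
  pose f := e./2; have ef : e = (f + f)%N.
    by rewrite addnn -[LHS]odd_double_half oe.
  have /eqP[] := s_nu (W f false); rewrite nuc; apply: sW.
  by rewrite addnA -ef eL.
pose eps := W e false \notin Ps.
pose y0 := W e eps.
have Py0 : y0 \in Ps.
  rewrite /y0 /eps; case: (boolP (W e false \in Ps)) => //= nP.
  by rewrite -[true]/(~~ false) -nuW Ps_nu.
have xy0 : x0 != y0.
  rewrite /y0; case: (eps).
    apply: contra we_nu => /eqP x0E; rewrite [X in _ == nu X]x0E nuW /=.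
    exact: eqxx.
  have lteL : (e < L x0)%N by rewrite -eL -[X in (X < _)%N]addn0 ltn_add2l.
  rewrite -[X in X != _]W0 /W (word_eqE nuK nu_free cnu) eqxx mod0n.
  by rewrite (modn_small lteL) eq_sym -lt0n.
pose O := signed_orbit c nu x0.
pose g x := (c ^+ e * nu ^+ eps)%g x.
have OW i b : W i b \in O by apply/(mem_signed_orbitP cnu); exists i, b.
have OP x : x \in O -> exists i b, x = W i b.
  by move/(mem_signed_orbitP cnu).
have gW i b : g (W i b) = W (i + e)%N (b (+) eps).
  by rewrite /g /W -(wordM nuK cnu) permM.
pose h x := if x \in O then g x else x.
have hW i b : h (W i b) = W (i + e)%N (b (+) eps) by rewrite /h OW gW.
have hK : involutive h.
  move=> x; rewrite {2}/h; case: ifPn => Ox; last by rewrite /h (negPf Ox).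
  have [i [b ->]] := OP x Ox; rewrite gW hW -addbA addbb addbF -addnA eL.
  by apply: W_mod; rewrite modnDr.
have comm_h (r : {perm X}) : (r * r = 1)%g ->
    (forall i, exists j d, forall b, r (W i b) = W j (b (+) d)
       /\ r (W (i + e)%N b) = W (j + e)%N (b (+) d)) ->
    forall x, h (r x) = r (h x).
  move=> rK rW x; case: (boolP (x \in O)) => Ox.
    have [i [b ->]] := OP x Ox; have [j [d rE]] := rW i.
    have [-> _] := rE b; have [_] := rE (b (+) eps).
    by rewrite !hW => ->; rewrite addbAC.
  have nOr : r x \notin O.
    apply: contra Ox => /OP[i [b e']]; have [j [d rE]] := rW i.
    by rewrite -[x]perm1 -rK permM e'; have [-> _] := rE b.
  by rewrite /h (negPf Ox) (negPf nOr).
have hE x : perm (inv_inj hK) x = h x by rewrite permE.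
have commP (r : {perm X}) : (forall x, h (r x) = r (h x)) ->
    commute (perm (inv_inj hK)) r.
  by move=> hr; apply/permP=> x; rewrite !permM !hE hr.
have dvdL i : (L x0 %| i + i * (L x0).-1)%N.
  by rewrite -mulnS prednK // dvdn_mull.
exists (perm (inv_inj hK)); split.
- apply/commP/comm_h => // i; exists (i * (L x0).-1)%N, false => b.
  rewrite addbF; split; apply: sW; first exact: dvdL.
  by rewrite addnACA eL dvdn_addl ?dvdnn ?dvdL.
- apply/commP/comm_h => // i; exists (i.+1 * (L x0).-1)%N, false => b.
  rewrite addbF; split; apply: tW; first exact: dvdL.
  by rewrite -addSn addnACA eL dvdn_addl ?dvdnn ?dvdL.
- apply/commP/comm_h => // i; exists i, true => b.
  by rewrite !nuW !addbT.
- exists x0, y0; split=> //; rewrite ?hE.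
  + by rewrite -[X in h X]W0 hW.
  + by rewrite /y0 hW addbb eL -[RHS]W0; apply: W_mod; rewrite modnn mod0n.
  move=> z Pz zx zy; rewrite hE /h; case: ifP => // /OP[i [b zE]].
  have sz := Ps_fix Pz; move: sz; rewrite zE (sW _ _ _ (dvdL i)) => /eqP.
  rewrite (word_eqE nuK nu_free cnu) eqxx /= => hi.
  (* A point [c^i x0], up to sign, is fixed by [s] only if [L] divides [2 i]; with [L = 2 e] this
     leaves the multiples of [e], that is [x0] and its antipode. *)
  have /dvdnP[q iq] : (e %| i)%N.
    have : (L x0 %| i + i)%N.
      by rewrite /dvdn -modnDmr -(eqP hi) modnDmr -/(dvdn _ _) dvdL.
    by rewrite -eL !addnn -!mul2n dvdn_pmul2l.
  have Wq : W i b = if odd q then W e b else W 0%N b.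
    rewrite iq; case: ifP => oq; apply: W_mod.
      rewrite -[q]odd_double_half oq mulnDl mul1n -muln2 -mulnA mul2n -addnn eL.
      by rewrite addnC modnMDl.
    by rewrite -[q]odd_double_half oq add0n -muln2 -mulnA mul2n -addnn eL modnMl mod0n.
  exfalso; move: Pz zx zy; rewrite zE Wq; case: (odd q).
    rewrite /y0; case: (altP (b =P eps)) => [-> _ _ /eqP//|ne Pz _ _].
    move: Py0; rewrite /y0 (_ : eps = ~~ b); last by case: (b) (eps) ne => [] [].
    by rewrite -nuW Ps_nu ?Pz.
  case: b {zE Wq hi} => [Pz _ _|_ /eqP[]]; last exact: W0.
  by move: Px0; rewrite -W0 -(nuW 0%N true) Ps_nu ?Pz.
move=> x Px; rewrite hE /h; case: ifP => // /OP[i [b xE]].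
have := Pt_fix Px; rewrite xE (tW _ _ _ (dvdL i.+1)) => /eqP.
rewrite (word_eqE nuK nu_free cnu) eqxx /= => hi; exfalso.
(* A fixed point of [t] would make the even length [L] divide the odd number [2 i + 1]. *)
have : (L x0 %| i.+1 + i)%N.
  by rewrite /dvdn -modnDmr -(eqP hi) modnDmr -/(dvdn _ _) dvdL.
move/dvdnP=> [q /(congr1 odd)]; rewrite addSn addnn oddS odd_double oddM (negPf evL).
by rewrite andbF.
Qed.

(** * Exchanging the involutions when all fixed points lie on odd cycles *)

Section OddOrbits.
Hypothesis Ps_odd : forall x, x \in Ps -> odd (L x).
Hypothesis Pt_odd : forall x, x \in Pt -> odd (L x).
Local Notation O := (signed_orbit c nu).

Let O_refl x : x \in O x. Proof. exact: (signed_orbit_refl cnu). Qed.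
Let O_eq x y : y \in O x -> O y = O x. Proof. exact: (signed_orbit_eq nuK cnu). Qed.
Let O_word i b x : word c nu i b x \in O x.
Proof. by apply/(mem_signed_orbitP cnu); exists i, b. Qed.
Let O_c i x : (c ^+ i)%g x \in O x.
Proof. by have := O_word i false x; rewrite wordE expg0 perm1. Qed.
Let O_nu x : nu x \in O x.
Proof. by have := O_word 0 true x; rewrite wordE expg0 perm1 expg1. Qed.

Definition fixed_part : {set X} := [set x | [exists y in Ps, x \in O y]].
Local Notation Y := fixed_part.

Lemma fixed_partP x : reflect (exists2 y, y \in Ps & x \in O y) (x \in Y).
Proof. by rewrite inE; apply: exists_inP. Qed.

Lemma fixed_part_orbit x y : y \in O x -> (y \in Y) = (x \in Y).
Proof.
move=> yx; apply/fixed_partP/fixed_partP=> -[z Pz Oz]; exists z => //.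
  by rewrite -(O_eq Oz) (O_eq yx).
by rewrite -(O_eq Oz) -(O_eq yx).
Qed.

Lemma s_fixed_part x : s x = x -> x \in Y.
Proof.
move=> sx; apply/fixed_partP; case: (boolP (x \in Ps)) => Px; first by exists x.
by exists (nu x); rewrite ?Ps_nu // (O_eq (O_nu x)).
Qed.

(** On a cycle of length [2 f + 1], if [t] fixes [y] then [s] fixes [c^(f+1) y]; so the fixed points
    of [t] lie on the orbits of those of [s]. *)
Lemma t_fixed_part x : t x = x -> x \in Y.
Proof.
suff Pt_Y y : y \in Pt -> y \in Y.
  move=> tx; case: (boolP (x \in Pt)) => Px; first exact: Pt_Y.
  by rewrite -(fixed_part_orbit (O_nu x)) Pt_Y // Pt_nu.
move=> Py; pose f := (L y)./2.
have eL : (f + f).+1 = L y by rewrite addnn -[RHS]odd_double_half Pt_odd.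
have sc : s ((c ^+ f.+1)%g y) = (c ^+ f.+1)%g y.
  apply: (@perm_inj _ (c ^+ f)%g); rewrite -[RHS]permM -expgD addSn eL.
  have -> : (c ^+ f.+1)%g y = c ((c ^+ f)%g y) by rewrite -[RHS]permM -expgSr.
  rewrite -reflect_t reflect_ct (Pt_fix Py) -[y in LHS]perm1 -(expg0 c).
  by apply/eqP; rewrite expg_porbit_eq modnn mod0n.
by rewrite -(fixed_part_orbit (O_c f.+1 y)); apply: s_fixed_part.
Qed.

Lemma fixed_partE x : x \in Y ->
  exists y i b, [/\ y \in Ps, s y = y, odd (L y) & x = word c nu i b y].
Proof.
case/fixed_partP=> y Py /(mem_signed_orbitP cnu)[i [b ->]].
by exists y, i, b; rewrite Ps_fix ?Ps_odd.
Qed.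

Lemma s_fixed_orbit x : x \in Y -> s x \in O x.
Proof.
move=> /fixed_partE[y [i [b [_ sy oy ->]]]].
rewrite (@s_word i (i * (L y).-1)) //; last first.
  by rewrite -mulnS prednK ?dvdn_mull // lt0n card_porbit_neq0.
by rewrite (O_eq (O_word i b y)) O_word.
Qed.

(* [c] has odd order on the orbits through a fixed point, so its powers contain
   a square root of [c] there; [sqrt_exp] is the exponent. *)
Definition odd_exp : nat := \prod_(y in Ps) L y.
Definition sqrt_exp : nat := (odd_exp.+1)./2.
Local Notation M := sqrt_exp.

Lemma sqrt_expE : (M + M = odd_exp.+1)%N.
Proof.
have od : odd odd_exp.
  apply: (big_ind (fun p => odd p)) => [//|p q|y]; last exact: Ps_odd.
  by rewrite oddM => -> ->.
by rewrite addnn -[RHS]odd_double_half /= od.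
Qed.

Lemma sqrt_cE x : x \in Y -> (c ^+ (M + M))%g x = c x.
Proof.
case/fixed_partE=> y [i [b [Py _ _ ->]]]; rewrite sqrt_expE -[in RHS](expg1 c).
apply/eqP; rewrite expg_porbit_eq.
have -> : L (word c nu i b y) = L y.
  by have := ctype_word nuK cnu i b y; case.
rewrite -addn1 -{2}[1%N]add0n eqn_modDr mod0n -/(dvdn _ _).
by rewrite /odd_exp (bigD1 y) //= dvdn_mulr.
Qed.

(** A reflection of the dihedral orbit built on the square root [c^M] of [c]; it lies halfway
    between [s] and [t] and so exchanges them. *)
Definition mirror x := s ((c ^+ M)%g x).

Lemma mirror_orbit x : x \in Y -> mirror x \in O x.
Proof.
move=> Yx; rewrite /mirror -(O_eq (O_c M x)) s_fixed_orbit //.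
by rewrite (fixed_part_orbit (O_c M x)).
Qed.

Lemma mirrorK : involutive mirror.
Proof. by move=> x; rewrite /mirror reflect_c sKx. Qed.

Lemma mirror_nu x : mirror (nu x) = nu (mirror x).
Proof. by rewrite /mirror -(nu_cX cnu) s_nux. Qed.

Lemma mirror_s x : x \in Y -> mirror (s x) = t (mirror x).
Proof.
move=> Yx; rewrite reflect_t /mirror; congr (s _).
apply: (@perm_inj _ (c ^+ M)%g); rewrite -[LHS]permM -expgD.
have Ysx : s x \in Y by rewrite (fixed_part_orbit (s_fixed_orbit Yx)).
rewrite sqrt_cE //.
have -> : (c ^+ M)%g (c (s ((c ^+ M)%g x))) = c ((c ^+ M)%g (s ((c ^+ M)%g x))).
  by rewrite -!permM -expgS -expgSr.
by rewrite reflect_c.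
Qed.

(** On an odd cycle [2 i = 0] forces [i = 0], so [s] fixes just one point up to sign, and [Ps]
    selects the sign. *)
Lemma Ps_orbit_uniq x y : x \in Ps -> y \in Ps -> y \in O x -> y = x.
Proof.
move=> Px Py /(mem_signed_orbitP cnu)[i [b yE]].
have sx := Ps_fix Px; have := Ps_fix Py; rewrite yE.
rewrite (@s_word i (i * (L x).-1)) //; last first.
  by rewrite -mulnS prednK ?dvdn_mull // lt0n card_porbit_neq0.
move/eqP; rewrite (word_eqE nuK nu_free cnu) eqxx /= => hi.
have dv : (L x %| i)%N.
  have : (L x %| i + i)%N.
    rewrite /dvdn -modnDmr -(eqP hi) modnDmr -mulnS prednK ?modnMl //.
    by rewrite lt0n card_porbit_neq0.
  by rewrite addnn -muln2 Gauss_dvdl // coprimen2 Ps_odd.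
have y0 : y = word c nu 0 b x.
  apply/eqP; rewrite yE (word_eqE nuK nu_free cnu) eqxx mod0n; exact: dv.
rewrite -yE y0 wordE expg0 perm1; case: (b) y0 => [y0|_]; last by rewrite expg0 perm1.
by move: Py; rewrite y0 wordE expg0 perm1 expg1 Ps_nu // Px.
Qed.

(** The mirror carries the one point of [Ps] on the orbit to a fixed point of [t], possibly of the
    wrong sign; [twist] records whether [nu] must correct it. *)
Definition twist x := [exists y in Ps, (y \in O x) && (mirror y \notin Pt)].

Lemma twist_orbit x y : y \in O x -> twist y = twist x.
Proof. by move=> yx; rewrite /twist (O_eq yx). Qed.

(** Off [fixed_part], [s] exchanges two distinct signed orbits; comparing the ranks of their bases
    selects one of the two. *)
Definition side x := (enum_rank (base c nu x) < enum_rank (base c nu (s x)))%N.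

(** If [s x = c^i nu^b x], then at the midpoint [c^(i/2) x], exponent rounded down, [s] (for even
    [i]) or [t] (for odd [i]) acts as [nu^b]. Acting as [nu] is excluded, so the midpoint is a fixed
    point and the orbit belongs to [fixed_part]. *)
Lemma free_base x : x \notin Y -> base c nu x != base c nu (s x).
Proof.
move=> nYx; apply: contraNneq nYx => eb.
have : s x \in O x.
  have := in_signed_orbit_base nuK cnu (s x); rewrite -eb.
  by rewrite (O_eq (base_in cnu x)).
case/(mem_signed_orbitP cnu)=> i [b sxE].
have key (r : {perm X}) y : (forall z, r z != nu z) ->
    r y = (nu ^+ b)%g y -> r y = y.
  move=> rnu; case: b {sxE} => ry; last by rewrite ry expg0 perm1.
  by have := rnu y; rewrite ry expg1 eqxx.
have nub j y : (nu ^+ b)%g ((c ^+ j)%g y) = (c ^+ j)%g ((nu ^+ b)%g y).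
  by case: (b); rewrite ?expg1 ?(nu_cX cnu) // expg0 !perm1.
case oi: (odd i); pose f := i./2.
  have iE : i = (f + f.+1)%N by rewrite addnS addnn -[LHS]odd_double_half oi.
  rewrite -(fixed_part_orbit (O_c f x)); apply/t_fixed_part/key => //.
  rewrite reflect_t; apply: (@perm_inj _ (c ^+ f.+1)%g).
  rewrite -[c _]permM -expgSr reflect_c sxE wordE iE.
  by rewrite !nub -[RHS]permM -expgD.
have iE : i = (f + f)%N by rewrite addnn -[LHS]odd_double_half oi.
rewrite -(fixed_part_orbit (O_c f x)); apply/s_fixed_part/key => //.
apply: (@perm_inj _ (c ^+ f)%g); rewrite reflect_c sxE wordE iE.
by rewrite !nub -[RHS]permM -expgD.
Qed.

Lemma s_orbit x y : y \in O x -> s y \in O (s x).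
Proof.
case/(mem_signed_orbitP cnu)=> i [b ->]; rewrite -(reflect_c i x) (O_eq (O_c i _)).
have -> : s (word c nu i b x) = word c nu 0 b (s ((c ^+ i)%g x)).
  by rewrite !wordE expg0 perm1; case: b; rewrite ?expg1 ?s_nux // expg0 !perm1.
exact: O_word.
Qed.

Lemma side_orbit x y : y \in O x -> side y = side x.
Proof.
move=> yx; rewrite /side (base_eq nuK cnu yx).
by rewrite (base_eq nuK cnu (s_orbit yx)).
Qed.

Lemma side_s x : x \notin Y -> side (s x) = ~~ side x.
Proof.
move/free_base=> ne; rewrite /side sKx ltnNge leq_eqVlt.
by rewrite (inj_eq (@ord_inj _)) (inj_eq enum_rank_inj) (negPf ne).
Qed.

(** On [fixed_part], [z] is the mirror with its sign corrected. Elsewhere it is an inverter [u] of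
    [c] on the chosen side, and the relation [z s = t z] forces [t u s] on the other side; that [z]
    is an involution there amounts to [u c u = c^-1]. *)
Lemma odd_swap : exists z : {perm X},
  [/\ (z * z = 1)%g, commute z nu, (s ^ z = t)%g
    & forall x, (x \in Ps) = (z x \in Pt)].
Proof.
have [u [uK unu ucu uO]] := exists_inverter nuK nu_free cnu.
have uKx x : u (u x) = x by rewrite -permM uK perm1.
have u_nux x : u (nu x) = nu (u x) by have /permP/(_ x) := unu; rewrite !permM.
have ucux x : u (c (u x)) = t (s x).
  have /permP/(_ x) := ucu; rewrite !permM => ->.
  apply: (@perm_inj _ c); rewrite -permM mulVg perm1.
  by rewrite permM tKx sKx.
have nubK (b : bool) x : (nu ^+ b)%g ((nu ^+ b)%g x) = x.
  case: b; first by rewrite expg1 -permM nuK perm1.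
  by rewrite expg0 !perm1.
have nub_mirror (b : bool) x : mirror ((nu ^+ b)%g x) = (nu ^+ b)%g (mirror x).
  by case: (b); rewrite ?expg1 ?mirror_nu // expg0 !perm1.
have O_nub (b : bool) x : (nu ^+ b)%g x \in O x.
  by case: (b); rewrite ?expg1 ?O_nu // expg0 perm1.
pose z x := if x \in Y then (nu ^+ twist x)%g (mirror x)
            else if side x then u x else t (u (s x)).
have zY x : x \in Y -> z x = (nu ^+ twist x)%g (mirror x) by rewrite /z => ->.
have zY_orbit x : x \in Y -> z x \in O x.
  move=> Yx; rewrite zY // -(O_eq (mirror_orbit Yx)); exact: O_nub.
have sY x : (s x \in Y) = (x \in Y).
  apply/idP/idP=> Yx; last by rewrite (fixed_part_orbit (s_fixed_orbit Yx)).
  by rewrite -(sKx x) (fixed_part_orbit (s_fixed_orbit Yx)).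
have cY x : (c x \in Y) = (x \in Y).
  by rewrite (fixed_part_orbit (O_c 1 x)).
have tY x : (t x \in Y) = (x \in Y) by rewrite reflect_t sY cY.
have uY x : (u x \in Y) = (x \in Y) by rewrite (fixed_part_orbit (uO x)).
have side_u x : side (u x) = side x := side_orbit (uO x).
have side_t x : x \notin Y -> side (t x) = ~~ side x.
  by move=> nY; rewrite reflect_t side_s ?cY // (side_orbit (O_c 1 x)).
have zA x : x \notin Y -> side x -> z x = u x by rewrite /z => /negPf-> ->.
have zB x : x \notin Y -> ~~ side x -> z x = t (u (s x)).
  by rewrite /z => /negPf-> /negPf->.
have zYE x : (z x \in Y) = (x \in Y).
  case: (boolP (x \in Y)) => Yx; first by rewrite (fixed_part_orbit (zY_orbit x Yx)).
  apply/negbTE; case: (boolP (side x)) => sx; first by rewrite zA ?uY.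
  by rewrite zB // tY uY sY.
have zK : involutive z.
  move=> x; case: (boolP (x \in Y)) => Yx.
    rewrite zY ?zYE // (twist_orbit (zY_orbit x Yx)) zY // nub_mirror mirrorK.
    exact: nubK.
  case: (boolP (side x)) => sx; first by rewrite (zA x) // zA ?uY ?side_u // uKx.
  have sA : side (s x) by rewrite side_s.
  rewrite (zB x) // zB ?tY ?uY ?sY //; last by rewrite side_t ?uY ?sY // side_u sA.
  have -> : s (t (u (s x))) = c (u (s x)) by rewrite [RHS]permM.
  by rewrite ucux !tKx sKx.
have zS x : z (s x) = t (z x).
  case: (boolP (x \in Y)) => Yx.
    rewrite !zY ?sY // (twist_orbit (s_fixed_orbit Yx)) mirror_s //.
    by case: (twist x); rewrite ?expg1 ?t_nux // expg0 !perm1.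
  case: (boolP (side x)) => sx.
    by rewrite zB ?sY ?side_s ?sx // sKx zA.
  by rewrite zA ?sY ?side_s // zB // tKx.
have zN x : z (nu x) = nu (z x).
  have YN : (nu x \in Y) = (x \in Y) := fixed_part_orbit (O_nu x).
  have sN : side (nu x) = side x := side_orbit (O_nu x).
  case: (boolP (x \in Y)) => Yx.
    rewrite !zY ?YN // (twist_orbit (O_nu x)) mirror_nu.
    by case: (twist x); rewrite ?expg1 // expg0 !perm1.
  case: (boolP (side x)) => sx; first by rewrite !zA ?YN ?sN.
  by rewrite !zB ?YN ?sN // s_nux u_nux t_nux.
have zE x : perm (inv_inj zK) x = z x by rewrite permE.
have PsPt x : x \in Ps -> z x \in Pt.
  move=> Px; have sx := Ps_fix Px; have Yx := s_fixed_part sx.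
  have tm : t (mirror x) = mirror x by rewrite -mirror_s // sx.
  rewrite zY //; have -> : twist x = (mirror x \notin Pt).
    apply/exists_inP/idP => [[y Py /andP[Oy]]|nP].
      by rewrite (Ps_orbit_uniq Px Py Oy).
    by exists x; rewrite // O_refl.
  case: (boolP (mirror x \in Pt)) => mP; first by rewrite expg0 perm1.
  by rewrite expg1 Pt_nu.
exists (perm (inv_inj zK)); split.
- by apply/permP=> x; rewrite permM !zE zK perm1.
- by apply/permP=> x; rewrite !permM !zE zN.
- rewrite conjgE; apply: (mulgI (perm (inv_inj zK))); rewrite mulKVg.
  by apply/permP=> x; rewrite !permM !zE zS.
move=> x; rewrite zE; apply/idP/idP=> [/PsPt //|Pzx].
have sx : s x = x.
  by apply: (can_inj zK); rewrite zS (Pt_fix Pzx).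
case: (boolP (x \in Ps)) => // nPx; have : nu x \in Ps by rewrite Ps_nu.
by move/PsPt; rewrite zN Pt_nu ?Pzx ?(Pt_fix Pzx).
Qed.

End OddOrbits.

End TwoInvolutions.

(* With [s] the pairing of the head coordinates, [t] its conjugate by [g], and
   [Ps], [Pt] the positive tail points and their images under [g], the two cases
   are those of [gelfand_trick]: [z] gives an involution in [H g], while [h] lies
   in [H :&: H :^ g^-1] and is odd on exactly one of the two tails. *)
Lemma swap_or_transpose (X : finType) (nu s t : {perm X}) (Ps Pt : {set X}) :
  (nu * nu = 1)%g -> (forall x, nu x != x) -> (s * s = 1)%g -> (t * t = 1)%g ->
  commute s nu -> commute t nu ->
  (forall x, s x != nu x) -> (forall x, t x != nu x) ->
  (forall x, x \in Ps -> s x = x) -> (forall x, x \in Pt -> t x = x) ->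
  (forall x, s x = x -> (nu x \in Ps) = (x \notin Ps)) ->
  (forall x, t x = x -> (nu x \in Pt) = (x \notin Pt)) ->
  (exists z : {perm X}, [/\ (z * z = 1)%g, commute z nu, (s ^ z = t)%g
    & forall x, (x \in Ps) = (z x \in Pt)]) \/
  (exists h : {perm X}, [/\ commute h s, commute h t, commute h nu
    & (transposes h Ps /\ forall x, x \in Pt -> h x = x)
      \/ (transposes h Pt /\ forall x, x \in Ps -> h x = x)]).
Proof.
move=> nuK nu_free sK tK snu tnu s_nu t_nu Psf Ptf Psn Ptn.
have cV : (t * s = (s * t)^-1)%g.
  rewrite invMg; have -> : (t^-1 = t)%g by apply/eqP; rewrite eq_invg_mul tK.
  by have -> : (s^-1 = s)%g by apply/eqP; rewrite eq_invg_mul sK.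
case: (boolP [forall x in Ps, odd #|porbit (t * s) x|]); last first.
  rewrite negb_forall => /existsP[x]; rewrite negb_imply => /andP[Px ev].
  have [h [hs ht hn tr fx]] :=
    even_orbit_transposition nuK nu_free sK tK snu tnu s_nu t_nu Psf Ptf Psn Px ev.
  by right; exists h; split=> //; left.
move/forall_inP=> Po.
case: (boolP [forall x in Pt, odd #|porbit (t * s) x|]); last first.
  (* The roles of [s] and [t] are exchanged: [s * t] is the inverse of [t * s] and has the same
     cycles. *)
  rewrite negb_forall => /existsP[x]; rewrite negb_imply cV porbitV => /andP[Px ev].
  have [h [hs ht hn tr fx]] :=
    even_orbit_transposition nuK nu_free tK sK tnu snu t_nu s_nu Ptf Psf Ptn Px ev.
  by right; exists h; split=> //; right.
move/forall_inP=> Qo; left.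
exact: (odd_swap nuK nu_free sK tK snu tnu s_nu t_nu Psf Ptf Psn Ptn Po Qo).
Qed.

(** Without fixed points [fixed_part] for empty point sets is empty, so [side] is a two-colouring of
    all points, changed by both involutions. *)
Lemma two_sides (X : finType) (nu s t : {perm X}) :
  (nu * nu = 1)%g -> (s * s = 1)%g -> (t * t = 1)%g ->
  commute s nu -> commute t nu ->
  (forall x, s x != nu x) -> (forall x, t x != nu x) ->
  (forall x, s x != x) -> (forall x, t x != x) ->
  exists sd : X -> bool, [/\ forall x, sd (nu x) = sd x,
    forall x, sd (s x) = ~~ sd x & forall x, sd (t x) = ~~ sd x].
Proof.
move=> nuK sK tK snu tnu s_nu t_nu s_free t_free.
have orb := side_orbit nuK sK tK snu tnu.
have cnu := two_inv_nu snu tnu.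
have sdS x : side nu s t (s x) = ~~ side nu s t x.
  apply: (side_s nuK sK tK snu tnu s_nu t_nu (Ps := set0) (Pt := set0)).
  - by move=> y; rewrite inE.
  - by move=> y /eqP; rewrite (negPf (s_free y)).
  - by move=> y /eqP; rewrite (negPf (t_free y)).
  - by move=> y; rewrite inE.
  by rewrite inE; apply/exists_inP=> -[y]; rewrite inE.
have in_orbit i e x : word (t * s)%g nu i e x \in signed_orbit (t * s)%g nu x.
  by apply/(mem_signed_orbitP cnu); exists i, e.
exists (side nu s t); split=> // x.
  by apply: orb; have := in_orbit 0%N true x; rewrite wordE expg0 perm1 expg1.
rewrite (reflect_t t sK) sdS; congr (~~ _).
by apply: orb; have := in_orbit 1%N false x; rewrite wordE expg0 perm1 expg1.
Qed.

(** * The ordinary layers *)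

Section SignedCommute.
Variable n : nat.

Lemma sneg_invol : involutive (@sneg n).
Proof. by move=> [i b]; rewrite /sneg /= negbK. Qed.

Definition neg_perm : sperm n := perm (inv_inj sneg_invol).

Lemma neg_permE i b : neg_perm (i, b) = (i, ~~ b).
Proof. by rewrite permE. Qed.

Lemma neg_permK : (neg_perm * neg_perm = 1)%g.
Proof. by apply/permP=> -[i b]; rewrite permM !neg_permE perm1 negbK. Qed.

Lemma neg_perm_free x : neg_perm x != x.
Proof. by case: x => i b; rewrite neg_permE xpair_eqE eqxx /=; case: b. Qed.

Lemma signed_commute (w : sperm n) : is_signed w <-> commute w neg_perm.
Proof.
split=> [/is_signedP hw|/permP hw].
  apply/permP=> -[i b]; rewrite !permM neg_permE hw.
  by case: (w _) => j d; rewrite neg_permE.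
apply/is_signedP=> i b; have := hw (i, b); rewrite !permM neg_permE => <-.
by case: (w _) => j d; rewrite neg_permE.
Qed.

Lemma signedV (w : sperm n) : is_signed w -> is_signed w^-1%g.
Proof. by move/signed_commute=> cw; apply/signed_commute/commute_sym/commuteV/commute_sym. Qed.

Lemma signedJ (v w : sperm n) : is_signed v -> is_signed w -> is_signed (v ^ w)%g.
Proof. by move=> hv hw; rewrite conjgE !signedM // signedV. Qed.

Lemma sneg_signed (w : sperm n) i b : is_signed w -> w (i, ~~ b) = sneg (w (i, b)).
Proof. by move/is_signedP. Qed.

End SignedCommute.

(** * The paired group as a centraliser *)

Section PairedGenerators.
Variables n k : nat.
Hypothesis le2k : (2 * k <= n)%N.

Lemma coord_subproof (i : 'I_k) (p : bool) : (2 * i + p < n)%N.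
Proof.
apply: leq_trans le2k; apply: leq_trans (_ : 2 * i.+1 <= _)%N.
  by rewrite mulnS addnC ltn_add2r; case: p.
by rewrite leq_mul2l ltn_ord.
Qed.
Definition coord i p : 'I_n := Ordinal (coord_subproof i p).

Lemma coord_inj i p j q : (coord i p == coord j q) = (i == j) && (p == q).
Proof.
apply/eqP/andP=> [eqc|[/eqP-> /eqP-> //]].
have e : (2 * i + p = 2 * j + q)%N := congr1 val eqc.
have ep : p = q.
  by have := congr1 odd e; rewrite !mul2n !oddD !odd_double; case: (p) (q) => [] [].
split; last exact/eqP; apply/eqP/val_inj/eqP.
by move/eqP: e; rewrite ep eqn_add2r eqn_mul2l.
Qed.

Lemma coordP (x : 'I_n) : (x < 2 * k)%N -> exists i p, x = coord i p.
Proof.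
move=> lt; have hk : (x./2 < k)%N.
  rewrite -ltn_double -!mul2n; apply: leq_ltn_trans lt.
  by rewrite mul2n -{2}(odd_double_half x) leq_addl.
exists (Ordinal hk), (odd x); apply: val_inj => /=.
by rewrite mul2n addnC odd_double_half.
Qed.

Lemma coord_lt i p j : (coord i p < 2 * j)%N = (i < j)%N.
Proof.
by rewrite /= !mul2n addnC; case: p; rewrite ?add1n ?add0n ?ltn_double // ltn_Sdouble.
Qed.

Lemma coord_tpermE' (x y : 'I_n) : coord_tperm n x y = tperm x y.
Proof. by rewrite /coord_tperm !valK. Qed.

Lemma gen_a_coord (i : 'I_k) : gen_a n i = cperm (tperm (coord i false) (coord i true)).
Proof. by rewrite -coord_tpermE' /gen_a /= addn0 addn1. Qed.

Lemma gen_c_coord (i : 'I_k) : gen_c n i =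
  (tperm (coord i false, false) (coord i false, true)
   * tperm (coord i true, false) (coord i true, true))%g.
Proof.
have flipE' (x : 'I_n) : flip n x = tperm (x, false) (x, true) by rewrite /flip valK.
by rewrite -!flipE' /gen_c /= addn0 addn1.
Qed.

Definition pair_swap (i j : 'I_k) : sperm n :=
  cperm (tperm (coord i false) (coord j false) * tperm (coord i true) (coord j true))%g.

Lemma gen_b_coord (i j : 'I_k) : j = i.+1 :> nat -> gen_b n i = pair_swap i j.
Proof. by move=> e; rewrite /pair_swap -!coord_tpermE' /gen_b /= !addn0 !addn1 e. Qed.

Lemma gen_aE_coord (i j : 'I_k) p b :
  gen_a n i (coord j p, b) = (coord j (p (+) (i == j)), b).
Proof.
rewrite gen_a_coord cpermE; congr (_, _); case: tpermP => [/eqP|/eqP|].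
- by rewrite coord_inj => /andP[/eqP-> /eqP->]; rewrite eqxx.
- by rewrite coord_inj => /andP[/eqP-> /eqP->]; rewrite eqxx.
move=> /eqP; rewrite coord_inj => n1 /eqP; rewrite coord_inj => n2.
by move: n1 n2; rewrite eq_sym; case: eqP => //; case: p.
Qed.

Lemma gen_cE_coord (i j : 'I_k) p b :
  gen_c n i (coord j p, b) = (coord j p, b (+) (i == j)).
Proof.
have fl (x y : 'I_n) d : tperm (x, false) (x, true) (y, d) = (y, d (+) (x == y)).
  have [->|ne] := eqVneq x y; last by rewrite tpermD ?addbF // xpair_eqE (negPf ne).
  by case: d; rewrite ?tpermL ?tpermR.
by rewrite gen_c_coord permM !fl !coord_inj -addbA; congr (_, _ (+) _); case: (i == j) p => [] [].
Qed.

Lemma pair_swapE (i j l : 'I_k) p b :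
  pair_swap i j (coord l p, b) = (coord (tperm i j l) p, b).
Proof.
rewrite cpermE permM; congr (_, _).
have tc (q : bool) : tperm (coord i q) (coord j q) (coord l p)
     = if p == q then coord (tperm i j l) p else coord l p.
  case: (altP (p =P q)) => [->|ne].
    case: (tpermP i j l) => [->|->|n1 n2]; rewrite ?tpermL ?tpermR //.
    by rewrite tpermD // coord_inj eqxx andbT eq_sym; apply/eqP.
  by rewrite tpermD // coord_inj eq_sym [q == p]eq_sym (negPf ne) andbF.
rewrite tc; case: p tc => tc; rewrite ?tc //=.
have tc' (l' : 'I_k) : tperm (coord i true) (coord j true) (coord l' false) = coord l' false.
  by rewrite tpermD // coord_inj andbF.
exact: tc'.
Qed.

Lemma gen_tailE (w : sperm n) (x : 'I_n) b :
  w \in Cgroup n k -> (2 * k <= x)%N -> w (x, b) = (x, b).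
Proof.
move/(subsetP (C_head n k)); rewrite inE => hw hx.
by apply: (out_perm hw); rewrite inE /= -leqNgt.
Qed.

Lemma gen_a_mem (i : 'I_k) : gen_a n i \in Cgroup n k.
Proof. by apply: mem_gen; rewrite !inE (imset_f (fun i : 'I_k => gen_a n i)). Qed.

Lemma gen_c_mem (i : 'I_k) : gen_c n i \in Cgroup n k.
Proof. by apply: mem_gen; rewrite !inE (imset_f (fun i : 'I_k => gen_c n i)) ?orbT. Qed.

Lemma gen_b_mem (i : 'I_k) : (i.+1 < k)%N -> gen_b n i \in Cgroup n k.
Proof.
move=> hi; apply: mem_gen; rewrite !inE.
by rewrite (imset_f (fun i : 'I_k => gen_b n i)) ?inE ?hi ?orbT.
Qed.

Lemma head_ext (v w : sperm n) :
  (forall (x : 'I_n) b, (2 * k <= x)%N -> v (x, b) = w (x, b)) ->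
  (forall i p b, v (coord i p, b) = w (coord i p, b)) -> v = w.
Proof.
move=> vt vh; apply/permP=> -[x b]; have [|lt] := leqP (2 * k) x; first exact: vt.
by have [i [p ->]] := coordP lt.
Qed.

Lemma pair_swap_tail i j (x : 'I_n) b : (2 * k <= x)%N -> pair_swap i j (x, b) = (x, b).
Proof.
move=> hx; have ne l p : coord l p != x.
  by apply: contraTneq hx => <-; rewrite -ltnNge coord_lt.
by rewrite cpermE permM !tpermD.
Qed.

(** Adjacent transpositions generate: with [j' = j - 1], the swap of [i] and [j] is the conjugate of
    the swap of [i] and [j'] by that of [j'] and [j]. *)
Lemma pair_swap_mem i j : pair_swap i j \in Cgroup n k.
Proof.
wlog: i j / (i <= j)%N => [W|].
  case: (leqP i j) => [|/ltnW] le; first exact: W.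
  rewrite (_ : pair_swap i j = pair_swap j i) ?W //.
  by rewrite /pair_swap tpermC [X in (_ * X)%g]tpermC.
move: {2}(j - i)%N (erefl (j - i)%N) => d; elim: d j => [|d IH] j ed le.
  rewrite (_ : pair_swap i j = 1%g) ?group1 //.
  have -> : j = i by apply/val_inj/eqP; rewrite eqn_leq le andbT -subn_eq0 ed.
  by rewrite /pair_swap !tperm1 mulg1 (morph1 (cperm_morphism n)).
have lt : (i < j)%N by rewrite -subn_gt0 ed.
have j1 : (j.-1 < k)%N by apply: leq_ltn_trans (leq_pred j) _.
pose j' := Ordinal j1; have jj' : j = j'.+1 :> nat by rewrite /= prednK //; case: (val j) lt.
have Cb : pair_swap j' j \in Cgroup n k.
  by rewrite -(gen_b_coord jj') gen_b_mem // -jj'.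
have Ci : pair_swap i j' \in Cgroup n k.
  by apply: IH; [rewrite /= -subn1 subnAC ed subn1 | rewrite -ltnS -jj'].
have [->//|ne] := eqVneq i j'.
suff -> : pair_swap i j = (pair_swap i j' ^ pair_swap j' j)%g by rewrite groupJ.
rewrite conjgE (_ : (pair_swap j' j)^-1%g = pair_swap j' j); last first.
  apply/eqP; rewrite eq_invg_mul; apply/eqP/head_ext=> [x b hx|l p b].
    by rewrite permM !pair_swap_tail // perm1.
  by rewrite permM !pair_swapE tpermK perm1.
have ne2 : j' != j by rewrite -(inj_eq val_inj) /= [X in _ == X]jj' neq_ltn ltnSn.
apply: head_ext=> [x b hx|l p b]; first by rewrite !permM !pair_swap_tail.
rewrite !permM !pair_swapE; congr (coord _ _, _).
have : tperm i j = (tperm i j' ^ tperm j' j)%g.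
  by rewrite tpermJ tpermL tpermD // eq_sym // -(inj_eq val_inj) /= neq_ltn lt.
move=> ->; rewrite conjgE !permM; congr (tperm _ _ (tperm _ _ _)).
by rewrite tpermV.
Qed.

Definition pair_flip (x : 'I_n) : 'I_n :=
  if (x < 2 * k)%N then insubd x (if odd x then x.-1 else x.+1) else x.

Lemma pair_flip_coord i p : pair_flip (coord i p) = coord i (~~ p).
Proof.
rewrite /pair_flip coord_lt ltn_ord; apply: val_inj.
rewrite val_insubd /= mul2n oddD odd_double /= oddb -mul2n; case: p; rewrite ?addn0 ?addn1 /=.
  by rewrite (leq_ltn_trans _ (coord_subproof i true)) //= addn1 leqnSn.
by have := coord_subproof i true; rewrite addn1 => ->.
Qed.

Lemma pair_flip_tail (x : 'I_n) : (2 * k <= x)%N -> pair_flip x = x.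
Proof. by rewrite /pair_flip ltnNge => ->. Qed.

Lemma pair_flipK : involutive pair_flip.
Proof.
move=> x; have [/pair_flip_tail e|lt] := leqP (2 * k) x; first by rewrite !e.
by have [i [p ->]] := coordP lt; rewrite !pair_flip_coord negbK.
Qed.

(** The product of all [gen_a]; [Cgroup n k] is its centraliser among the signed permutations that
    fix the tail. *)
Definition flip_perm : sperm n := cperm (perm (inv_inj pair_flipK)).

Lemma flip_permE x b : flip_perm (x, b) = (pair_flip x, b).
Proof. by rewrite cpermE permE. Qed.

(** Sifting by induction on the number of pairs that may move: a product of generators agrees with
    [v] at one coordinate of the last pair, hence on the pair, since both commute with the flip and
    with negation. Dividing by it leaves one pair less. *)
Lemma mem_Cgroup (w : sperm n) :
  is_signed w -> commute w flip_perm ->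
  (forall (x : 'I_n) b, (2 * k <= x)%N -> w (x, b) = (x, b)) ->
  w \in Cgroup n k.
Proof.
move=> sw cw wt.
suff gen j : (j <= k)%N -> forall v : sperm n, is_signed v -> commute v flip_perm ->
    (forall (x : 'I_n) b, (2 * j <= x)%N -> v (x, b) = (x, b)) -> v \in Cgroup n k.
  exact: (gen k).
elim: j => [|j IH] lejk v sv cv vt.
  rewrite (_ : v = 1%g) ?group1 //; apply/permP=> -[x b].
  by rewrite perm1 vt // muln0.
pose jj : 'I_k := Ordinal lejk.
have vflip x b : v (pair_flip x, b) = (pair_flip (v (x, b)).1, (v (x, b)).2).
  have /permP/(_ (x, b)) := cv; rewrite !permM flip_permE => <-.
  by case: (v _) => y d; rewrite flip_permE.
case vj: (v (coord jj false, false)) => [y e].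
have le2 : (2 * j.+1 <= 2 * k)%N by rewrite leq_mul2l.
have lty : (y < 2 * j.+1)%N.
  rewrite ltnNge; apply/negP=> ge; have : v (y, e) = v (coord jj false, false).
    by rewrite vj vt.
  move=> /perm_inj[yE _].
  by move: ge; rewrite yE leqNgt coord_lt /= ltnS leqnn.
have [i [p yE]] := coordP (leq_trans lty le2).
have leij : (i <= j)%N by move: lty; rewrite yE coord_lt ltnS.
(* The swap brings the last pair to the pair of its image, [p] adjusts the order within the pair and
   [e] the sign. *)
pose u := (pair_swap i jj * (if p then gen_a n i else 1)
           * (if e then gen_c n i else 1))%g.
have Cu : u \in Cgroup n k.
  rewrite !groupM ?pair_swap_mem //; first by case: (p); rewrite ?gen_a_mem.
  by case: (e); rewrite ?gen_c_mem.
have uE l q b : u (coord l q, b) = (coord (tperm i jj l) (q (+) (p && (i == tperm i jj l))),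
                                   b (+) (e && (i == tperm i jj l))).
  rewrite !permM pair_swapE; case: (p); rewrite ?gen_aE_coord ?perm1;
    case: (e); rewrite ?gen_cE_coord ?perm1 ?addbF //=.
clearbody u; have su : is_signed u.
  apply/is_signedP=> x b; have [hx|lt] := leqP (2 * k) x.
    by rewrite !(gen_tailE _ Cu).
  by have [l [q ->]] := coordP lt; rewrite !uE /sneg /= addNb.
have cu : commute u flip_perm.
  apply: head_ext=> [x b hx|l q b].
    by rewrite !permM flip_permE pair_flip_tail // (gen_tailE _ Cu) // flip_permE
      pair_flip_tail.
  by rewrite !permM flip_permE pair_flip_coord !uE flip_permE pair_flip_coord addNb.
suff Cvu : (v * u^-1)%g \in Cgroup n k by rewrite -(mulgKV u v) groupM.
have uj : u (coord jj false, false) = (y, e).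
  by rewrite uE tpermR eqxx !andbT yE.
have vu0 : (v * u^-1)%g (coord jj false, false) = (coord jj false, false).
  by rewrite permM vj -uj permK.
have svu : is_signed (v * u^-1)%g by rewrite signedM // signedV.
have cvu : commute (v * u^-1)%g flip_perm.
  by apply/commute_sym/commuteM; [exact/commute_sym|apply/commuteV/commute_sym].
apply: IH => // [|x b hx]; first exact: ltnW.
have fixb (z : 'I_n) : (v * u^-1)%g (z, false) = (z, false) ->
    (v * u^-1)%g (z, b) = (z, b).
  by move=> fz; case: (b) => //; rewrite -[true]/(~~ false) sneg_signed // fz.
have [ge|lt] := leqP (2 * j.+1) x.
  rewrite permM vt //; apply: (@perm_inj _ u); rewrite permKV.
  have [hxk|ltk] := leqP (2 * k) x; first by rewrite (gen_tailE _ Cu).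
  have [l [q xE]] := coordP ltk; have ltl : (j < l)%N 
    by move: ge; rewrite xE leqNgt coord_lt ltnS -ltnNge.
  have lN1 : i != l by rewrite neq_ltn (leq_ltn_trans leij).
  have lN2 : jj != l by rewrite neq_ltn /= ltl.
  by rewrite xE uE tpermD // (negPf lN1) !andbF !addbF.
have xE : exists q, x = coord jj q.
  have [l [q xE]] := coordP (leq_trans lt le2).
  exists q; rewrite xE; congr coord; apply/val_inj/eqP; rewrite eqn_leq.
  by move: hx lt; rewrite xE leqNgt !coord_lt -leqNgt ltnS => -> ->.
have [[] ->] := xE; last exact: fixb.
apply: fixb; have /permP/(_ (coord jj false, false)) := cvu.
rewrite [in LHS]permM [in RHS]permM vu0 flip_permE pair_flip_coord /=.
by move=> <-.
Qed.

End PairedGenerators.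

Lemma linear_sign_hom (gT : finGroupType) (H : {group gT}) (lambda : 'CF(H)) :
  lambda \is a linear_char -> {in H, forall h, lambda h = 1 \/ lambda h = -1} ->
  sign_hom H (fun h => lambda h != 1)
  /\ {in H, forall h, lambda h = (-1) ^+ (lambda h != 1)}.
Proof.
move=> lin val; have n1 : (-1 : algC) != 1.
  by rewrite eq_sym -subr_eq0 opprK -(natrD _ 1 1) pnatr_eq0.
split=> [x y Hx Hy|h Hh]; last by case: (val h Hh) => ->; rewrite ?eqxx ?n1.
rewrite lin_charM //.
by case: (val x Hx) (val y Hy) => -> [] ->; rewrite ?mulrNN ?mulr1 ?mul1r ?eqxx ?n1.
Qed.

Lemma cperm_in_D n (r : 'S_n) : cperm r \in Dgroup n.
Proof.
rewrite inE signed_cperm sign_changesE big1 // => i _.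
by rewrite cpermE.
Qed.

Lemma coord_flipE n (x y : 'I_n) (b : bool) :
  tperm (x, false) (x, true) (y, b) = (y, b (+) (x == y)).
Proof.
have [->|ne] := eqVneq x y; last by rewrite tpermD ?addbF // xpair_eqE (negPf ne).
by case: b; rewrite ?tpermL ?tpermR.
Qed.

Lemma coord_flip_signed n (x : 'I_n) : is_signed (tperm (x, false) (x, true)).
Proof. by apply/is_signedP=> y b; rewrite !coord_flipE /sneg /= addNb. Qed.

Lemma coord_flip_odd n (x : 'I_n) : odd (sign_changes (tperm (x, false) (x, true))).
Proof.
rewrite sign_changesE (bigD1 x) //= coord_flipE eqxx big1 // => y ne.
by rewrite coord_flipE eq_sym (negPf ne).
Qed.

Lemma Cgroup_in_D n k : (2 * k <= n)%N -> Cgroup n k \subset Dgroup n.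
Proof.
move=> le2k; rewrite gen_subG; apply/subsetP=> w.
rewrite in_setU => /orP[|].
  rewrite in_setU => /orP[|] /imsetP[i _ ->]; first exact: cperm_in_D.
  rewrite inE (gen_c_coord le2k) signedM ?coord_flip_signed //.
  by rewrite sign_changesM ?coord_flip_signed // !coord_flip_odd.
by case/imsetP=> i _ ->; apply: cperm_in_D.
Qed.

Section Layer.
Variables n k : nat.
Hypothesis le2k : (2 * k <= n)%N.
Local Notation H := (Cgroup n k <*> tail_sym n k)%G.
Local Notation fl := (flip_perm le2k).

Lemma head_lt_neq (x y : 'I_n) : (x < 2 * k)%N -> (2 * k <= y)%N -> x != y.
Proof. by move=> lt le; apply: contraTneq lt => ->; rewrite -leqNgt. Qed.

Lemma Sym_tail_head (r : 'S_n) (x : 'I_n) : r \in perm.Sym (tail n k) ->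
  (x < 2 * k)%N -> r x = x.
Proof. by rewrite inE => hr hx; apply: (out_perm hr); rewrite inE -ltnNge. Qed.

Lemma Sym_tail_tail (r : 'S_n) (x : 'I_n) : r \in perm.Sym (tail n k) ->
  (2 * k <= x)%N -> (2 * k <= r x)%N.
Proof. by rewrite inE => hr hx; have := perm_closed x hr; rewrite !inE hx. Qed.

(** The unsigned factor is read off from the positive tail and extended by the identity on the head;
    the quotient satisfies the criterion [mem_Cgroup]. *)
Lemma layer_decomposition (h : sperm n) :
  is_signed h -> commute h fl ->
  (forall x : 'I_n, (2 * k <= x)%N ->
     (2 * k <= (h (x, false)).1)%N && ~~ (h (x, false)).2) ->
  exists c r, [/\ c \in Cgroup n k, r \in perm.Sym (tail n k) & h = (c * cperm r)%g].
Proof.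
move=> sh ch th; have sE x b := signedE x b sh.
pose f (x : 'I_n) := if (2 * k <= x)%N then (h (x, false)).1 else x.
have f_inj : injective f.
  move=> x y; rewrite /f; case: leqP => hx; case: leqP => hy // e.
  - have [_ /negPf ex] := andP (th x hx); have [_ /negPf ey] := andP (th y hy).
    have : h (x, false) = h (y, false).
      by rewrite [LHS]surjective_pairing [RHS]surjective_pairing e ex ey.
    by move/perm_inj=> [].
  - by have [] := andP (th x hx); rewrite e leqNgt hy.
  by have [] := andP (th y hy); rewrite -e leqNgt hx.
pose r := perm f_inj.
have Sr : r \in perm.Sym (tail n k).
  rewrite inE; apply/subsetP=> x; rewrite inE permE /f.
  by rewrite inE; case: (leqP (2 * k) x) => //; rewrite eqxx.
have cr : commute (cperm r) fl.
  apply: (head_ext (le2k := le2k)) => [x b hx|i p b].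
    rewrite !permM [in RHS]flip_permE pair_flip_tail // [cperm r _]cpermE flip_permE.
    by rewrite pair_flip_tail // Sym_tail_tail.
  have lt : (coord le2k i p < 2 * k)%N by rewrite coord_lt.
  rewrite !permM [in RHS]flip_permE [cperm r (coord _ _ _, _)]cpermE Sym_tail_head //.
  by rewrite flip_permE pair_flip_coord cpermE Sym_tail_head // coord_lt.
exists (h * (cperm r)^-1)%g, r; split=> //; last by rewrite mulgKV.
apply: (mem_Cgroup (le2k := le2k)).
- by rewrite signedM // signedV // signed_cperm.
- by apply/commute_sym/commuteM; [exact/commute_sym|apply/commuteV/commute_sym].
move=> x b hx; rewrite permM; apply: (@perm_inj _ (cperm r)); rewrite permKV cpermE sE.
have [_ /negPf->] := andP (th x hx); rewrite addbF; congr (_, _).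
by rewrite permE /f hx.
Qed.

Lemma layer_char_lin : layer_char n k \is a linear_char.
Proof.
apply: cfDprod_lin_char; first exact: cfun1_lin_char.
by rewrite /sgn_tail cfIsom_lin_char lin_cfun_lin.
Qed.

Lemma layer_charE c r : c \in Cgroup n k -> r \in perm.Sym (tail n k) ->
  layer_char n k (c * cperm r)%g = (-1) ^+ (r : bool).
Proof.
move=> Cc Sr; have Tr : cperm r \in tail_sym n k.
  exact: (mem_morphim (cperm_morphism n) (in_setT r) Sr).
by rewrite /layer_char cfDprodE // cfun1E Cc mul1r sgn_tailE.
Qed.

Lemma mem_layerP h : h \in H ->
  exists c r, [/\ c \in Cgroup n k, r \in perm.Sym (tail n k) & h = (c * cperm r)%g].
Proof.
rewrite /= -(dprodWY (C_tail_dprod n k)).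
case/dprodP: (C_tail_dprod n k) => _ <- _ _ /mulsgP[c w Cc /tail_sym_fix[r Sr ->] ->].
by exists c, r.
Qed.

Lemma mem_layer c r : c \in Cgroup n k -> r \in perm.Sym (tail n k) ->
  (c * cperm r)%g \in H.
Proof.
move=> Cc Sr; have Tr : cperm r \in tail_sym n k.
  exact: (mem_morphim (cperm_morphism n) (in_setT r) Sr).
by rewrite groupM // mem_gen // inE ?Cc ?Tr ?orbT.
Qed.

Lemma layer_char_sign : {in H, forall h, layer_char n k h = 1 \/ layer_char n k h = -1}.
Proof.
move=> h /mem_layerP[c [r [Cc Sr ->]]]; rewrite layer_charE //.
by case: (r : bool); [right|left].
Qed.

Lemma layer_tail c r (x : 'I_n) b : c \in Cgroup n k -> (2 * k <= x)%N ->
  (c * cperm r)%g (x, b) = (r x, b).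
Proof. by move=> Cc hx; rewrite permM (gen_tailE _ Cc) // cpermE. Qed.

Definition pos_tail : {set 'I_n * bool} :=
  [set x : 'I_n * bool | (2 * k <= x.1)%N && ~~ x.2].

Lemma mem_pos_tail x b : ((x, b) \in pos_tail) = (2 * k <= x)%N && ~~ b.
Proof. by rewrite inE. Qed.

Lemma flip_permK : (fl * fl = 1)%g.
Proof.
by apply/permP=> -[x b]; rewrite permM !flip_permE (pair_flipK le2k) perm1.
Qed.

Lemma flip_perm_signed : is_signed fl.
Proof. exact: signed_cperm. Qed.

Lemma flip_perm_neg x : fl x != neg_perm n x.
Proof.
case: x => x b; rewrite flip_permE neg_permE xpair_eqE negb_and orbC.
by case: b.
Qed.

Lemma flip_perm_fix x b : (fl (x, b) == (x, b)) = (2 * k <= x)%N.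
Proof.
rewrite flip_permE xpair_eqE eqxx andbT; have [hx|lt] := leqP (2 * k) x.
  by rewrite pair_flip_tail // eqxx.
have [i [p ->]] := coordP le2k lt; rewrite pair_flip_coord coord_inj eqxx.
by case: p.
Qed.

Lemma layer_sign_transposes (h : sperm n) : is_signed h -> commute h fl ->
  transposes h pos_tail -> h \in H /\ layer_char n k h = -1.
Proof.
move=> sh ch [[x b] [[y d] [[]]]]; rewrite !mem_pos_tail.
move=> /andP[hx /negPf->] /andP[hy /negPf->] ne hxy hyx fixz {b d}.
have hz (z : 'I_n) : (2 * k <= z)%N -> h (z, false) = (tperm x y z, false).
  move=> hz; case: tpermP => [->|->|/eqP nx /eqP ny] //.
  by apply: fixz; rewrite ?mem_pos_tail ?hz // xpair_eqE eqxx andbT.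
have [|c [r [Cc Sr hE]]] := layer_decomposition sh ch.
  move=> z gez; rewrite hz //= andbT.
  by case: tpermP => // ->.
have rE : r = tperm x y.
  apply/permP=> z; have [gez|lt] := leqP (2 * k) z.
    by have := hz z gez; rewrite hE layer_tail // => -[].
  rewrite (Sym_tail_head Sr lt) tpermD // eq_sym; exact: head_lt_neq.
rewrite hE mem_layer // layer_charE // rE odd_tperm.
by have -> : x != y by apply: contraNneq ne => ->.
Qed.

Lemma layer_sign_fixes (h : sperm n) : is_signed h -> commute h fl ->
  (forall x, x \in pos_tail -> h x = x) -> h \in H /\ layer_char n k h = 1.
Proof.
move=> sh ch fixz.
have hz (z : 'I_n) : (2 * k <= z)%N -> h (z, false) = (z, false).
  by move=> hz; rewrite fixz // mem_pos_tail hz.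
have [|c [r [Cc Sr hE]]] := layer_decomposition sh ch.
  by move=> z gez; rewrite hz //= gez.
have rE : r = 1%g.
  apply/permP=> z; rewrite perm1; have [gez|lt] := leqP (2 * k) z.
    by have := hz z gez; rewrite hE layer_tail // => -[].
  exact: (Sym_tail_head Sr lt).
by rewrite hE mem_layer // layer_charE // rE odd_perm1.
Qed.

Lemma mem_layer_stable (h : sperm n) : is_signed h -> commute h fl ->
  (forall x, x \in pos_tail -> h x \in pos_tail) -> h \in H.
Proof.
move=> sh ch st; have [|c [r [Cc Sr ->]]] := layer_decomposition sh ch.
  by move=> z gez; have := st (z, false); rewrite !inE /= gez => /(_ isT).
exact: mem_layer.
Qed.

Lemma layer_trick : gelfand_trick (Dgroup n) H (fun h => layer_char n k h != 1).
Proof.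
move=> g; rewrite inE => /andP[sg _].
pose t := (fl ^ g)%g; pose Pt := [set g x | x in pos_tail].
have n1 : (-1 : algC) != 1.
  by rewrite eq_sym -subr_eq0 opprK -(natrD _ 1 1) pnatr_eq0.
have g_nu x : g (neg_perm n x) = neg_perm n (g x).
  by have /permP/(_ x) := (signed_commute g).1 sg; rewrite !permM.
have tE x : t (g x) = g (fl x) by rewrite permJ.
have PtE x : (g x \in Pt) = (x \in pos_tail).
  by apply/imsetP/idP => [[y Py /perm_inj ->]|Px] //; exists x.
have fl_fix x : x \in pos_tail -> fl x = x.
  by case: x => x b; rewrite mem_pos_tail => /andP[hx _]; apply/eqP; rewrite flip_perm_fix.
have t_fix x : x \in Pt -> t x = x.
  by case/imsetP=> y Py ->; rewrite tE fl_fix.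
have P_nu x : fl x = x -> (neg_perm n x \in pos_tail) = (x \notin pos_tail).
  case: x => x b /eqP; rewrite flip_perm_fix neg_permE !mem_pos_tail => ->.
  by case: b.
have Pt_nu x : t x = x -> (neg_perm n x \in Pt) = (x \notin Pt).
  rewrite -[x](permKV g) tE => /perm_inj fx.
  by rewrite -g_nu !PtE P_nu.
have t_nu x : t x != neg_perm n x.
  by rewrite -[x](permKV g) tE -g_nu (inj_eq perm_inj) flip_perm_neg.
have st : is_signed t by rewrite signedJ // flip_perm_signed.
have tK : (t * t = 1)%g by rewrite -conjMg flip_permK conj1g.
have [[z [zK znu zs zP]]|[h [hs ht hn hP]]] := swap_or_transpose (neg_permK n)
    (@neg_perm_free n) flip_permK tK ((signed_commute _).1 flip_perm_signed)
    ((signed_commute _).1 st) flip_perm_neg t_nu fl_fix t_fix P_nu Pt_nu.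
  (* Both [z] and [g] conjugate [fl] to [t] and carry [pos_tail] onto [Pt], so [z g^-1] centralises
     [fl] and preserves [pos_tail]. *)
  left; exists (z * g^-1)%g; last by rewrite mulgKV.
  apply: mem_layer_stable.
  - by rewrite signedM ?signedV //; apply/signed_commute.
  - by apply/commute_sym/commgP/conjg_fixP; rewrite conjgM zs conjgK.
  by move=> x; rewrite permM zP => /imsetP[y Py ->]; rewrite permK.
(* The conjugate by [g] of this element is [h]. The sign of [h] is read on [pos_tail], that of
   [h ^ g^-1] on [Pt], and exactly one of them is a transposition. *)
right; exists (h ^ g^-1)%g; rewrite conjgKV.
have sh : is_signed h by apply/signed_commute.
have sh1 : is_signed (h ^ g^-1)%g by rewrite signedJ // signedV.
have ch1 : commute (h ^ g^-1)%g fl.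
  by rewrite -[fl](conjgK g) -/t /commute -!conjMg ht.
have h1E x : (h ^ g^-1)%g x = g^-1%g (h (g x)) by rewrite conjgE invgK !permM.
case: hP => -[tr fx].
  have [Hh ->] := layer_sign_transposes sh hs tr.
  have [|Hh1 ->] := layer_sign_fixes sh1 ch1.
    by move=> x Px; rewrite h1E fx ?PtE // permK.
  by rewrite Hh Hh1 eqxx n1.
have [Hh ->] := layer_sign_fixes sh hs fx.
have [|Hh1 ->] := layer_sign_transposes sh1 ch1.
  case: tr => x [y [[/imsetP[x' Px ->] /imsetP[y' Py ->]] ne hxy hyx fz]].
  exists x', y'; rewrite !h1E hxy hyx !permK; split=> //.
    by apply: contraNneq ne => ->.
  move=> z Pz zx zy; rewrite h1E fz ?PtE ?(inj_eq perm_inj) //.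
  by rewrite permK.
by rewrite Hh Hh1 eqxx n1.
Qed.

Lemma layer_in_D : H \subset Dgroup n.
Proof.
rewrite join_subG Cgroup_in_D //; apply/subsetP=> w /tail_sym_fix[r _ ->].
exact: cperm_in_D.
Qed.

Lemma layer_gelfand : linear_gelfand_triple (Dgroup n) (layer_char n k).
Proof.
have [hb hE] := linear_sign_hom layer_char_lin layer_char_sign.
split; [exact: layer_in_D | exact: layer_char_lin |].
exact: (gelfand_trick_multiplicity_free layer_in_D hb hE layer_trick).
Qed.

End Layer.

(** * Double cosets of the group of paired signed permutations *)

Section TypeEmbedding.
Variables (X Y : finType) (c nu : {perm X}) (c' nu' : {perm Y}) (f : X -> Y).
Hypotheses (f_inj : injective f) (fc : forall x, f (c x) = c' (f x)).
Hypothesis fnu : forall x, f (nu x) = nu' (f x).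

Lemma embed_expg i x : f ((c ^+ i)%g x) = (c' ^+ i)%g (f x).
Proof. by elim: i x => [|i IH] x; rewrite ?expg0 ?perm1 // !expgSr !permM fc IH. Qed.

Lemma porbit_embed x : porbit c' (f x) = [set f y | y in porbit c x].
Proof.
apply/setP=> y; apply/porbitP/imsetP=> [[i ->]|[z /porbitP[i ->] ->]].
  by exists ((c ^+ i)%g x); rewrite ?mem_porbit ?embed_expg.
by exists i; rewrite embed_expg.
Qed.

Lemma ctype_embed x : ctype c' nu' (f x) = ctype c nu x.
Proof. by rewrite /ctype porbit_embed card_imset // -fnu mem_imset. Qed.

End TypeEmbedding.

(** * Parity of sign changes and negative cycles *)

Section SignParity.
Variable m : nat.
Local Notation nu := (neg_perm m).

Lemma odd_cperm (r : 'S_m) : odd_perm (cperm r) = false.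
Proof.
case: (prod_tpermP r) => ts -> _; elim: ts => [|[x y] ts IH].
  by rewrite big_nil (morph1 (cperm_morphism m)) odd_perm1.
rewrite big_cons (morphM (cperm_morphism m)) ?inE // odd_permM IH addbF /=.
have tE d z b : tperm (x, d) (y, d) (z, b) = (if b == d then tperm x y z else z, b).
  case: eqP => [->|/eqP ne]; last by rewrite tpermD // xpair_eqE [d == b]eq_sym (negPf ne) andbF.
  case: tpermP => [[->]|[->]|n1 n2]; rewrite ?tpermL ?tpermR // tpermD //.
    by apply/eqP=> e; apply: n1; rewrite e.
  by apply/eqP=> e; apply: n2; rewrite e.
have -> : cperm (tperm x y) = (tperm (x, false) (y, false) * tperm (x, true) (y, true))%g.
  by apply/permP=> -[z b]; rewrite cpermE permM !tE; case: b.
by rewrite odd_permM !odd_tperm !xpair_eqE !eqxx !andbT addbb.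
Qed.

(** An unsigned permutation acts evenly on signed points, as it permutes both signs alike, and each
    sign change is removed by one transposition of signed points. *)
Lemma odd_sign_changes (w : sperm m) : is_signed w ->
  odd (sign_changes w) = odd_perm w.
Proof.
move: {2}(sign_changes w) (leqnn (sign_changes w)) => j; elim: j w => [|j IH] w le sw.
  have s0 x : (w (x, false)).2 = false.
    apply/negbTE/negP=> wx; move: le; rewrite leqn0 sign_changesE sum_nat_eq0.
    by move/forallP/(_ x); rewrite /= wx.
  have -> : w = cperm (perm (signed_abs_inj sw)).
    apply/permP=> -[x b]; rewrite cpermE permE (signedE _ _ sw) s0 addbF.
    by [].
  by rewrite odd_cperm sign_changesE big1 // => x _; rewrite cpermE.
case: (posnP (sign_changes w)) => [e|gt0]; first by apply: IH; rewrite // e.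
have [x wx] : exists x, (w (x, false)).2.
  apply/existsP; apply: contraLR gt0; rewrite negb_exists => /forallP n0.
  rewrite -leqNgt leqn0 sign_changesE sum_nat_eq0; apply/forallP=> x.
  by rewrite /= (negPf (n0 x)).
pose fx := tperm (x, false) (x, true).
have sfx : is_signed fx := coord_flip_signed x.
have sc : (sign_changes (fx * w)%g).+1 = sign_changes w.
  rewrite !sign_changesE (bigD1 x) //= [RHS](bigD1 x) //= wx permM coord_flipE eqxx.
  rewrite (signedE _ _ sw) /= wx add0n add1n; congr _.+1; apply: eq_bigr => y ne.
  by rewrite permM coord_flipE eq_sym (negPf ne).
have -> : w = (fx * (fx * w))%g by rewrite mulgA tperm2 mul1g.
rewrite sign_changesM ?signedM // odd_permM (IH (fx * w)%g) ?signedM //; last by rewrite -ltnS sc.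
by rewrite coord_flip_odd odd_tperm xpair_eqE eqxx.
Qed.

Section Bases.
Variable c : sperm m.
Hypothesis cnu : commute c nu.
Let nuK := neg_permK m.
Let nu_free := @neg_perm_free m.

Definition neg_bases : {set 'I_m * bool} :=
  [set x | (base c nu x == x) && (ctype c nu x).2].
Definition pos_bases : {set 'I_m * bool} :=
  [set x | (base c nu x == x) && ~~ (ctype c nu x).2].

Lemma base_nub x (e : bool) : base c nu ((nu ^+ e)%g x) = base c nu x.
Proof. by have := base_word nuK cnu 0 e x; rewrite wordE expg0 perm1. Qed.

Lemma porbit_base_inj x y (e e' : bool) : base c nu x = x -> base c nu y = y ->
  porbit c ((nu ^+ e)%g x) = porbit c ((nu ^+ e')%g y) -> x = y.
Proof.
move=> bx by_ /eqP; rewrite eq_porbit_mem => /porbitP[i xE].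
rewrite -bx -by_ -(base_nub x e) -(base_nub y e') xE.
by have := base_word nuK cnu i false ((nu ^+ e')%g y); rewrite wordE expg0 perm1.
Qed.

(** A negative signed orbit is a single cycle, a positive one is a cycle together with its
    negative. *)
Lemma card_porbits_bases : #|porbits c| = (#|neg_bases| + 2 * #|pos_bases|)%N.
Proof.
pose B := [set x | base c nu x == x].
have -> : porbits c = [set porbit c x | x in B] :|: [set porbit c (nu x) | x in pos_bases].
  apply/setP=> O; apply/idP/idP; last first.
    by case/setUP=> /imsetP[x _ ->]; apply: imset_f.
  case/imsetP=> x _ ->; rewrite in_setU; apply/orP.
  have [i [e xE]] := word_surj nuK cnu x; set b := base c nu x in xE.
  have Bb : b \in B by rewrite inE /b base_id.
  have -> : porbit c x = porbit c ((nu ^+ e)%g b).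
    rewrite xE /word permM; case: (e); rewrite ?expg1 ?(nu_cX cnu) ?expg0 ?perm1 porbit_perm //.
  case: (e); last by left; apply/imsetP; exists b; rewrite // expg0 perm1.
  rewrite expg1; case: (boolP (ctype c nu b).2) => [neg|pos].
    by left; apply/imsetP; exists b => //; apply/eqP; rewrite eq_porbit_mem.
  by right; apply/imsetP; exists b => //; move: Bb; rewrite !inE pos => ->.
rewrite cardsU (_ : _ :&: _ = set0) ?cards0 ?subn0; last first.
  apply/setP=> O; rewrite in_set0; apply/negbTE/negP=> /setIP[/imsetP[x Bx ->]].
  case/imsetP=> y; rewrite inE => /andP[/eqP by_ pos] e.
  move: Bx; rewrite inE => /eqP bx; have xy : x = y.
    by apply: (@porbit_base_inj _ _ false true) => //; rewrite expg0 perm1.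
  by move/eqP: e; rewrite xy eq_sym eq_porbit_mem; apply/negP.
rewrite !card_in_imset.
- have -> : B = neg_bases :|: pos_bases.
    by apply/setP=> x; rewrite !inE -andb_orr orbN andbT.
  rewrite cardsU (_ : _ :&: _ = set0) ?cards0 ?subn0 -?addnA ?addnn ?mul2n //.
  by apply/setP=> x; rewrite !inE; case: (base c nu x == x) (ctype c nu x).2 => [] [].
- move=> x y; rewrite !inE => /andP[/eqP bx _] /andP[/eqP by_ _] e.
  exact: (@porbit_base_inj _ _ true true).
move=> x y; rewrite !inE => /eqP bx /eqP by_ e.
by apply: (@porbit_base_inj _ _ false false) => //; rewrite expg0 !perm1.
Qed.

(** The parity of a permutation is that of the number of points minus the number of cycles; there
    are [2 m] points, and positive orbits contribute two cycles each. *)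
Lemma odd_sign_changes_bases : odd (sign_changes c) = odd #|neg_bases|.
Proof.
rewrite odd_sign_changes; last exact/signed_commute.
rewrite /odd_perm card_porbits_bases card_prod card_bool card_ord muln2 odd_double.
by rewrite oddD oddM addbF.
Qed.

End Bases.
End SignParity.

(** * Signed points as triples of pair, sign and side *)

Section Coordinates.
Variable m : nat.
Local Notation n := (2 * m)%N.
Local Notation X := ('I_n * bool)%type.
Local Notation Y := ('I_m * bool)%type.
Local Notation A := (Y * bool)%type.
Local Notation crd := (coord (leqnn n)).
Local Notation fl := (flip_perm (leqnn n)).
Local Notation C := (Cgroup n m).
Implicit Types (g h w : {perm A}) (u p : {perm Y}).

(* The signed point [(i, b)] of pair [i], on the even ([false]) or odd ([true])
   coordinate of that pair. *)
Definition join (a : A) : X := (crd a.1.1 a.2, a.1.2).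

Lemma join_inj : injective join.
Proof.
move=> [[i b] p] [[j d] q] /eqP; rewrite xpair_eqE coord_inj.
by case/andP=> /andP[/eqP /= -> /eqP /= ->] /eqP /= ->.
Qed.

Lemma join_surj x : exists a, join a == x.
Proof.
case: x => x b; have [i [q ->]] := coordP (leqnn n) (ltn_ord x).
by exists ((i, b), q).
Qed.

Definition split x : A := xchoose (join_surj x).

Lemma splitK : cancel split join.
Proof. by move=> x; apply/eqP/(xchooseP (join_surj x)). Qed.

Lemma joinK : cancel join split.
Proof. by move=> a; apply: join_inj; rewrite splitK. Qed.

Lemma transport_subproof w : injective (fun x => join (w (split x))).
Proof. by move=> x y /join_inj/perm_inj/(can_inj splitK). Qed.

(** Conjugation by [join]. In this model the central sign change and the pairing become [nuA] and
    [sA], each acting on a single component. *)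
Definition transport w : {perm X} := perm (@transport_subproof w).
Local Notation J := transport.

Lemma transportE w a : J w (join a) = join (w a).
Proof. by rewrite permE joinK. Qed.

Lemma join_ext (v w : {perm X}) : (forall a, v (join a) = w (join a)) -> v = w.
Proof. by move=> e; apply/permP=> x; rewrite -(splitK x). Qed.

Lemma transportM v w : J (v * w)%g = (J v * J w)%g.
Proof. by apply: join_ext => a; rewrite permM !transportE permM. Qed.

Lemma transport1 : J 1%g = 1%g.
Proof. by apply: join_ext => a; rewrite transportE !perm1. Qed.

Lemma transportV w : J w^-1%g = (J w)^-1%g.
Proof. by apply/eqP; rewrite eq_sym eq_invg_mul -transportM mulgV transport1. Qed.

Lemma transportJ v w : J (v ^ w)%g = (J v ^ J w)%g.
Proof. by rewrite !conjgE !transportM transportV. Qed.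

Lemma transport_inj : injective J.
Proof.
move=> v w e; apply/permP=> a; apply: join_inj.
by rewrite -!transportE e.
Qed.

Lemma transport_surj (v : {perm X}) : exists w, v = J w.
Proof.
have inj : injective (fun a => split (v (join a))).
  by move=> a b /(can_inj splitK)/perm_inj/join_inj.
by exists (perm inj); apply: join_ext => a; rewrite transportE permE splitK.
Qed.

Lemma nuA_invol : involutive (fun a : A => (neg_perm m a.1, a.2)).
Proof. by move=> [y q] /=; rewrite -permM neg_permK perm1. Qed.
Definition nuA : {perm A} := perm (inv_inj nuA_invol).
Lemma nuAE y q : nuA (y, q) = (neg_perm m y, q).
Proof. by rewrite permE. Qed.

Lemma sideA_invol : involutive (fun a : A => (a.1, ~~ a.2)).
Proof. by move=> [y q] /=; rewrite negbK. Qed.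
Definition sA : {perm A} := perm (inv_inj sideA_invol).
Lemma sAE y q : sA (y, q) = (y, ~~ q).
Proof. by rewrite permE. Qed.

Lemma transport_nu : J nuA = neg_perm n.
Proof.
by apply: join_ext => -[[i b] q]; rewrite transportE nuAE neg_permE /join /= neg_permE.
Qed.

Lemma transport_s : J sA = fl.
Proof.
apply: join_ext => -[[i b] q]; rewrite transportE sAE flip_permE.
by rewrite pair_flip_coord.
Qed.

Lemma commute_transport v w : commute (J v) (J w) <-> commute v w.
Proof.
rewrite /commute -!transportM; split=> [/transport_inj //|->]; first by [].
Qed.

Lemma transport_signed w : is_signed (J w) <-> commute w nuA.
Proof. by rewrite signed_commute -transport_nu commute_transport. Qed.

Lemma mem_C w : (J w \in C) <-> commute w nuA /\ commute w sA.
Proof.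
split=> [Cw|[cn cs]]; last first.
  apply: (mem_Cgroup (le2k := leqnn n)); first exact/transport_signed.
    by rewrite -transport_s; apply/commute_transport.
  by move=> x b; rewrite leqNgt ltn_ord.
have := subsetP (C_sub_Q m) _ Cw; rewrite inE => /andP[sw /pairedP pw].
split; first exact/transport_signed.
apply/commute_transport; rewrite transport_s; apply: join_ext => -[[i b] q].
have pE j d : pair_flip m (crd j d) = partner (crd j d).
  rewrite pair_flip_coord; apply: val_inj; rewrite /= mul2n oddD odd_double oddb.
  by case: d; rewrite /= ?addn0 ?addn1.
rewrite !permM [in RHS]flip_permE pE pw.
case: (J w _) => x d; rewrite flip_permE /=.
by have [j [q' ->]] := coordP (leqnn n) (ltn_ord x); rewrite pE.
Qed.

Lemma nuAK : (nuA * nuA = 1)%g.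
Proof. by apply/permP=> -[y q]; rewrite permM !nuAE -permM neg_permK !perm1. Qed.

Lemma sAK : (sA * sA = 1)%g.
Proof. by apply/permP=> -[y q]; rewrite permM !sAE negbK perm1. Qed.

Lemma sA_nuA : commute sA nuA.
Proof. by apply/permP=> -[y q]; rewrite !permM !(sAE, nuAE). Qed.

Lemma nuA_free a : nuA a != a.
Proof. by case: a => y q; rewrite nuAE xpair_eqE eqxx andbT neg_perm_free. Qed.

Lemma sA_free a : sA a != a.
Proof. by case: a => y q; rewrite sAE xpair_eqE eqxx /=; case: q. Qed.

Lemma sA_neq_nuA a : sA a != nuA a.
Proof. by case: a => y q; rewrite sAE nuAE xpair_eqE negb_and orbC; case: q. Qed.

(** This is the case of an empty tail: a transposition of the empty set is impossible, so
    [swap_or_transpose] always yields the involution, whatever the character. *)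
Lemma C_trick (w : {perm X}) : is_signed w -> exists2 h, h \in C & ((h * w) * (h * w) = 1)%g.
Proof.
have [g ->] := transport_surj w; move/transport_signed=> gn.
have [t tdef] : exists t, t = (sA ^ g)%g by eexists.
have g_nu a : g (nuA a) = nuA (g a) by have /permP/(_ a) := gn; rewrite !permM.
have tE a : t (g a) = g (sA a) by rewrite tdef permJ.
have t_nu a : t a != nuA a.
  by rewrite -[a](permKV g) tE -g_nu (inj_eq perm_inj) sA_neq_nuA.
have tn : commute t nuA.
  apply/permP=> a; rewrite !permM -[a](permKV g) tE -!g_nu tE.
  by have /permP/(_ (g^-1%g a)) := sA_nuA; rewrite !permM => ->.
have tK : (t * t = 1)%g by rewrite tdef -conjMg sAK conj1g.
have none (P : A -> Prop) a : a \in set0 -> P a by rewrite inE.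
have no_s a : sA a = a -> (nuA a \in set0) = (a \notin set0).
  by move/eqP; rewrite (negPf (sA_free a)).
have no_t a : t a = a -> (nuA a \in set0) = (a \notin set0).
  by rewrite -[a](permKV g) tE => /perm_inj/eqP; rewrite (negPf (sA_free _)).
case: (swap_or_transpose nuAK nuA_free sAK tK sA_nuA tn sA_neq_nuA t_nu
    (none _) (none _) no_s no_t) => [[z [zK zn zs _]]|]; last first.
  by case=> h [_ _ _ [] [[a [b [[]]]]]]; rewrite inE.
exists (J (z * g^-1))%g; last by rewrite -!transportM mulgKV zK transport1.
apply/mem_C; split; first by apply/commute_sym/commuteM; [|apply/commuteV]; apply/commute_sym.
by apply/commute_sym/commgP/conjg_fixP; rewrite conjgM zs tdef conjgK.
Qed.

Lemma C_gelfand_trick (b : {perm X} -> bool) : gelfand_trick (Dgroup n) C b.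
Proof.
move=> g; rewrite inE => /andP[sg _]; left; exact: C_trick.
Qed.

End Coordinates.

(** * Normal forms and invariants of double cosets *)

Section DoubleCosetModel.
Variable m : nat.
Local Notation n := (2 * m)%N.
Local Notation Y := ('I_m * bool)%type.
Local Notation A := (Y * bool)%type.
Local Notation C := (Cgroup n m).
Local Notation nuY := (neg_perm m).
Local Notation J := (@transport m).
Implicit Types (g h w : {perm A}) (u p : {perm Y}).

Lemma odd_side_subproof p : injective (fun a : A => (if a.2 then p a.1 else a.1, a.2)).
Proof. by move=> [y [|]] [z [|]] //= [] // /perm_inj ->. Qed.
(** The double coset representative attached to [p]: it acts by [p] on the odd coordinates and fixes
    the even ones. *)
Definition odd_side p : {perm A} := perm (@odd_side_subproof p).
Lemma odd_sideE p y q : odd_side p (y, q) = (if q then p y else y, q).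
Proof. by rewrite permE. Qed.

Lemma both_sides_subproof p : injective (fun a : A => (p a.1, a.2)).
Proof. by move=> [y q] [z r] [/perm_inj -> ->]. Qed.
Definition both_sides p : {perm A} := perm (@both_sides_subproof p).
Lemma both_sidesE p y q : both_sides p (y, q) = (p y, q).
Proof. by rewrite permE. Qed.

Lemma both_sides_C p : commute p nuY -> J (both_sides p) \in C.
Proof.
move=> cp; apply/mem_C; split; apply/permP=> -[y q].
  by rewrite !permM !(nuAE, both_sidesE) -!permM cp.
by rewrite !permM !(sAE, both_sidesE).
Qed.

Lemma odd_side_nu p : commute p nuY -> commute (odd_side p) (nuA m).
Proof.
move=> cp; apply/permP=> -[y q]; rewrite !permM !(nuAE, odd_sideE).
by case: q; rewrite // -!permM cp.
Qed.

(** The rotation of the dihedral group of [sA] and its conjugate; its cycle type is an invariant of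
    the double coset of [w]. *)
Definition cycle_perm w : {perm A} := ((sA m ^ w) * sA m)%g.

Lemma odd_side_sE p y q :
  (sA m ^ odd_side p)%g (y, q) = (if q then p^-1%g y else p y, ~~ q).
Proof.
have e z r : (sA m ^ odd_side p)%g (odd_side p (z, r)) = odd_side p (z, ~~ r).
  by rewrite permJ sAE.
case: q; last by have := e y false; rewrite !odd_sideE.
by have := e (p^-1%g y) true; rewrite !odd_sideE permKV.
Qed.

Lemma cycle_perm_odd_side p y q :
  cycle_perm (odd_side p) (y, q) = (if q then p^-1%g y else p y, q).
Proof. by rewrite /cycle_perm permM odd_side_sE sAE negbK. Qed.

(** Moving the colour given by [two_sides] into the side component is an element [h] of the paired
    group, after which [t ^ h] exchanges the two sides and hence is [sA ^ odd_side p] for some [p].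
    Then [w h] and [odd_side p] conjugate [sA] to the same involution, so they differ by a left
    factor centralising [sA]. *)
Lemma double_coset_normal_form w : commute w (nuA m) ->
  exists p, commute p nuY /\
    exists h1 h2, [/\ J h1 \in C, J h2 \in C & w = (h1 * odd_side p * h2)%g].
Proof.
move=> wn; have [t tdef] : exists t, t = (sA m ^ w)%g by eexists.
have w_nu a : w (nuA m a) = nuA m (w a) by have /permP/(_ a) := wn; rewrite !permM.
have tE a : t (w a) = w (sA m a) by rewrite tdef permJ.
have t_nu a : t a != nuA m a.
  by rewrite -[a](permKV w) tE -w_nu (inj_eq perm_inj) sA_neq_nuA.
have t_free a : t a != a by rewrite -[a](permKV w) tE (inj_eq perm_inj) sA_free.
have tn : commute t (nuA m).
  apply/permP=> a; rewrite !permM -[a](permKV w) tE -!w_nu tE.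
  by have /permP/(_ (w^-1%g a)) := sA_nuA m; rewrite !permM => ->.
have tK : (t * t = 1)%g by rewrite tdef -conjMg sAK conj1g.
have tKa a : t (t a) = a by rewrite -permM tK perm1.
have t_nua a : t (nuA m a) = nuA m (t a) by have /permP/(_ a) := tn; rewrite !permM.
have [sd [sd_nu sd_s sd_t]] := two_sides (nuAK m) (sAK m) tK (sA_nuA m) tn
  (@sA_neq_nuA m) t_nu (@sA_free m) t_free.
pose hf a := (a.1, ~~ sd a).
have hf_invol : injective hf.
  move=> [y q] [z r] [<-] /negb_inj.
  case: q r => [] [] //; first by rewrite -[true]/(~~ false) -sAE sd_s; case: (sd _).
  by rewrite -[true]/(~~ false) -sAE sd_s; case: (sd _).
pose h := perm hf_invol; have hE a : h a = (a.1, ~~ sd a) by rewrite permE.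
have hn : commute h (nuA m).
  by apply/permP=> -[y q]; rewrite !permM !hE sd_nu !nuAE.
have hs : commute h (sA m).
  by apply/permP=> -[y q]; rewrite !permM !hE sd_s !sAE.
have [t1 t1def] : exists t1, t1 = (t ^ h)%g by eexists.
have t1E a : t1 (h a) = h (t a) by rewrite t1def permJ.
have t1_side a : (t1 a).2 = ~~ a.2.
  by rewrite -(permKV h a) t1E !hE sd_t /= negbK.
have t1K a : t1 (t1 a) = a by rewrite -(permKV h a) !t1E tKa.
have t1n a : t1 (nuA m a) = nuA m (t1 a).
  have h_nu b : h (nuA m b) = nuA m (h b) by have /permP/(_ b) := hn; rewrite !permM.
  by rewrite -(permKV h a) -h_nu !t1E t_nua h_nu.
have t1F y : t1 (y, false) = ((t1 (y, false)).1, true).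
  by rewrite {1}[t1 _]surjective_pairing t1_side.
have p_inj : injective (fun y => (t1 (y, false)).1).
  move=> y z /= e; have : t1 (y, false) = t1 (z, false) by rewrite t1F e -t1F.
  by move/perm_inj=> [].
pose p := perm p_inj.
have pE y : t1 (y, false) = (p y, true) by rewrite t1F permE.
have pE' y : t1 (y, true) = (p^-1%g y, false).
  by apply: (@perm_inj _ t1); rewrite t1K pE permKV.
have cp : commute p nuY.
  apply/permP=> y; rewrite !permM; have := t1n (y, false).
  by rewrite nuAE !pE nuAE => -[].
have t1S : t1 = (sA m ^ odd_side p)%g.
  by apply/permP=> -[y [|]]; rewrite odd_side_sE ?pE ?pE'.
exists p; split=> //.
exists (w * h * (odd_side p)^-1)%g, h^-1%g; split; last by rewrite mulgKV mulgK.
  apply/mem_C; split.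
    apply/commute_sym/commuteM; last exact/commuteV/commute_sym/odd_side_nu.
    by apply/commuteM; apply/commute_sym.
  apply/commute_sym/commgP/conjg_fixP.
  by rewrite !conjgM -tdef -t1def t1S conjgK.
by apply/mem_C; split; apply/commute_sym/commuteV/commute_sym.
Qed.

Lemma double_coset_conj p p' : commute p nuY -> commute p' nuY ->
  (forall t, #|bases nuY p t| = #|bases nuY p' t|) ->
  exists h1 h2, [/\ J h1 \in C, J h2 \in C
    & odd_side p' = (h1 * odd_side p * h2)%g].
Proof.
move=> cp cp' eqB.
have [f cf pf] := conj_by_type (neg_permK m) (@neg_perm_free m) cp cp' eqB.
exists (both_sides f)^-1%g, (both_sides f); split; last first.
- apply: (mulgI (both_sides f)); rewrite -mulgA mulKVg.
  apply/permP=> -[y q]; rewrite !permM !(odd_sideE, both_sidesE) -pf.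
  by case: q; rewrite // permJ.
- exact: both_sides_C.
by rewrite transportV groupV both_sides_C.
Qed.

Lemma ctype_conj (T : finType) (c nu h : {perm T}) x : commute h nu ->
  ctype (c ^ h)%g nu (h x) = ctype c nu x.
Proof.
move=> hn; apply: (ctype_embed (f := h)) => [|y|y]; first exact: perm_inj.
  by rewrite permJ.
by have /permP/(_ y) := hn; rewrite !permM.
Qed.

Lemma card_ctype_conj (T : finType) (c nu h : {perm T}) t : commute h nu ->
  #|[set x | ctype (c ^ h)%g nu x == t]| = #|[set x | ctype c nu x == t]|.
Proof.
move=> hn; rewrite -[RHS](card_imset _ (@perm_inj _ h)); apply: eq_card => x.
rewrite inE; apply/idP/imsetP => [xt|[y yt ->]].
  by exists (h^-1%g x); rewrite ?permKV // inE -(ctype_conj c _ hn) permKV.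
by rewrite ctype_conj //; move: yt; rewrite inE.
Qed.

Lemma ctype_cycle_perm p y q : commute p nuY ->
  ctype (cycle_perm (odd_side p)) (nuA m) (y, q) = ctype p nuY y.
Proof.
move=> cp; case: q.
  have -> : ctype p nuY y = ctype p^-1%g nuY y by rewrite /ctype porbitV.
  apply: (ctype_embed (f := fun y => (y, true))) => [z z' []|z|z] //.
    by rewrite cycle_perm_odd_side.
  by rewrite nuAE.
apply: (ctype_embed (f := fun y => (y, false))) => [z z' []|z|z] //.
  by rewrite cycle_perm_odd_side.
by rewrite nuAE.
Qed.

Lemma card_ctype_odd_side p t : commute p nuY ->
  #|[set a | ctype (cycle_perm (odd_side p)) (nuA m) a == t]|
  = (#|[set y | ctype p nuY y == t]| * 2)%N.
Proof.
move=> cp; have -> : [set a | ctype (cycle_perm (odd_side p)) (nuA m) a == t]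
   = setX [set y | ctype p nuY y == t] [set: bool].
  by apply/setP=> -[y q]; rewrite !inE andbT ctype_cycle_perm.
by rewrite cardsX cardsT card_bool.
Qed.

Lemma card_bases_eq (T : finType) (c c' nu : {perm T}) t :
  (nu * nu = 1)%g -> commute c nu -> commute c' nu ->
  #|[set x | ctype c nu x == t]| = #|[set x | ctype c' nu x == t]| ->
  #|bases nu c t| = #|bases nu c' t|.
Proof.
move=> nuK cn cn'; rewrite !(card_ctype nuK) //.
case: (posnP t.1) => [t0 _|t_gt0 /eqP].
  have none (d : {perm T}) : bases nu d t = set0.
    apply/setP=> x; rewrite !inE; apply/negbTE; rewrite negb_and orbC.
    apply/orP; left; apply: contra_eqN t0 => /eqP <-.
    by rewrite /ctype /= card_porbit_neq0.
  by rewrite !none.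
by rewrite eqn_pmul2r => [/eqP //|]; case: ifP; rewrite ?double_gt0.
Qed.

(** Elements of the paired group centralise [sA], so [cycle_perm] changes by conjugation only. For
    [odd_side p] it acts as [p] on one side and [p^-1] on the other, so each type of [p] occurs
    exactly twice. *)
Lemma double_coset_types p p' h1 h2 : commute p nuY -> commute p' nuY ->
  J h1 \in C -> J h2 \in C -> odd_side p' = (h1 * odd_side p * h2)%g ->
  forall t, #|bases nuY p t| = #|bases nuY p' t|.
Proof.
move=> cp cp' /mem_C[_ s1] /mem_C[n2 s2] e t.
have cyc : cycle_perm (odd_side p') = (cycle_perm (odd_side p) ^ h2)%g.
  have e1 : (sA m ^ h1 = sA m)%g by apply/conjg_fixP/commgP/commute_sym.
  have e2 : (sA m ^ h2 = sA m)%g by apply/conjg_fixP/commgP/commute_sym.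
  by rewrite /cycle_perm conjMg e2 e (conjgM _ (h1 * _)%g) (conjgM _ h1) e1.
apply: card_bases_eq => //; first exact: neg_permK.
apply/eqP; rewrite -(eqn_pmul2r (isT : 0 < 2)%N) -!card_ctype_odd_side //.
by rewrite cyc card_ctype_conj.
Qed.

End DoubleCosetModel.

Section RestrictedPerm.
Variables (T : finType) (O : {set T}) (r : {perm T}).
Hypothesis stab : forall y, (r y \in O) = (y \in O).

Lemma restr_perm_if y : restr_perm O r y = if y \in O then r y else y.
Proof.
case: ifP => Oy; first by rewrite restr_permE //; apply/astabsP.
by rewrite (out_perm (restr_perm_on O r)) ?Oy.
Qed.

Lemma restr_perm_commute (v : {perm T}) :
  (forall y, (v y \in O) = (y \in O)) -> commute r v -> commute (restr_perm O r) v.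
Proof.
move=> vO /permP rv; apply/permP=> y; rewrite !permM !restr_perm_if vO.
by case: ifP => // _; have := rv y; rewrite !permM.
Qed.

End RestrictedPerm.

(** * Which double cosets support [eta] *)

Section Supports.
Variable m : nat.
Local Notation n := (2 * m)%N.
Local Notation Y := ('I_m * bool)%type.
Local Notation A := (Y * bool)%type.
Local Notation C := (Cgroup n m).
Local Notation nuY := (neg_perm m).
Local Notation J := (@transport m).
Local Notation crd := (coord (leqnn n)).
Implicit Types (w : {perm A}) (u p r : {perm Y}).

Definition eta_bit (v : {perm 'I_n * bool}) : bool := odd (sign_changes v)./2.

Lemma sum_coord (F : 'I_n -> nat) :
  (\sum_x F x = \sum_(i < m) (F (crd i false) + F (crd i true)))%N.
Proof.
pose h (a : 'I_m * bool) := crd a.1 a.2.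
have h_inj : injective h.
  by move=> [i b] [j d] /eqP; rewrite coord_inj => /andP[/eqP /= -> /eqP /= ->].
rewrite (reindex h) /=; last first.
  apply: onW_bij; apply: inj_card_bij => //.
  by rewrite card_prod card_bool !card_ord mulnC.
rewrite -(pair_bigA _ (fun i b => F (h (i, b)))) /=.
by apply: eq_bigr => i _; rewrite big_bool addnC.
Qed.

Lemma sign_changes_transport w : sign_changes (J w) =
  (\sum_(i < m) ((w ((i, false), false)).1.2 + (w ((i, false), true)).1.2))%N.
Proof.
rewrite sign_changesE sum_coord; apply: eq_bigr => i _.
have e q : (crd i q, false) = join ((i, false), q) by [].
by rewrite !e !transportE.
Qed.

(** Commuting with [sA] gives both coordinates of a pair the same sign, so halving the number of
    sign changes amounts to counting on even coordinates. *)
Lemma eta_bit_transport w : commute w (sA m) ->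
  eta_bit (J w) = odd (\sum_(i < m) (w ((i, false), false)).1.2)%N.
Proof.
move=> ws; rewrite /eta_bit sign_changes_transport.
rewrite (eq_bigr (fun i : 'I_m => (w ((i, false), false)).1.2 * 2)%N) => [|i _].
  by rewrite -big_distrl /= muln2 doubleK.
have /permP/(_ ((i, false), false)) := ws; rewrite !permM sAE /= => <-.
by case: (w _) => y q; rewrite sAE /= muln2 addnn.
Qed.

Lemma eta_bit_both_sides r : eta_bit (J (both_sides r)) = odd (sign_changes r).
Proof.
rewrite eta_bit_transport; last first.
  by apply/permP=> -[y q]; rewrite !permM !(sAE, both_sidesE).
by rewrite sign_changesE; congr odd; apply: eq_bigr => i _; rewrite both_sidesE.
Qed.

Lemma odd_side_D p : commute p nuY ->
  (J (odd_side p) \in Dgroup n) = ~~ odd #|neg_bases p|.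
Proof.
move=> cp; rewrite inE.
have -> : is_signed (J (odd_side p)) by apply/transport_signed/odd_side_nu.
rewrite /= -odd_sign_changes_bases // sign_changes_transport sign_changesE.
by congr (~~ odd _); apply: eq_bigr => i _; rewrite !odd_sideE.
Qed.

Lemma both_sides_centralize r p : commute r p ->
  (J (both_sides r) ^ J (odd_side p) = J (both_sides r))%g.
Proof.
move=> rp; rewrite -transportJ; congr transport; apply/conjg_fixP/commgP/permP=> -[y q].
rewrite !permM !(both_sidesE, odd_sideE).
by case: q; rewrite // -!permM rp.
Qed.

Section OneOrbit.
Variables (p : {perm Y}) (y0 : Y).
Hypothesis cp : commute p nuY.
Let O := signed_orbit p nuY y0.
Let nuK := neg_permK m.

Lemma orbit_stable i e y : (word p nuY i e y \in O) = (y \in O).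
Proof.
have orb (j : nat) (d : bool) z : word p nuY j d z \in signed_orbit p nuY z.
  by apply/(mem_signed_orbitP cp); exists j, d.
apply/idP/idP=> Oy; last first.
  by rewrite /O -(signed_orbit_eq nuK cp Oy) orb.
rewrite /O -(signed_orbit_eq nuK cp Oy) (signed_orbit_eq nuK cp (orb i e y)).
exact: (signed_orbit_refl cp).
Qed.

Lemma orbit_p y : (p y \in O) = (y \in O).
Proof. by have := orbit_stable 1 false y; rewrite wordE expg0 perm1 expg1. Qed.

Lemma orbit_nu y : (nuY y \in O) = (y \in O).
Proof. by have := orbit_stable 0 true y; rewrite wordE expg0 perm1 expg1. Qed.

Lemma restr_orbit_p : commute (restr_perm O p) nuY /\ commute (restr_perm O p) p.
Proof.
by split; apply: restr_perm_commute => // y; rewrite ?orbit_p ?orbit_nu.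
Qed.

Lemma restr_orbit_nu : commute (restr_perm O nuY) nuY /\ commute (restr_perm O nuY) p.
Proof.
by split; apply: restr_perm_commute => // y; rewrite ?orbit_p ?orbit_nu.
Qed.

(** Restricted to the orbit, [p] has exactly one negative cycle, and [odd_sign_changes_bases]
    applies. *)
Lemma odd_restr_neg : nuY y0 \in porbit p y0 -> odd (sign_changes (restr_perm O p)).
Proof.
move=> neg; have [cO _] := restr_orbit_p; rewrite odd_sign_changes_bases //.
have expO i y : y \in O -> (restr_perm O p ^+ i)%g y = (p ^+ i)%g y.
  elim: i y => [|i IH] y Oy; first by rewrite !expg0.
  by rewrite !expgS !permM restr_perm_if ?Oy ?IH ?orbit_p //; apply: orbit_p.
have porO y : y \in O -> porbit (restr_perm O p) y = porbit p y.
  move=> Oy; apply/setP=> z; apply/porbitP/porbitP=> -[i ->]; exists i;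
    by rewrite expO.
have typ y : y \in O -> ctype p nuY y = ctype p nuY y0.
  by move=> Oy; apply: ctype_signed_orbit.
have baseO y : y \in O -> base (restr_perm O p) nuY y = base p nuY y.
  by move=> Oy; rewrite /base /signed_orbit !porO ?orbit_nu.
have -> : neg_bases (restr_perm O p) = [set base p nuY y0].
  apply/setP=> x; rewrite !inE; case: (boolP (x \in O)) => Ox.
    rewrite baseO // (base_eq nuK cp Ox) eq_sym andbC /=.
    rewrite porO // (_ : nuY x \in porbit p x) //.
    by have := typ x Ox; rewrite /ctype => -[_ ->].
  rewrite [RHS](_ : _ = false); last first.
    by apply: contraNF Ox => /eqP->; exact: (base_in cp).
  apply/negbTE; rewrite negb_and orbC; apply/orP; left.
  rewrite /ctype /=; apply/negP; case/porbitP=> i; have -> : (restr_perm O p ^+ i)%g x = x.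
    elim: i => [|i IH]; first by rewrite expg0 perm1.
    by rewrite expgS permM restr_perm_if ?(negPf Ox) //; apply: orbit_p.
  by apply/eqP; rewrite neg_perm_free.
by rewrite cards1.
Qed.

(** The orbit has [2 L] signed points on [L] coordinates, each of which changes sign once. *)
Lemma odd_restr_pos : nuY y0 \notin porbit p y0 -> odd #|porbit p y0| ->
  odd (sign_changes (restr_perm O nuY)).
Proof.
move=> pos oL.
have card_O : #|O| = (#|porbit p y0| * 2)%N.
  by rewrite /O (card_signed_orbit nuK cp) /ctype /= (negPf pos) muln2.
have -> : sign_changes (restr_perm O nuY) = #|porbit p y0|; last by [].
have sumO : #|O| = (\sum_(i < m) \sum_(b : bool) ((i, b) \in O))%N.
  rewrite pair_big /= -sum1_card big_mkcond; apply: eq_bigr => -[i b] _ /=.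
  by case: ifP.
apply/eqP; rewrite -(eqn_pmul2r (isT : 0 < 2)%N) -card_O sumO sign_changesE.
rewrite big_distrl /=; apply/eqP/eq_bigr => i _.
rewrite big_bool /= restr_perm_if; last exact: orbit_nu.
rewrite -[true]/(~~ false) -neg_permE orbit_nu.
by case: ifP => //; rewrite neg_permE.
Qed.

(** Since [r] commutes with [p], conjugation by [odd_side p] fixes [both_sides r]; support would
    force [eta] to be trivial on it, but its [eta] is the parity of the sign changes of [r]. *)
Lemma eta_unsupported (r : {perm Y}) : commute r nuY -> commute r p ->
  odd (sign_changes r) -> ~~ supported C (fun=> false) eta_bit (J (odd_side p)).
Proof.
move=> rn rp odd_r; apply/supportedP=> /(_ (J (both_sides r))).
rewrite both_sides_centralize // both_sides_C // => /(_ isT isT).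
by rewrite eta_bit_both_sides odd_r.
Qed.

Lemma eta_unsupported_orbit :
  (nuY y0 \in porbit p y0) || odd #|porbit p y0| ->
  ~~ supported C (fun=> false) eta_bit (J (odd_side p)).
Proof.
case: (boolP (nuY y0 \in porbit p y0)) => [neg _|pos /= oL].
  have [rn rp] := restr_orbit_p; exact: eta_unsupported rn rp (odd_restr_neg neg).
have [rn rp] := restr_orbit_nu; exact: eta_unsupported rn rp (odd_restr_pos pos oL).
Qed.

Section SwapOnOrbit.
Variable r : {perm Y}.
Hypothesis rO : forall y, (r y \in O) = (y \in O).

Lemma swap_on_subproof :
  injective (fun a : A => if a.1 \in O then (r a.1, ~~ a.2) else a).
Proof.
move=> [y q] [z d] /=; case: ifP => Oy; case: ifP => Oz //.
- by case=> /perm_inj -> /negb_inj ->.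
- by case=> e _; rewrite -e rO Oy in Oz.
by case=> e _; rewrite e rO Oz in Oy.
Qed.

Definition swap_on : {perm A} := perm swap_on_subproof.

Lemma swap_onE y q : swap_on (y, q) = if y \in O then (r y, ~~ q) else (y, q).
Proof. by rewrite permE. Qed.

Lemma swap_on_nu : commute r nuY -> commute swap_on (nuA m).
Proof.
move=> rn; apply/permP=> -[y q]; rewrite !permM nuAE !swap_onE orbit_nu.
by case: ifP => _; rewrite nuAE // -!permM rn.
Qed.

Lemma swap_on_s : commute swap_on (sA m).
Proof.
apply/permP=> -[y q]; rewrite !permM sAE !swap_onE.
by case: ifP => _; rewrite sAE.
Qed.

Lemma eta_bit_swap_on : eta_bit (J swap_on) = odd (sign_changes (restr_perm O r)).
Proof.
rewrite eta_bit_transport; last exact: swap_on_s.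
rewrite sign_changesE; congr odd.
by apply: eq_bigr => i _; rewrite swap_onE restr_perm_if //; case: ifP.
Qed.

End SwapOnOrbit.

(* Swapping the two sides of one negative cycle by an inverter [u] of [p]
   conjugates to the swap by [u * p], and [p] has an odd number of sign changes
   on that cycle. *)
Lemma eta_eta_unsupported : nuY y0 \in porbit p y0 ->
  ~~ supported C eta_bit eta_bit (J (odd_side p)).
Proof.
move=> neg; have [u [uK un upu uorb]] := exists_inverter nuK (@neg_perm_free m) cp.
have uO y : (u y \in O) = (y \in O).
  have orb z : z \in O -> u z \in O.
    by move=> Oz; rewrite /O -(signed_orbit_eq nuK cp Oz) uorb.
  by apply/idP/idP=> [/orb|/orb //]; rewrite -permM uK perm1.
have upO y : ((u * p)%g y \in O) = (y \in O) by rewrite permM orbit_p uO.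
have conj : (swap_on uO ^ odd_side p)%g = swap_on upO.
  apply: (mulgI (odd_side p)); rewrite -conjgC.
  apply/permP=> -[y q]; rewrite !permM swap_onE.
  case: q; rewrite !odd_sideE /= !swap_onE ?orbit_p.
    case: ifP => Oy; rewrite odd_sideE //= !permM.
    congr (_, _); have /permP/(_ (p y)) := upu; rewrite !permM permK => e.
    by have := congr1 u e; rewrite -[u (u _)]permM uK perm1 => ->.
  by case: ifP => Oy; rewrite odd_sideE // permM.
have sw1 : J (swap_on uO) \in C.
  by apply/mem_C; split; [apply: swap_on_nu | apply: swap_on_s].
have sw2 : J (swap_on upO) \in C.
  apply/mem_C; split; last exact: swap_on_s.
  by apply/swap_on_nu/commute_sym/commuteM; apply/commute_sym.
apply/supportedP=> /(_ _ sw1); rewrite -transportJ conj => /(_ sw2).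
rewrite !eta_bit_swap_on.
have -> : restr_perm O (u * p)%g = (restr_perm O u * restr_perm O p)%g.
  apply/permP=> y; rewrite permM (restr_perm_if upO) (restr_perm_if uO).
  by rewrite (restr_perm_if orbit_p); case: ifP => Oy; rewrite ?uO Oy // permM.
have su : is_signed (restr_perm O u).
  by apply/signed_commute/restr_perm_commute => //; apply: orbit_nu.
have sp : is_signed (restr_perm O p) by apply/signed_commute; case: restr_orbit_p.
by rewrite sign_changesM // (odd_restr_neg neg) addbT; case: (odd _).
Qed.

End OneOrbit.

Section Unsigned.
Variable p : {perm Y}.
Hypothesis p2 : forall y, (p y).2 = y.2.

Lemma odd_side_unsigned x b : (J (odd_side p) (x, b)).2 = b.
Proof.
have [i [q ->]] := coordP (leqnn n) (ltn_ord x).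
rewrite -[(crd i q, b)]/(join ((i, b), q)) transportE odd_sideE /=.
by case: q; rewrite ?p2.
Qed.

(** The representative preserves signs, so conjugation by it only permutes the coordinates and keeps
    the number of sign changes. *)
Lemma eta_eta_supported : supported C eta_bit eta_bit (J (odd_side p)).
Proof.
set g := J _; have g2 x b : (g (x, b)).2 = b by exact: odd_side_unsigned.
apply/supportedP=> h Ch Chg; rewrite /eta_bit; congr (odd _./2).
have f_inj : injective (fun x => (g (x, false)).1).
  move=> x y /= e; suff : g (x, false) = g (y, false) by move/perm_inj=> [].
  by rewrite [LHS]surjective_pairing [RHS]surjective_pairing e !g2.
rewrite !sign_changesE [RHS](reindex_inj f_inj); apply: eq_bigr => x _ /=.
have -> : ((g (x, false)).1, false) = g (x, false).
  by rewrite [RHS]surjective_pairing g2.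
by rewrite permJ; case: (h (x, false)) => y d; rewrite g2.
Qed.

Hypothesis cp : commute p nuY.

(** The conjugate [w] commutes with [sA] and with [sA ^ odd_side p], so whether it changes the sign
    at [y] is constant along the cycles of [p]. The positive points where it does form a union of
    cycles of even length. *)
Lemma eta_supported : (forall y, ~~ odd #|porbit p y|) ->
  supported C (fun=> false) eta_bit (J (odd_side p)).
Proof.
move=> ev; apply/supportedP=> h Ch; have [w hw] := transport_surj (h ^ J (odd_side p))%g.
move=> Chg; have := Chg; rewrite hw => /mem_C[wn ws].
have wt : commute w (sA m ^ odd_side p)%g.
  apply/commute_transport; rewrite transportJ -hw /commute -!conjMg; congr (_ ^ _)%g.
  have [v hv] := transport_surj h; move: Ch; rewrite hv => /mem_C[_ vs].
  by rewrite -!transportM vs.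
rewrite eta_bit_transport //; apply/esym/negbTE.
have p2V y : (p^-1%g y).2 = y.2 by rewrite -[in RHS](permKV p y) p2.
have t2 y q : ((sA m ^ odd_side p)%g (y, q)).1.2 = y.2.
  by rewrite odd_side_sE /=; case: q; rewrite ?p2 ?p2V.
have tF y : (sA m ^ odd_side p)%g (y, false) = (p y, true) by rewrite odd_side_sE.
move: (sA m ^ odd_side p)%g wt t2 tF => t wt t2 tF.
have s2 a : (sA m a).1.2 = a.1.2 by case: a => y q; rewrite sAE.
have t2' a : (t a).1.2 = a.1.2 by case: a => y q; rewrite t2.
have wp y : (w (p y, false)).1.2 = (w (y, false)).1.2.
  have /permP/(_ (p y, true)) := ws; rewrite !permM sAE /= => <-; rewrite s2.
  by have /permP/(_ (y, false)) := wt; rewrite !permM tF => <-; rewrite t2'.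
pose S := [set y | ~~ y.2 && (w (y, false)).1.2].
have -> : (\sum_(i < m) (w ((i, false), false)).1.2)%N = #|S|.
  have -> : #|S| = (\sum_(i < m) \sum_(b : bool) ((i, b) \in S))%N.
    rewrite pair_big /= -sum1_card big_mkcond; apply: eq_bigr => -[i b] _ /=.
    by case: ifP.
  by apply: eq_bigr => i _; rewrite big_bool /= !inE.
have pS i y : ((p ^+ i)%g y \in S) = (y \in S).
  elim: i y => [|i IH] y; first by rewrite expg0 perm1.
  by rewrite expgS permM IH !inE p2 wp.
rewrite -sum1_card (partition_big (porbit p) (mem [set porbit p y | y in S])) /=; last first.
  by move=> y Sy; apply: imset_f.
have even_sum (I : finType) (P : pred I) (F : I -> nat) :
    (forall i, P i -> ~~ odd (F i)) -> ~~ odd (\sum_(i | P i) F i).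
  move=> evF; apply: (big_ind (fun k => ~~ odd k)) => // a b.
  by rewrite oddD => /negPf-> /negPf->.
apply: even_sum => U /imsetP[y Sy ->].
rewrite (eq_bigl (fun z => z \in porbit p y)) ?sum1_card ?ev // => z.
rewrite eq_porbit_mem; apply/andP/idP=> [[]//|zy]; split=> //.
by case/porbitP: zy => i ->; rewrite pS.
Qed.

End Unsigned.
End Supports.

(** * Signed permutations with prescribed cycle types *)

Section SignFlip.
Variable I : finType.

Lemma sign_flip_invol : involutive (fun x : I * bool => (x.1, ~~ x.2)).
Proof. by move=> [i b] /=; rewrite negbK. Qed.
Definition sign_flip : {perm I * bool} := perm (inv_inj sign_flip_invol).
Lemma sign_flipE i b : sign_flip (i, b) = (i, ~~ b).
Proof. by rewrite permE. Qed.

Lemma sign_flip_commute (c : {perm I * bool}) :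
  (forall i b, c (i, ~~ b) = sign_flip (c (i, b))) -> commute c sign_flip.
Proof. by move=> h; apply/permP=> -[i b]; rewrite !permM sign_flipE h. Qed.

End SignFlip.

(* The [ctype] of a cycle on [l + 1] coordinates, encoded as [(l, e)] with [e] true
   if the cycle is negative; a negative cycle visits both signs of each
   coordinate before it closes. *)
Definition cycle_type (a : nat * bool) : nat * bool :=
  (if a.2 then a.1.+1.*2 else a.1.+1, a.2).

Section SignedCycle.
Variables (l : nat) (eps : bool).
Local Notation I := 'I_l.+1.
Local Notation nu := (sign_flip I).

Lemma rotate_inj :
  injective (fun x : I * bool => (ordS x.1, x.2 (+) (eps && (x.1 == l :> nat)))).
Proof.
move=> [i b] [j d] /= e; have /ordS_inj eij : ordS i = ordS j := congr1 fst e.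
by have := congr1 snd e; rewrite /= eij => /addIb ->.
Qed.

Definition rotate : {perm I * bool} := perm rotate_inj.

Lemma rotateE i b : rotate (i, b) = (ordS i, b (+) (eps && (i == l :> nat))).
Proof. by rewrite permE. Qed.

Lemma rotate_commute : commute rotate nu.
Proof.
by apply: sign_flip_commute => i b; rewrite !rotateE sign_flipE addNb.
Qed.

Lemma rotateX k i b : (rotate ^+ k)%g (i, b)
  = (inZp (i + k), b (+) (eps && odd ((i + k) %/ l.+1))).
Proof.
elim: k => [|k IH].
  rewrite expg0 perm1 addn0 divn_small // andbF addbF; congr (_, _).
  by apply: val_inj; rewrite /= modn_small.
rewrite expgSr permM IH rotateE; congr (_, _).
  by apply: val_inj; rewrite /= -addn1 modnDml addn1 addnS.
rewrite addnS divnS // oddD oddb -addbA; congr (_ (+) _).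
have -> : (inZp (p' := l) (i + k) == l :> nat) = (l.+1 %| (i + k).+1)%N.
  rewrite /= /dvdn -[in RHS]addn1 -[in RHS]modnDml addn1.
  have := ltn_pmod (i + k) (ltn0Sn l); rewrite ltnS leq_eqVlt => /orP[/eqP->|lt].
    by rewrite eqxx modnn.
  by rewrite (ltn_eqF lt) modn_small ?ltnS.
by case: eps => //=; rewrite addbC.
Qed.

Lemma rotateX_mul q i b : (rotate ^+ (q * l.+1))%g (i, b) = (i, b (+) (eps && odd q)).
Proof.
rewrite rotateX addnC divnMDl // divn_small // addn0; congr (_, _).
by apply: val_inj; rewrite /= modnMDl modn_small.
Qed.

Lemma rotate_fix k x : ((rotate ^+ k)%g x == x) = ((cycle_type (l, eps)).1 %| k)%N.
Proof.
case: x => i b; case: (boolP (l.+1 %| k)%N) => [/dvdnP[q ->]|ndv].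
  rewrite rotateX_mul xpair_eqE eqxx /= /cycle_type.
  case: eps => /=; last by rewrite addbF eqxx dvdn_mull.
  by rewrite -mul2n dvdn_pmul2r // dvdn2; case: b (odd q) => [] [].
rewrite rotateX xpair_eqE [X in X && _](_ : _ = false) /=.
  by apply/esym; apply: contraNF ndv; case: eps => //; apply: dvdn_trans; rewrite -mul2n dvdn_mull.
apply: contraNF ndv => /eqP/(congr1 val) /= e; rewrite /dvdn.
have : (i + k == i + 0 %[mod l.+1])%N by rewrite e addn0 modn_small.
by rewrite eqn_modDl mod0n.
Qed.

Lemma rotate_ctype x : ctype rotate nu x = cycle_type (l, eps).
Proof.
have L : #|porbit rotate x| = (cycle_type (l, eps)).1.
  apply/eqP; rewrite eqn_dvd -(rotate_fix _ x) permX iter_porbit eqxx andbT.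
  have := rotate_fix (cycle_type (l, eps)).1 x; rewrite dvdnn.
  by rewrite -[X in _ == X]perm1 -(expg0 rotate) expg_porbit_eq mod0n.
rewrite /ctype L /cycle_type; congr (_, _); case: x {L} => i b /=.
case he: eps; apply/porbitP.
  by exists (1 * l.+1)%N; rewrite rotateX_mul sign_flipE he /= addbT.
by case=> k; rewrite rotateX sign_flipE he /= addbF => -[_]; case: (b).
Qed.

Lemma card_rotate_ctype t : #|[set x | ctype rotate nu x == t]|
  = ((cycle_type (l, eps) == t) * (if t.2 then t.1 else t.1.*2))%N.
Proof.
case: eqP => [<-|ne]; last first.
  rewrite mul0n; apply/eqP; rewrite cards_eq0; apply/eqP/setP=> x.
  by rewrite !inE rotate_ctype; apply/eqP.
rewrite mul1n (_ : [set x | _] = setT) ?cardsT ?card_prod ?card_ord ?card_bool.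
  by rewrite /cycle_type /=; case: eps; rewrite muln2.
by apply/setP=> x; rewrite !inE rotate_ctype eqxx.
Qed.

End SignedCycle.

Section SignedSum.
Variables (I1 I2 : finType) (c1 : {perm I1 * bool}) (c2 : {perm I2 * bool}).
Hypotheses (n1 : commute c1 (sign_flip I1)) (n2 : commute c2 (sign_flip I2)).
Local Notation I := (I1 + I2)%type.

Definition in1 (x : I1 * bool) : I * bool := (inl x.1, x.2).
Definition in2 (x : I2 * bool) : I * bool := (inr x.1, x.2).

Lemma in1_inj : injective in1. Proof. by move=> [i b] [j d] [-> ->]. Qed.
Lemma in2_inj : injective in2. Proof. by move=> [i b] [j d] [-> ->]. Qed.

Definition sum_fun (x : I * bool) : I * bool :=
  match x.1 with
  | inl i => in1 (c1 (i, x.2))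
  | inr i => in2 (c2 (i, x.2))
  end.

Lemma sum_fun_inj : injective sum_fun.
Proof.
move=> [[i|i] b] [[j|j] d]; rewrite /sum_fun /=.
- by move/in1_inj/perm_inj=> [-> ->].
- by case.
- by case.
by move/in2_inj/perm_inj=> [-> ->].
Qed.

Definition perm_sum : {perm I * bool} := perm sum_fun_inj.

Lemma perm_sum1 x : perm_sum (in1 x) = in1 (c1 x).
Proof. by case: x => i b; rewrite permE. Qed.
Lemma perm_sum2 x : perm_sum (in2 x) = in2 (c2 x).
Proof. by case: x => i b; rewrite permE. Qed.
Lemma flip_in1 x : in1 (sign_flip I1 x) = sign_flip I (in1 x).
Proof. by case: x => i b; rewrite !sign_flipE. Qed.
Lemma flip_in2 x : in2 (sign_flip I2 x) = sign_flip I (in2 x).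
Proof. by case: x => i b; rewrite !sign_flipE. Qed.

Lemma perm_sum_commute : commute perm_sum (sign_flip I).
Proof.
apply/permP=> -[[i|i] b]; rewrite !permM.
  rewrite -[(inl i, b)]/(in1 (i, b)) -flip_in1 !perm_sum1 -flip_in1; congr in1.
  by have /permP/(_ (i, b)) := n1; rewrite !permM.
rewrite -[(inr i, b)]/(in2 (i, b)) -flip_in2 !perm_sum2 -flip_in2; congr in2.
by have /permP/(_ (i, b)) := n2; rewrite !permM.
Qed.

Lemma card_sum_ctype t : #|[set x | ctype perm_sum (sign_flip I) x == t]|
  = (#|[set x | ctype c1 (sign_flip I1) x == t]|
     + #|[set x | ctype c2 (sign_flip I2) x == t]|)%N.
Proof.
have t1 x := ctype_embed in1_inj (fun x => esym (perm_sum1 x)) flip_in1 x.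
have t2 x := ctype_embed in2_inj (fun x => esym (perm_sum2 x)) flip_in2 x.
rewrite -(card_imset _ in1_inj) -(card_imset _ in2_inj) -cardsUI.
rewrite [X in (_ + #|pred_of_set X|)%N](_ : _ = set0) ?cards0 ?addn0; last first.
  apply/setP=> y; rewrite inE in_set0; apply/negbTE/negP.
  by case/andP=> /imsetP[x _ ->] /imsetP[z _] [].
congr #|pred_of_set _|; apply/setP=> -[[i|i] b]; rewrite in_setU [in LHS]inE.
  rewrite -[(inl i, b)]/(in1 (i, b)) t1 mem_imset ?inE; last exact: in1_inj.
  by rewrite orbC; case: imsetP => // -[z _ []].
rewrite -[(inr i, b)]/(in2 (i, b)) t2 (mem_imset _ _ in2_inj) inE.
by case: imsetP => // -[z _ []].
Qed.

End SignedSum.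

(** The set of coordinates is left free, so cycles can be added by disjoint union without
    renumbering; [realize_types] transports the result to ['I_m]. *)
Lemma realize_cycle_types (s : seq (nat * bool)) :
  exists (I : finType) (c : {perm I * bool}),
  [/\ #|I| = (\sum_(a <- s) a.1.+1)%N, commute c (sign_flip I),
      (forall t, #|[set x | ctype c (sign_flip I) x == t]|
        = (count (fun a => cycle_type a == t) s * (if t.2 then t.1 else t.1.*2))%N)
    & all (fun a => ~~ a.2) s -> forall x, (c x).2 = x.2].
Proof.
elim: s => [|[l e] s [I [c [cI cn ct cu]]]].
  exists void, 1%g; rewrite big_nil card_void; split=> // [|t|].
  - by apply/permP=> -[[]].
  - by rewrite mul0n; apply/eqP; rewrite cards_eq0; apply/eqP/setP=> -[[]].
  by move=> _ [[]].
exists ('I_l.+1 + I)%type, (perm_sum (rotate l e) c); split.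
- by rewrite big_cons card_sum card_ord cI.
- exact: perm_sum_commute (rotate_commute l e) cn.
- by move=> t; rewrite card_sum_ctype ct card_rotate_ctype -mulnDl.
case/andP=> /= ne /cu c2 [[i|i] b].
  by rewrite -[(inl i, b)]/(in1 I (i, b)) perm_sum1 rotateE (negPf ne) addbF.
by rewrite -[(inr i, b)]/(in2 'I_l.+1 (i, b)) perm_sum2 /= c2.
Qed.

Lemma realize_types m (s : seq (nat * bool)) : (\sum_(a <- s) a.1.+1)%N = m ->
  exists p : sperm m, [/\ commute p (neg_perm m),
    forall t, #|bases (neg_perm m) p t| = count (fun a => cycle_type a == t) s
  & all (fun a => ~~ a.2) s -> forall x, (p x).2 = x.2].
Proof.
have [I [c [cI cn ct cu]]] := realize_cycle_types s; rewrite -cI => em.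
case: m / em.
pose f (x : I * bool) : 'I_#|I| * bool := (enum_rank x.1, x.2).
pose f' (x : 'I_#|I| * bool) : I * bool := (enum_val x.1, x.2).
have fK : cancel f f' by move=> [i b]; rewrite /f /f' /= enum_rankK.
have f'K : cancel f' f by move=> [i b]; rewrite /f /f' /= enum_valK.
have p_inj : injective (fun x => f (c (f' x))).
  by move=> x y /(can_inj fK)/perm_inj/(can_inj f'K).
have pf x : f (c x) = perm p_inj (f x) by rewrite permE fK.
have nf x : f (sign_flip I x) = neg_perm _ (f x).
  by case: x => i b; rewrite sign_flipE neg_permE.
have pn : commute (perm p_inj) (neg_perm #|I|).
  apply/permP=> x; rewrite !permM -(f'K x) -nf -!pf -nf; congr f.
  by have /permP/(_ (f' x)) := cn; rewrite !permM.
exists (perm p_inj); split=> // [t|/cu c2 x]; last by rewrite permE /= c2.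
have := card_ctype (neg_permK _) pn t; rewrite -/(bases _ _ _).
have -> : #|[set x | ctype (perm p_inj) (neg_perm #|I|) x == t]|
          = #|[set x | ctype c (sign_flip I) x == t]|.
  rewrite -[RHS](card_imset _ (can_inj fK)); apply: eq_card => x; rewrite inE.
  rewrite -[x](f'K x) (ctype_embed (can_inj fK) pf nf) mem_imset ?inE //.
  exact: can_inj fK.
rewrite ct; case: (posnP t.1) => [t0 _|t_gt0 /eqP]; last first.
  by rewrite eqn_pmul2r => [/eqP //|]; case: ifP; rewrite ?double_gt0.
transitivity 0%N; last first.
  apply/esym/eqP; rewrite -leqn0 leqNgt -has_count; apply/hasP=> -[a _ /eqP ta].
  by move: t0; rewrite -ta /cycle_type; case: (a.2).
apply/eqP; rewrite cards_eq0; apply/eqP/setP=> x; rewrite !inE.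
apply/negbTE; rewrite negb_and orbC; apply/orP; left.
by apply: contra_eqN t0 => /eqP <-; rewrite /ctype /= card_porbit_neq0.
Qed.

(** * Partitions and bipartitions *)

Section PartitionMultiplicities.

(** Here [f i] is the multiplicity of the part [i + 1]. *)
Definition weight N K (f : {ffun 'I_N -> 'I_K}) : nat :=
  (\sum_(i < N) i.+1 * f i)%N.

Lemma weight_ge N K (f : {ffun 'I_N -> 'I_K}) (i : 'I_N) : (i.+1 * f i <= weight f)%N.
Proof. by rewrite /weight (bigD1 i) //= leq_addr. Qed.

Lemma sumn_count (s : seq nat) N : all (fun x => x <= N)%N s ->
  (sumn s = \sum_(i < N) i.+1 * count (pred1 i.+1) s)%N.
Proof.
elim: s => [_|x s IH]; first by rewrite big1 // => i _; rewrite muln0.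
rewrite [all _ _]/= [sumn _]/= => /andP[xN /IH->].
rewrite [RHS](eq_bigr (fun i : 'I_N => i.+1 * (x == i.+1) + i.+1 * count (pred1 i.+1) s)%N)
  => [|i _]; last by rewrite -mulnDr.
rewrite [RHS]big_split; congr (_ + _)%N; case: x xN => [|x] xN.
  by rewrite big1 // => i _; rewrite muln0.
rewrite (bigD1 (Ordinal xN)) //= eqxx muln1 big1 ?addn0 // => i ne.
by move: ne; rewrite eqSS eq_sym -(inj_eq val_inj) /= => /negPf->; rewrite muln0.
Qed.

Definition partitions n : {set n.-tuple 'I_n.+1} :=
  [set t : n.-tuple 'I_n.+1 | sorted geq (map val t) & (\sum_(x <- t) x)%N == n].

Lemma sum_tuple_sumn n (t : n.-tuple 'I_n.+1) : (\sum_(x <- t) x)%N = sumn (map val t).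
Proof. by rewrite sumnE big_map. Qed.

Lemma vals_le n (t : n.-tuple 'I_n.+1) N : (n <= N)%N -> all (fun x => x <= N)%N (map val t).
Proof.
move=> nN; apply/allP=> x /mapP[y _ ->]; rewrite -ltnS.
by apply: leq_trans (ltn_ord y) _; rewrite ltnS.
Qed.

(** The bounds [N] on parts and [K] on multiplicities are free above [n], so partitions of different
    numbers can be counted in one function type. *)
Lemma num_part_multiplicities n N K : (n <= N)%N -> (n <= K)%N ->
  #|[set f : {ffun 'I_N -> 'I_K.+1} | weight f == n]| = num_part n.
Proof.
move=> nN nK; rewrite /num_part -/(partitions n).
pose F (t : n.-tuple 'I_n.+1) : {ffun 'I_N -> 'I_K.+1} :=
  [ffun i : 'I_N => inord (count (pred1 i.+1) (map val t))].
have cnt_le (t : n.-tuple 'I_n.+1) v : (count (pred1 v) (map val t) <= K)%N.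
  by apply: leq_trans (count_size _ _) _; rewrite size_map size_tuple.
have FE t i : F t i = count (pred1 i.+1) (map val t) :> nat.
  by rewrite ffunE inordK // ltnS.
have wF t : weight (F t) = (\sum_(x <- t) x)%N.
  rewrite sum_tuple_sumn (sumn_count (vals_le t nN)).
  by apply: eq_bigr => i _; rewrite FE.
have F_inj : {in partitions n &, injective F}.
  move=> t t'; rewrite !inE => /andP[st _] /andP[st' _] eF.
  apply/val_inj/(inj_map val_inj)/(@sorted_eq _ geq) => //.
  - by move=> a b c ba cb; apply: leq_trans cb ba.
  - by move=> a b; rewrite /geq andbC -eqn_leq => /eqP.
  apply/allP=> v _ /=; apply/eqP.
  have cS w : count_mem w.+1 (map val t) = count_mem w.+1 (map val t').
    case: (ltnP w N) => [wN|Nw]; first by rewrite -!(FE _ (Ordinal wN)) eF.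
    have none (t0 : n.-tuple 'I_n.+1) : count_mem w.+1 (map val t0) = 0%N.
      apply/eqP; rewrite -leqn0 leqNgt -has_count; apply/hasP=> -[x xt /eqP xw].
      by have := allP (vals_le t0 nN) x xt; rewrite xw leqNgt ltnS Nw.
    by rewrite !none.
  case: v => [|v]; last exact: cS.
  (* The number of padding zeros is [n] minus the number of positive parts, so it too is determined
     by the multiplicities. *)
  have cnt0 (t0 : n.-tuple 'I_n.+1) : (count_mem 0 (map val t0)
      + \sum_(i < N) count_mem i.+1 (map val t0) = n)%N.
    rewrite -[in RHS](size_tuple t0) -(size_map val t0).
    have := vals_le t0 nN; elim: (map val t0) => [|x s IH] /= => [_|/andP[xN /IH {1}<-]].
      by rewrite big1.
    rewrite big_split /= addnACA -[in RHS]add1n; congr (_ + _)%N.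
    case: x xN => [|x] xN; first by rewrite big1.
    rewrite add0n (bigD1 (Ordinal xN)) //= eqxx big1 // => i ne.
    by move: ne; rewrite eqSS eq_sym -(inj_eq val_inj) /= => /negPf->.
  apply/eqP; rewrite -(eqn_add2r (\sum_(i < N) count_mem i.+1 (map val t))) cnt0.
  by rewrite (eq_bigr (fun i : 'I_N => count_mem i.+1 (map val t'))) ?cnt0.
rewrite -(card_in_imset F_inj); apply: eq_card => f; rewrite inE.
apply/eqP/imsetP=> [wf|[t]]; last first.
  by rewrite inE => /andP[_ /eqP <-] ->; rewrite wF.
(* The partition with multiplicities [f], to be padded with zeros and sorted. *)
pose s0 := flatten [seq nseq (f i) i.+1 | i <- index_enum 'I_N].
have cs0 w : count_mem w.+1 s0 = (\sum_(i < N) f i * (i == w :> nat))%N.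
  rewrite count_flatten sumnE !big_map; apply: eq_bigr => i _.
  by rewrite count_nseq mulnC /= eqSS.
have ss0 : sumn s0 = n.
  rewrite sumn_flatten sumnE !big_map -wf; apply: eq_bigr => i _.
  by rewrite sumn_nseq.
have pos0 : all (fun x => 0 < x)%N s0.
  by apply/allP=> x /flattenP[u /mapP[i _ ->]]; rewrite mem_nseq => /andP[_ /eqP->].
have sz0 : (size s0 <= n)%N.
  rewrite -ss0; elim: (s0) pos0 => //= x u IH /andP[x0 /IH le].
  by rewrite -add1n leq_add.
have le0 : all (fun x => x <= n)%N s0.
  rewrite -ss0; elim: (s0) => //= x u IH; rewrite leq_addr /=.
  by apply: sub_all IH => y le; apply: leq_trans le (leq_addl _ _).
pose s := sort geq (s0 ++ nseq (n - size s0) 0%N).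
have ps : perm_eq s (s0 ++ nseq (n - size s0) 0%N) by rewrite perm_sort.
have szs : size s = n by rewrite size_sort size_cat size_nseq subnKC.
have les : all (fun x => x <= n)%N s.
  by rewrite (perm_all _ ps) all_cat le0; apply/allP=> x; rewrite mem_nseq => /andP[_ /eqP->].
pose t0 := map (@inord n) s.
have st0 : size t0 == n by rewrite size_map szs.
have vt : map val t0 = s.
  rewrite -map_comp -[RHS]map_id; apply/eq_in_map=> x xs /=.
  by rewrite inordK // ltnS (allP les).
exists (Tuple st0).
  rewrite inE sum_tuple_sumn /= vt sort_sorted; last by move=> x y; exact: leq_total.
  by rewrite (perm_sumn ps) sumn_cat ss0 sumn_nseq mul0n addn0 eqxx.
apply/ffunP=> i; apply: val_inj; rewrite /= FE /= vt (seq.permP ps) count_cat count_nseq.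
rewrite addn0 cs0 (bigD1 i) //= eqxx muln1 big1 ?addn0 // => j ne.
by rewrite (inj_eq val_inj) (negPf ne) muln0.
Qed.

End PartitionMultiplicities.

(** * Bipartitions and the parity of their negative parts *)

Section Bipartitions.
Variable m : nat.
Local Notation T := {ffun 'I_m -> 'I_m.+1}.
Implicit Types (fg : T * T) (f g h : T).

(** The two components hold the multiplicities of positive and of negative cycles. *)
Definition bipartitions : {set T * T} :=
  [set fg : T * T | (weight fg.1 + weight fg.2 == m)%N].

Definition neg_parts fg : nat := (\sum_(i < m) fg.2 i)%N.

Lemma weight_eq0 f : (weight f == 0%N) = [forall i, f i == 0%N :> nat].
Proof.
rewrite sum_nat_eq0; apply: eq_forallb => i /=.
by rewrite muln_eq0.
Qed.

Lemma card_bipartitions : #|bipartitions| = a_num m.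
Proof.
rewrite -sum1_card (partition_big (fun fg => inord (weight fg.1) : 'I_m.+1) predT) //=.
rewrite /a_num; apply: eq_bigr => k _.
have kle : (k <= m)%N by rewrite -ltnS.
rewrite -(num_part_multiplicities (N := m) (K := m) kle kle).
rewrite -(num_part_multiplicities (N := m) (K := m) (leq_subr k m) (leq_subr k m)).
rewrite -cardsX -[RHS]sum1_card; apply: eq_bigl => -[f g]; rewrite !inE /=.
apply/andP/andP=> [[/eqP e /eqP ek]|[/eqP ef /eqP eg]].
  have wf : weight f = k :> nat.
    by rewrite -ek inordK // ltnS (leq_trans (leq_addr (weight g) _)) // e.
  by rewrite wf eqxx -wf -(addKn (weight f) (weight g)) e.
rewrite ef eg subnKC //; split=> //; apply/eqP/val_inj.
by rewrite /= inordK.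
Qed.

Lemma card_nonneg_bipartitions :
  #|[set fg in bipartitions | neg_parts fg == 0%N]| = num_part m.
Proof.
rewrite -(num_part_multiplicities (N := m) (K := m) (leqnn m) (leqnn m)).
have inj : injective (fun f : T => (f, [ffun=> ord0] : T)) by move=> f f' [].
rewrite -[RHS](card_imset _ inj); apply: eq_card => -[f g]; rewrite !inE /=.
have w0 : weight ([ffun=> ord0] : T) = 0%N.
  by apply: big1 => i _; rewrite ffunE muln0.
apply/andP/imsetP=> [[/eqP wfg]|[f' wf [-> ->]]]; last first.
  rewrite w0 addn0; move: wf; rewrite inE => ->; split=> //.
  by rewrite /neg_parts sum_nat_eq0; apply/forallP=> i; rewrite ffunE.
rewrite /neg_parts sum_nat_eq0 => /forallP g0.
have gE : g = [ffun=> ord0].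
  by apply/ffunP=> i; apply: val_inj; rewrite ffunE /=; apply/eqP/(g0 i).
by move: wfg; rewrite gE w0 addn0 => wf; exists f; rewrite ?inE ?wf ?gE.
Qed.

Lemma bip_bound fg (i : 'I_m) : fg \in bipartitions -> (fg.1 i + fg.2 i <= m)%N.
Proof.
rewrite inE => /eqP e; rewrite -[X in (_ <= X)%N]e.
apply: leq_add; [apply: leq_trans (weight_ge fg.1 i)|apply: leq_trans (weight_ge fg.2 i)];
  by rewrite leq_pmull.
Qed.

(* Sign-reversing involution: at a part size [i.+1] of total multiplicity [k],
   the signed splittings [(k, 0), (k - 1, 1), ...] cancel in pairs, except for
   [(k, 0)] with [k] even. *)
Definition unbalanced fg (i : 'I_m) : bool := odd (fg.1 i) || (fg.2 i != 0%N :> nat).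

Definition toggle (i : 'I_m) fg : T * T :=
  if odd (fg.1 i) then
    ([ffun j => if j == i then inord (fg.1 i).-1 else fg.1 j],
     [ffun j => if j == i then inord (fg.2 i).+1 else fg.2 j])
  else
    ([ffun j => if j == i then inord (fg.1 i).+1 else fg.1 j],
     [ffun j => if j == i then inord (fg.2 i).-1 else fg.2 j]).

Definition cancel_map fg : T * T :=
  if [pick i | unbalanced fg i] is Some i then toggle i fg else fg.

Lemma toggleE i fg : fg \in bipartitions -> unbalanced fg i ->
  [/\ (toggle i fg).1 i = (if odd (fg.1 i) then (fg.1 i).-1 else (fg.1 i).+1) :> nat,
      ((toggle i fg).1 i + (toggle i fg).2 i = fg.1 i + fg.2 i)%N,
      unbalanced (toggle i fg) i
    & forall j, j != i -> (toggle i fg).1 j = fg.1 j /\ (toggle i fg).2 j = fg.2 j].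
Proof.
move=> B un; have bd := bip_bound i B; rewrite /toggle /unbalanced.
case: ifP un => [odf _|ef /= g0]; rewrite /unbalanced ?odf ?ef /=.
  have f0 : (0 < fg.1 i)%N by move: odf; case: (fg.1 i : nat).
  have b1 : ((fg.1 i).-1 < m.+1)%N by rewrite ltnS (leq_trans (leq_pred _)) // -ltnS.
  have b2 : ((fg.2 i).+1 < m.+1)%N.
    by rewrite ltnS (leq_trans _ bd) // -add1n leq_add2r.
  rewrite !ffunE eqxx !inordK //; split=> //.
  - by rewrite addnS -addSn prednK.
  - by rewrite orbT.
  by move=> j /negPf ne; rewrite !ffunE ne.
have gt0 : (0 < fg.2 i)%N by move: g0; rewrite /unbalanced ef lt0n.
have b1 : ((fg.1 i).+1 < m.+1)%N.
  by rewrite ltnS (leq_trans _ bd) // -addn1 leq_add2l.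
have b2 : ((fg.2 i).-1 < m.+1)%N by rewrite ltnS (leq_trans (leq_pred _)) // -ltnS.
rewrite !ffunE eqxx !inordK //=; split=> //; rewrite ?ef //.
- by rewrite addSn -addnS prednK.
by move=> j /negPf ne; rewrite !ffunE ne.
Qed.

(** A toggle keeps the total multiplicity at its size, hence the weight, and keeps the set of
    unbalanced sizes, so that [pick] returns the same size the second time; the number of negative
    parts changes by one. *)
Lemma cancel_mapP fg : fg \in bipartitions -> [exists i, unbalanced fg i] ->
  [/\ cancel_map fg \in bipartitions, [exists i, unbalanced (cancel_map fg) i],
      odd (neg_parts (cancel_map fg)) = ~~ odd (neg_parts fg)
    & cancel_map (cancel_map fg) = fg].
Proof.
move=> B /existsP[i0 un0].
have [i un defi] : exists2 i, unbalanced fg i & [pick i | unbalanced fg i] = Some i.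
  by case: pickP => [i|/(_ i0)]; [exists i | rewrite un0].
have -> : cancel_map fg = toggle i fg by rewrite /cancel_map defi.
have [valE sumE unE offE] := toggleE B un.
have oddE : odd ((toggle i fg).1 i) = ~~ odd (fg.1 i).
  rewrite valE; case: ifP => odf //=; first by case: (fg.1 i : nat) odf => //= k /negPf.
  by rewrite odf.
have B' : toggle i fg \in bipartitions.
  move: B; rewrite !inE; congr (_ == m); rewrite /weight -!big_split.
  apply: eq_bigr => j _ /=; rewrite -!mulnDr; congr (_ * _)%N.
  have [->|ne] := eqVneq j i; first by rewrite sumE.
  by have [-> ->] := offE j ne.
split=> //; first by apply/existsP; exists i.
  rewrite /neg_parts (bigD1 i) //= [in RHS](bigD1 i) //= !oddD.
  rewrite (eq_bigr (fun j => fg.2 j : nat)) => [|j ne]; last by have [_ ->] := offE j ne.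
  have : odd ((toggle i fg).1 i + (toggle i fg).2 i) = odd (fg.1 i + fg.2 i) by rewrite sumE.
  rewrite !oddD oddE; case: (odd (fg.1 i)) => /=; rewrite ?addTb ?addFb.
    by move=> ->; rewrite addNb.
  by move=> /(congr1 negb); rewrite negbK => ->; rewrite addNb.
have same : unbalanced (toggle i fg) =1 unbalanced fg.
  move=> j; have [->|ne] := eqVneq j i; first by rewrite unE un.
  by rewrite /unbalanced; have [-> ->] := offE j ne.
have -> : cancel_map (toggle i fg) = toggle i (toggle i fg).
  by rewrite /cancel_map (eq_pick same) defi.
have [valE2 sumE2 _ offE2] := toggleE B' unE.
have f_eq : (toggle i (toggle i fg)).1 i = fg.1 i :> nat.
  rewrite valE2 oddE valE; case: ifP => /=; case: ifP => // odf _.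
  by rewrite prednK //; case: (fg.1 i : nat) odf.
have g_eq : (toggle i (toggle i fg)).2 i = fg.2 i :> nat.
  by apply/eqP; rewrite -(eqn_add2l (fg.1 i)) -{1}f_eq sumE2 sumE.
have ext (a b : T * T) : a.1 = b.1 -> a.2 = b.2 -> a = b.
  by case: a b => [a1 a2] [b1 b2] /= -> ->.
apply: ext; apply/ffunP=> j; have [->|ne] := eqVneq j i.
- exact: val_inj.
- by have [-> _] := offE2 j ne; have [-> _] := offE j ne.
- exact: val_inj.
by have [_ ->] := offE2 j ne; have [_ ->] := offE j ne.
Qed.

Lemma half_lt (h : T) i : weight h = m./2 -> (2 * h i < m.+1)%N.
Proof.
move=> wh; rewrite ltnS -[X in (_ <= X)%N](odd_double_half m) mul2n.
apply: leq_trans (leq_addl _ _); rewrite leq_double -[X in (_ <= X)%N]wh.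
by apply: leq_trans (weight_ge h i); rewrite leq_pmull.
Qed.

Definition balanced_set : {set T * T} :=
  [set fg in bipartitions | [forall i, ~~ unbalanced fg i]].

(** Balanced means no negative part and even multiplicities; halving the multiplicities gives the
    partitions of [m / 2]. *)
Lemma card_balanced : #|balanced_set| = d_num m.
Proof.
rewrite /d_num; have bal fg : [forall i, ~~ unbalanced fg i] ->
    (forall i, ~~ odd (fg.1 i)) /\ weight fg.2 = 0%N.
  move=> /forallP b; split=> [i|]; first by have := b i; rewrite negb_or => /andP[].
  apply/eqP; rewrite weight_eq0; apply/forallP=> i.
  by have := b i; rewrite negb_or negbK => /andP[].
have even_weight f : (forall i, ~~ odd (f i)) -> ~~ odd (weight f).
  move=> ev; rewrite /weight; apply: (big_ind (fun k => ~~ odd k)) => // [a b|i _].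
    by rewrite oddD => /negPf-> /negPf->.
  by rewrite oddM (negPf (ev i)) andbF.
case: ifP => om.
  apply/eqP; rewrite cards_eq0; apply/eqP/setP=> fg; rewrite !inE.
  apply/negbTE/negP=> /andP[/eqP w /bal[ev g0]].
  by have := even_weight _ ev; rewrite -(addn0 (weight fg.1)) -g0 w om.
have mE : (2 * m./2 = m)%N by rewrite mul2n -[RHS]odd_double_half om.
have hm : (m./2 <= m)%N by rewrite -divn2 leq_div.
rewrite -(num_part_multiplicities (N := m) (K := m) hm hm).
pose D h : T * T := ([ffun i => inord (2 * h i)], [ffun=> ord0]).
have DE h i : weight h = m./2 -> (D h).1 i = (2 * h i)%N :> nat.
  by move=> wh; rewrite ffunE inordK // half_lt.
have D_inj : {in [set h : T | weight h == m./2] &, injective D}.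
  move=> h h'; rewrite !inE => /eqP wh /eqP wh' e; apply/ffunP=> i; apply: val_inj.
  have := congr1 (fun z : T * T => z.1 i : nat) e; rewrite /= !DE // => /eqP.
  by rewrite eqn_pmul2l // => /eqP.
have wD h : weight h = m./2 -> weight (D h).1 = m.
  move=> wh; rewrite -[RHS]mE -[in RHS]wh /weight big_distrr /=.
  by apply: eq_bigr => i _; rewrite DE // mulnCA.
have w0 : weight ([ffun=> ord0] : T) = 0%N by apply: big1 => i _; rewrite ffunE muln0.
rewrite -(card_in_imset D_inj); apply: eq_card => fg; rewrite !inE.
apply/andP/imsetP=> [[/eqP w /bal[ev g0]]|[h]]; last first.
  rewrite inE => /eqP wh ->; rewrite wD // w0 addn0; split=> //.
  apply/forallP=> i; rewrite /unbalanced DE // oddM /=.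
  by rewrite ffunE.
have f2 i : (fg.1 i)./2.*2 = fg.1 i by rewrite -[RHS]odd_double_half (negPf (ev i)).
pose h : T := [ffun i => inord (fg.1 i)./2].
have hE i : h i = (fg.1 i)./2 :> nat.
  rewrite ffunE inordK // ltnS; apply: leq_trans (_ : fg.1 i <= m)%N.
    by rewrite -[X in (_ <= X)%N]f2 -addnn leq_addr.
  by rewrite -ltnS.
have wh : weight h = m./2.
  apply/eqP; rewrite -(eqn_pmul2l (isT : 0 < 2)%N) mE -[X in _ == X]w g0 addn0.
  rewrite /weight big_distrr /=; apply/eqP/eq_bigr => i _.
  by rewrite hE mulnCA mul2n f2.
exists h; first by rewrite inE wh.
have ext (a b : T * T) : a.1 = b.1 -> a.2 = b.2 -> a = b.
  by case: a b => [a1 a2] [b1 b2] /= -> ->.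
apply: ext; apply/ffunP=> i; apply: val_inj.
  by apply: etrans (esym (DE h i wh)); rewrite hE mul2n f2.
by move/eqP: g0; rewrite weight_eq0 => /forallP/(_ i)/eqP /= ->; rewrite ffunE.
Qed.

Definition even_bipartitions : {set T * T} :=
  [set fg in bipartitions | ~~ odd (neg_parts fg)].

(** By [cancel_map] the even class exceeds the odd one by the [d_num m] balanced bipartitions, and
    together they number [a_num m]. *)
Lemma card_even_bipartitions : (2 * #|even_bipartitions| = a_num m + d_num m)%N.
Proof.
pose Od := [set fg in bipartitions | odd (neg_parts fg)].
pose Ev := [set fg in even_bipartitions | [exists i, unbalanced fg i]].
have splitB : #|bipartitions| = (#|even_bipartitions| + #|Od|)%N.
  rewrite -(cardsID [set fg | ~~ odd (neg_parts fg)]); congr (_ + _)%N;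
    by apply: eq_card => fg; rewrite !inE ?negbK // andbC.
have splitE : #|even_bipartitions| = (#|Ev| + d_num m)%N.
  rewrite -card_balanced -(cardsID [set fg | [exists i, unbalanced fg i]]).
  congr (_ + _)%N; apply: eq_card => fg; rewrite !inE //.
  rewrite -negb_exists; case: (boolP [exists i, _]) => [|nex]; first by rewrite !andbF.
  rewrite !andbT /= /neg_parts big1 ?andbT // => i _.
  by move: nex; rewrite negb_exists => /forallP/(_ i); rewrite negb_or negbK => /andP[_ /eqP].
have Od_un fg : fg \in Od -> [exists i, unbalanced fg i].
  rewrite inE => /andP[_]; apply: contraLR; rewrite negb_exists => /forallP b.
  rewrite /neg_parts big1 // => i _.
  by have := b i; rewrite negb_or negbK => /andP[_ /eqP].
have le_card (P Q : {set T * T}) : {subset P <= bipartitions} ->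
    {in P, forall fg, [exists i, unbalanced fg i]} ->
    {in P, forall fg, cancel_map fg \in Q} -> (#|P| <= #|Q|)%N.
  move=> PB Pun PQ; rewrite -(card_in_imset (f := cancel_map) (D := mem P)).
    by apply/subset_leq_card/subsetP=> _ /imsetP[fg Pfg ->]; apply: PQ.
  move=> x y Px Py e; have [_ _ _ <-] := cancel_mapP (PB x Px) (Pun x Px).
  by rewrite e; have [_ _ _] := cancel_mapP (PB y Py) (Pun y Py).
have EvOd : #|Ev| = #|Od|.
  have EvB : {subset Ev <= bipartitions}.
    by move=> fg; rewrite inE => /andP[]; rewrite inE => /andP[].
  have OdB : {subset Od <= bipartitions} by move=> fg; rewrite inE => /andP[].
  apply/eqP; rewrite eqn_leq; apply/andP; split; apply: le_card => // fg.
  - by rewrite inE => /andP[].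
  - move=> Efg; have := EvB _ Efg; move: Efg; rewrite inE => /andP[].
    rewrite inE => /andP[_ ev] un B; have [B' _ od _] := cancel_mapP B un.
    by rewrite inE B' od ev.
  move=> Ofg; have un := Od_un _ Ofg; have B := OdB _ Ofg.
  have [B' un' od _] := cancel_mapP B un; rewrite inE un' andbT inE B' od negbK.
  by move: Ofg; rewrite inE => /andP[].
rewrite -card_bipartitions splitB -EvOd mul2n -addnn {1}splitE.
by rewrite addnC addnA.
Qed.

(** Parts, rather than multiplicities, are halved here. The part at index [i] is [i + 1], so the
    even parts sit at odd indices. *)
Lemma card_even_part_bipartitions :
  #|[set fg in bipartitions | (neg_parts fg == 0%N)
       && [forall i : 'I_m, ~~ odd i ==> (fg.1 i == 0%N :> nat)]]| = d_num m.
Proof.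
rewrite /d_num; set S := [set _ in _ | _].
have SP fg : fg \in S -> [/\ weight fg.1 = m, fg.2 = [ffun=> ord0]
    & forall i : 'I_m, ~~ odd i -> fg.1 i = 0%N :> nat].
  rewrite inE => /andP[B /andP[g0 /forallP f0]]; move: g0.
  rewrite /neg_parts sum_nat_eq0 => /forallP g0.
  have gE : fg.2 = [ffun=> ord0].
    by apply/ffunP=> i; apply: val_inj; rewrite ffunE /=; apply/eqP/(g0 i).
  split=> // [|i ni]; last by have := f0 i; rewrite ni => /eqP.
  move: B; rewrite inE gE (_ : weight [ffun=> ord0] = 0%N) ?addn0 => [/eqP //|].
  by apply: big1 => i _; rewrite ffunE muln0.
case: ifP => om.
  apply/eqP; rewrite cards_eq0; apply/eqP/setP=> fg; rewrite [RHS]inE.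
  apply/negP=> /SP[w _ f0]; suff : ~~ odd (weight fg.1) by rewrite w om.
  rewrite /weight; apply: (big_ind (fun k => ~~ odd k)) => // [a b|i _].
    by rewrite oddD => /negPf-> /negPf->.
  by rewrite oddM /=; case: (boolP (odd i)) => //= ni; rewrite f0.
have mE : ((m./2).*2 = m)%N by rewrite -[RHS]odd_double_half om.
have hm : (m./2 <= m)%N by rewrite -divn2 leq_div.
have oddI (i : 'I_m./2) : (i.*2.+1 < m)%N.
  by rewrite -[X in (_ < X)%N]mE -doubleS leq_double.
rewrite -(num_part_multiplicities (N := m./2) (K := m) (leqnn _) hm).
pose od (i : 'I_m./2) := Ordinal (oddI i).
have od_inj : injective od.
  by move=> i j /(congr1 val) /= /eqP; rewrite eqSS => /eqP/double_inj/val_inj.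
have odP (i : 'I_m) : odd i -> exists j, i = od j.
  move=> oi; have iE : ((i./2).*2.+1 = i)%N by rewrite -[RHS]odd_double_half oi.
  have lt : (i./2 < m./2)%N.
    by rewrite -ltn_double mE (leq_ltn_trans _ (ltn_ord i)) // -[X in (_ <= X)%N]iE leqnSn.
  by exists (Ordinal lt); apply: val_inj; rewrite /= iE.
have sum_odd (F : 'I_m -> nat) : (forall i : 'I_m, ~~ odd i -> F i = 0%N) ->
    (\sum_i F i = \sum_j F (od j))%N.
  move=> F0; rewrite (bigID (fun i : 'I_m => odd i)) /= addnC big1 // add0n.
  rewrite -(big_imset F (in2W od_inj)); apply: eq_bigl => i.
  apply/idP/imsetP=> [/odP[j ->]|[j _ ->] /=]; first by exists j.
  by rewrite odd_double.
pose D (fg : T * T) := [ffun j => fg.1 (od j)].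
have wD fg : (forall i : 'I_m, ~~ odd i -> fg.1 i = 0%N :> nat) ->
    weight fg.1 = (weight (D fg)).*2.
  move=> f0; rewrite /weight sum_odd => [|i /f0 ->]; last by rewrite muln0.
  rewrite -muln2 big_distrl /=; apply: eq_bigr => j _.
  by rewrite ffunE mulnAC muln2 doubleS.
have D_inj : {in S &, injective D}.
  move=> [f g] [f' g'] /SP[/= _ -> f0] /SP[/= _ -> f0'] /ffunP e; congr (_, _).
  apply/ffunP=> i; apply: val_inj; case: (boolP (odd i)) => [/odP[j ->]|ni].
    by have := e j; rewrite !ffunE /= => ->.
  by rewrite /= f0 ?f0'.
rewrite -(card_in_imset D_inj); apply: eq_card => h; rewrite [RHS]inE.
apply/imsetP/eqP=> [[fg /SP[w _ f0] ->]|wh].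
  by apply: double_inj; rewrite -wD // mE.
pose f : T := [ffun i => if [pick j | od j == i] is Some j then h j else ord0].
have fE j : f (od j) = h j.
  by rewrite ffunE; case: pickP => [j' /eqP/od_inj->|/(_ j)] //; rewrite eqxx.
have f0 (i : 'I_m) : ~~ odd i -> f i = ord0.
  move=> ni; rewrite ffunE; case: pickP => // j /eqP ij.
  by rewrite -ij /= odd_double in ni.
have Df : D (f, [ffun=> ord0]) = h by apply/ffunP=> j; rewrite ffunE /= fE.
have wf : weight f = m.
  by rewrite (wD (f, [ffun=> ord0])) ?Df ?wh // => i /f0 /= ->.
exists (f, [ffun=> ord0]) => //; rewrite !inE /= wf.
rewrite (_ : weight [ffun=> ord0] = 0%N) ?addn0 ?eqxx; last first.
  by apply: big1 => i _; rewrite ffunE muln0.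
apply/and3P; split=> //; last by apply/forallP=> i; apply/implyP=> /f0 ->.
by rewrite /neg_parts sum_nat_eq0; apply/forallP=> i; rewrite ffunE.
Qed.

End Bipartitions.

(** * Double cosets counted by bipartitions *)

Lemma cycle_type_inj : injective cycle_type.
Proof.
move=> [i e] [j e'] [eij ee]; move: eij; rewrite ee; case: e' {ee} => [/double_inj|] [->] //.
Qed.

(** On [P], [h] factors through [f]. The induced map takes values in [option rT'], which supplies a
    default value. *)
Lemma leq_card_imset_factor (aT rT rT' : finType) (f : aT -> rT) (h : aT -> rT')
    (P : {set aT}) :
  {in P &, forall x y, f x = f y -> h x = h y} -> (#|h @: P| <= #|f @: P|)%N.
Proof.
move=> fh; have SomeI : injective (@Some rT') by move=> ? ? [].
pose phi U := if [pick x in P | f x == U] is Some x then Some (h x) else None.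
rewrite -(card_imset _ SomeI); suff -> : Some @: (h @: P) = phi @: (f @: P).
  exact: leq_imset_card.
rewrite -!imset_comp; apply: eq_in_imset => x Px /=; rewrite /phi.
case: pickP => [y /andP[Py /eqP e]|/(_ x)]; last by rewrite Px eqxx.
by congr Some; apply: fh.
Qed.

Section TypeCounts.
Variable m : nat.
Local Notation Y := ('I_m * bool)%type.
Local Notation nuY := (neg_perm m).
Local Notation T := {ffun 'I_m -> 'I_m.+1}.
Implicit Types (p : {perm Y}) (fg : T * T) (a : 'I_m * bool).
Let nuK := neg_permK m.

Definition type_of a : nat * bool := cycle_type (val a.1, a.2).

Lemma type_of_inj : injective type_of.
Proof. by move=> [i e] [j e'] /cycle_type_inj [/val_inj-> ->]. Qed.

Definition mult fg a : nat := if a.2 then fg.2 a.1 else fg.1 a.1.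

Definition type_counts p : T * T :=
  ([ffun i => inord #|bases nuY p (type_of (i, false))|],
   [ffun i => inord #|bases nuY p (type_of (i, true))|]).

Section OnePerm.
Variable p : {perm Y}.
Hypothesis cp : commute p nuY.

(** A signed orbit has at most [2 m] points, which bounds the number of coordinates of the cycle by
    [m]; for a negative cycle that number is half the even length. *)
Lemma ctype_type_of y : exists i, ctype p nuY y = type_of (i, (ctype p nuY y).2).
Proof.
have L0 : (0 < #|porbit p y|)%N by rewrite lt0n card_porbit_neq0.
have cY : #|{: Y}| = m.*2 by rewrite card_prod card_ord card_bool muln2.
have : (#|signed_orbit p nuY y| <= m.*2)%N by rewrite -cY max_card.
rewrite (card_signed_orbit nuK cp) /ctype /type_of /cycle_type /=.
case: ifP => [neg Lm|_].
  have [_ ev] := nu_porbit nuK (@neg_perm_free m) cp neg.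
  have LE : ((#|porbit p y|./2).*2 = #|porbit p y|)%N.
    by rewrite -[RHS]odd_double_half (negPf ev).
  have h0 : (0 < #|porbit p y|./2)%N by rewrite -double_gt0 LE.
  have lt : ((#|porbit p y|./2).-1 < m)%N by rewrite prednK // -leq_double LE.
  by exists (Ordinal lt); rewrite /= prednK // LE.
rewrite leq_double => Lm; have lt : (#|porbit p y|.-1 < m)%N by rewrite prednK.
by exists (Ordinal lt); rewrite /= prednK.
Qed.

(** The [2 m] signed points are counted by type: an orbit of type [type_of a] has [2 (a.1 + 1)]
    points for either sign. *)
Lemma sum_bases : (\sum_(a : 'I_m * bool) a.1.+1 * #|bases nuY p (type_of a)| = m)%N.
Proof.
apply: double_inj; rewrite -mul2n big_distrr /=.
have -> : m.*2 = (\sum_(y : Y) \sum_(a : 'I_m * bool) (ctype p nuY y == type_of a))%N.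
  transitivity (\sum_(y : Y) 1)%N.
    by rewrite sum1_card card_prod card_ord card_bool muln2.
  apply: eq_bigr => y _; have [i e] := ctype_type_of y.
  rewrite (bigD1 (i, (ctype p nuY y).2)) //= -e eqxx big1 // => a ne.
  by rewrite e (inj_eq type_of_inj) eq_sym (negPf ne).
rewrite exchange_big /=; apply: eq_bigr => a _.
rewrite -big_mkcond /= sum1_card; have := card_ctype nuK cp (type_of a).
rewrite cardsE => ->; rewrite -/(bases _ _ _) mulnA mulnC; congr (_ * _)%N.
by rewrite /type_of /cycle_type /=; case: a.2; rewrite mul2n.
Qed.

Lemma bases_le a : (#|bases nuY p (type_of a)| <= m)%N.
Proof.
rewrite -[X in (_ <= X)%N]sum_bases (bigD1 a) //=.
by apply: leq_trans (leq_addr _ _); rewrite leq_pmull.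
Qed.

Lemma mult_type_counts a : mult (type_counts p) a = #|bases nuY p (type_of a)|.
Proof.
by case: a => i [] /=; rewrite /mult /= ffunE inordK // ltnS bases_le.
Qed.

Lemma weight_mult fg : (weight fg.1 + weight fg.2 = \sum_(a : 'I_m * bool) a.1.+1 * mult fg a)%N.
Proof.
rewrite -(pair_bigA _ (fun (i : 'I_m) e => i.+1 * mult fg (i, e)))%N /= -big_split /=.
by apply: eq_bigr => i _; rewrite big_bool /= addnC.
Qed.

Lemma type_counts_bipartition : type_counts p \in bipartitions m.
Proof.
rewrite inE weight_mult; apply/eqP; rewrite -[RHS]sum_bases.
by apply: eq_bigr => a _; rewrite mult_type_counts.
Qed.

Lemma card_neg_bases : #|neg_bases p| = neg_parts (type_counts p).
Proof.
rewrite /neg_parts -sum1_card.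
transitivity (\sum_(y in neg_bases p) \sum_(i < m) (ctype p nuY y == type_of (i, true)))%N.
  apply: eq_bigr => y; rewrite inE => /andP[_ neg]; have [i e] := ctype_type_of y.
  rewrite neg in e; rewrite (bigD1 i) //= -e eqxx big1 // => j ne.
  by rewrite e (inj_eq type_of_inj) xpair_eqE andbT eq_sym (negPf ne).
rewrite exchange_big /=; apply: eq_bigr => i _.
have := mult_type_counts (i, true); rewrite {1}/mult [X in X = _]/= => ->.
rewrite -sum1_card big_mkcond [RHS]big_mkcond; apply: eq_bigr => y _; rewrite !inE.
case: (base _ _ _ == _) => //=; case: (boolP (nuY y \in _)) => [_|pos]; first by case: (_ == _).
by case: eqP => //; rewrite /ctype (negPf pos) => -[].
Qed.

End OnePerm.

Lemma type_counts_eq p p' : commute p nuY -> commute p' nuY ->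
  type_counts p = type_counts p' <-> forall t, #|bases nuY p t| = #|bases nuY p' t|.
Proof.
move=> cp cp'; split=> [e t|e]; last first.
  apply: (f_equal2 pair); apply: eq_ffun => i.
    by rewrite (e (type_of (i, false))).
  by rewrite (e (type_of (i, true))).
case: (pickP (fun a => type_of a == t)) => [a /eqP<-|none].
  by rewrite -(mult_type_counts cp) -(mult_type_counts cp') e.
have bases0 r : commute r nuY -> bases nuY r t = set0.
  move=> cr; apply/setP=> y; rewrite !inE; apply/negbTE; rewrite negb_and orbC.
  have [i yE] := ctype_type_of cr y; apply/orP; left; apply/eqP=> yt.
  by have := none (i, (ctype r nuY y).2); rewrite -yE yt eqxx.
by rewrite !bases0.
Qed.

Lemma realize_type_counts fg : fg \in bipartitions m -> exists p,
  [/\ commute p nuY, type_counts p = fg & neg_parts fg = 0%N -> forall x, (p x).2 = x.2].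
Proof.
rewrite inE weight_mult => /eqP w.
pose lbl a : nat * bool := (val a.1, a.2).
pose s := flatten [seq nseq (mult fg a) (lbl a) | a <- index_enum {: 'I_m * bool}].
have : (\sum_(a <- s) a.1.+1)%N = m.
  rewrite -[RHS]w /s big_flatten big_map; apply: eq_bigr => a _.
  by rewrite big_nseq iter_addn_0.
move=> /realize_types[p [cp types uns]]; exists p; split=> // [|g0]; last first.
  apply: uns; apply/allP=> a /flattenP[_ /mapP[[i e] _ ->]] /nseqP[-> /=].
  case: e => //=; rewrite /mult /=; move/eqP: g0; rewrite /neg_parts sum_nat_eq0.
  by move=> /forallP/(_ i)/eqP /= ->.
have cnt a : #|bases nuY p (type_of a)| = mult fg a.
  rewrite types count_flatten -map_comp sumnE big_map (bigD1_seq a) ?mem_index_enum //=; last first.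
    exact: index_enum_uniq.
  rewrite big1 => [|a' ne]; rewrite count_nseq.
    by rewrite eqxx mul1n addn0.
  by rewrite -/(type_of a') (inj_eq type_of_inj) (negPf ne).
have ext (x y : T * T) : x.1 = y.1 -> x.2 = y.2 -> x = y.
  by case: x y => [x1 x2] [y1 y2] /= -> ->.
apply: ext; apply/ffunP=> i; apply: val_inj.
  by have := mult_type_counts cp (i, false); rewrite cnt.
by have := mult_type_counts cp (i, true); rewrite cnt.
Qed.

End TypeCounts.

(** * The three counts of supported double cosets *)

Section CountSupportedDoubleCosets.
Variable m : nat.
Local Notation n := (2 * m)%N.
Local Notation G := (Dgroup n).
Local Notation C := (Cgroup n m).
Local Notation nuY := (neg_perm m).
Local Notation J := (@transport m).
Local Notation triv := (fun=> false : bool).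
Local Notation eta_b := (@eta_bit m).
Implicit Types (p : {perm 'I_m * bool}) (b : {perm 'I_n * bool} -> bool).

Lemma sign_hom_triv (gT : finGroupType) (H : {group gT}) : sign_hom H triv.
Proof. by []. Qed.

Lemma sign_hom_eta : sign_hom C eta_b.
Proof.
have etaE w : eta_fun w = (-1) ^+ eta_b w :> algC by rewrite /eta_fun signr_odd.
move=> v w Cv Cw; apply: (@signr_inj algC).
by rewrite signr_addb -!etaE; apply: eta_funM.
Qed.

Definition pair_coset p : {set {perm 'I_n * bool}} := (C :* J (odd_side p) * C)%g.

Lemma pair_coset_eq p p' : commute p nuY -> commute p' nuY ->
  pair_coset p = pair_coset p' <-> type_counts p = type_counts p'.
Proof.
move=> cp cp'; split=> [e|/(type_counts_eq cp cp')].
  apply/(type_counts_eq cp cp').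
  have : J (odd_side p') \in pair_coset p by rewrite e; apply: double_coset_refl.
  case/mem_double_cosetP=> h [k [Ch Ck]].
  have [h1 h1E] := transport_surj h; have [h2 h2E] := transport_surj k.
  rewrite {}h1E in Ch *; rewrite {}h2E in Ck *; rewrite -!transportM => /transport_inj.
  exact: double_coset_types.
move=> /(double_coset_conj cp cp')[h1 [h2 [C1 C2 e]]].
apply/esym/double_coset_eq/mem_double_cosetP; exists (J h1), (J h2); split=> //.
by rewrite e !transportM.
Qed.

Lemma mem_pair_coset g : is_signed g -> exists2 p, commute p nuY & g \in pair_coset p.
Proof.
have [w ->] := transport_surj g => /transport_signed/double_coset_normal_form.
case=> p [cp [h1 [h2 [C1 C2 ->]]]]; exists p => //.
by apply/mem_double_cosetP; exists (J h1), (J h2); rewrite !transportM.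
Qed.

Definition supported_perms b1 b2 : {set {perm 'I_m * bool}} :=
  [set p | [&& (p * nuY == nuY * p)%g, J (odd_side p) \in G
             & supported C b1 b2 (J (odd_side p))]].

Lemma supported_permsP b1 b2 p : reflect
  [/\ commute p nuY, ~~ odd (neg_parts (type_counts p)) & supported C b1 b2 (J (odd_side p))]
  (p \in supported_perms b1 b2).
Proof.
rewrite inE; apply: (iffP and3P) => [[/eqP cp Gp sp]|[cp ev sp]]; split=> //.
- by move: Gp; rewrite odd_side_D // card_neg_bases.
- exact/eqP.
by rewrite odd_side_D // card_neg_bases.
Qed.

(** On the admissible [p], the maps [pair_coset] and [type_counts] have the same fibres, so their
    images are equinumerous. *)
Lemma card_supported_double_cosets b1 b2 : sign_hom C b1 -> sign_hom C b2 ->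
  #|supported_double_cosets G C b1 b2| = #|[set type_counts p | p in supported_perms b1 b2]|.
Proof.
move=> h1 h2; have -> : supported_double_cosets G C b1 b2
    = [set pair_coset p | p in supported_perms b1 b2].
  apply/setP=> U; apply/imsetP/imsetP=> [[g]|[p]].
    rewrite inE => /andP[Gg sg] ->; have sgn : is_signed g by move: Gg; rewrite inE => /andP[].
    have [p cp gp] := mem_pair_coset sgn; exists p; last exact: double_coset_eq.
    have gE : (C :* J (odd_side p) * C = C :* g * C)%g by apply/esym/double_coset_eq.
    have pg : J (odd_side p) \in (C :* g * C)%g by rewrite -gE double_coset_refl.
    rewrite inE cp eqxx /= -(supported_double_coset h1 h2 gp) sg andbT.
    by apply: (subsetP (double_coset_subset (Cgroup_in_D (leqnn n)) Gg)).
  rewrite inE => /and3P[/eqP cp Gp sp] ->; exists (J (odd_side p)) => //.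
  by rewrite inE Gp sp.
apply/eqP; rewrite eqn_leq; apply/andP; split; apply: leq_card_imset_factor => p p';
  move=> /supported_permsP[cp _ _] /supported_permsP[cp' _ _]; by case: (pair_coset_eq cp cp').
Qed.

Lemma neg_parts0P p : commute p nuY ->
  neg_parts (type_counts p) = 0%N <-> forall y, nuY y \notin porbit p y.
Proof.
move=> cp; rewrite -card_neg_bases //; split=> [/cards0_eq n0 y|pos].
  apply/negP=> neg; have /setP/(_ (base p nuY y)) := n0.
  rewrite !inE (base_id (neg_permK m) cp) eqxx /=.
  have := ctype_signed_orbit (neg_permK m) cp (base_in cp y).
  by rewrite /ctype => -[_ ->]; rewrite neg.
apply/eqP; rewrite cards_eq0; apply/eqP/setP=> y; rewrite !inE.
by rewrite [(ctype _ _ _).2](negPf (pos y)) andbF.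
Qed.

Lemma card_triv_triv : #|supported_double_cosets G C triv triv| = #|even_bipartitions m|.
Proof.
rewrite card_supported_double_cosets; [|exact: sign_hom_triv..].
apply: eq_card => fg; rewrite inE; apply/imsetP/andP=> [[p /supported_permsP[cp ev _] ->]|].
  by rewrite type_counts_bipartition.
case=> /realize_type_counts[p [cp pE _]] ev; exists p => //.
by apply/supported_permsP; rewrite pE; split=> //; apply/supportedP.
Qed.

Lemma card_eta_eta : #|supported_double_cosets G C eta_b eta_b| = num_part m.
Proof.
rewrite card_supported_double_cosets; [|exact: sign_hom_eta..].
rewrite -card_nonneg_bipartitions.
apply: eq_card => fg; rewrite [RHS]inE; apply/imsetP/andP=> [[p /supported_permsP[cp ev sp] ->]|].
  rewrite type_counts_bipartition //; split=> //; apply/eqP/neg_parts0P => // y.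
  by apply: contraL sp => neg; apply: (eta_eta_unsupported cp neg).
case=> /realize_type_counts[p [cp pE p2]] /eqP g0; exists p => //.
apply/supported_permsP; rewrite pE g0; split=> //.
exact/eta_eta_supported/p2.
Qed.

Lemma card_triv_eta : #|supported_double_cosets G C triv eta_b| = d_num m.
Proof.
rewrite card_supported_double_cosets; [|exact: sign_hom_triv|exact: sign_hom_eta].
rewrite -card_even_part_bipartitions.
apply: eq_card => fg; rewrite [RHS]inE; apply/imsetP/andP=> [[p /supported_permsP[cp ev sp] ->]|].
  rewrite type_counts_bipartition //; split=> //.
  have orb y : nuY y \notin porbit p y /\ ~~ odd #|porbit p y|.
    apply/andP; rewrite -negb_or; apply: contraL sp => /(eta_unsupported_orbit cp).
    by [].
  apply/andP; split; first by apply/eqP/neg_parts0P => // y; case: (orb y).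
  apply/forallP=> i; apply/implyP=> ni.
  have := mult_type_counts cp (i, false); rewrite /mult [X in X = _]/= => ->.
  rewrite cards_eq0; apply/eqP/setP=> y; rewrite [RHS]inE; apply/negP.
  rewrite inE => /andP[_ /eqP[yL _]]; have [_ /negP[]] := orb y.
  by rewrite yL /= ni.
case=> /realize_type_counts[p [cp pE p2]] /andP[/eqP g0 /forallP ev]; exists p => //.
apply/supported_permsP; rewrite pE g0; split=> //.
apply: eta_supported => //; first exact: p2.
move=> y; have [i yE] := ctype_type_of cp y.
have pos : (ctype p nuY y).2 = false.
  by apply/negbTE; apply: (proj1 (neg_parts0P cp)); rewrite pE.
rewrite pos in yE; have -> : #|porbit p y| = i.+1 by case: yE.
have := ev i; rewrite /= negbK; case: (odd i) => //= /eqP f0.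
have := mult_type_counts cp (i, false); rewrite pE /mult [X in X = _]/= f0.
move/esym/cards0_eq/setP/(_ (base p nuY y)); rewrite !inE (base_id (neg_permK m) cp) eqxx /=.
by rewrite (ctype_signed_orbit (neg_permK m) cp (base_in cp y)) yE eqxx.
Qed.

End CountSupportedDoubleCosets.

(** Makes [d_num m] nonzero for even [m], which is the failure of the Gelfand property; the witness
    is the partition with a single part. *)
Lemma num_part_gt0 m : (0 < num_part m)%N.
Proof.
case: m => [|m].
  rewrite card_gt0; apply/set0Pn; exists [tuple]; rewrite inE /=.
  by rewrite big_nil.
have lt : (m.+1 < m.+2)%N by [].
rewrite -(num_part_multiplicities (leqnn m.+1) (leqnn m.+1)) card_gt0; apply/set0Pn.
exists [ffun i : 'I_m.+1 => if i == ord_max then 1%R else 0%R]; rewrite inE /weight.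
rewrite (bigD1 ord_max) //= big1 => [|i ne]; last by rewrite ffunE (negPf ne) muln0.
by rewrite ffunE eqxx addn0 muln1.
Qed.

(** * The even-special subgroup *)

Section EvenSpecial.
Variable m : nat.
Hypothesis m2 : (2 <= m)%N.
Local Notation n := (2 * m)%N.
Local Notation G := (Dgroup n).
Local Notation C := (Cgroup n m).
Local Notation eta_b := (@eta_bit m).

Lemma mem_Egroup x : (x \in Egroup m) = (x \in C) && ~~ eta_b x.
Proof.
have lin : Defs.eta m \is a linear_char by apply: lin_cfun_lin.
case: (boolP (x \in C)) => [Cx|nCx]; last first.
  by apply: contraNF nCx; apply: subsetP (cfker_sub _) x.
rewrite -[x \in Egroup m]/(x \in cfker (Defs.eta m)) cfkerEchar ?lin_charW //.
rewrite inE Cx /= lin_cfunE // (lin_char1 lin).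
rewrite /eta_fun -signr_odd -/(eta_b x); case: (eta_b x); rewrite ?eqxx //.
by rewrite expr1 eqNr oner_eq0.
Qed.

Lemma eta_bit_onto : exists2 c, c \in C & eta_b c.
Proof.
have m0 : (0 < m)%N by apply: ltnW.
exists (gen_c n (Ordinal m0)); first exact: gen_cC.
by rewrite /eta_bit sign_changes_c.
Qed.

Lemma even_special_gelfand : gelfand_pair G (Egroup m) <-> odd m.
Proof.
have := kernel_gelfand_pair (Cgroup_in_D (leqnn n)) (sign_hom_eta (m := m)) mem_Egroup
  eta_bit_onto (C_gelfand_trick _) (C_gelfand_trick _).
rewrite card_triv_eta /d_num => ->; case: ifP => // _; split=> // e.
by have := num_part_gt0 m./2; rewrite e.
Qed.

Let card_even := card_even_bipartitions m.

Lemma even_special_double_cosets : #|double_cosets G (Egroup m)|%:R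
  = ((a_num m)%:R + 2 * (num_part m)%:R + 5 * (d_num m)%:R) / 2 :> rat.
Proof.
rewrite (card_kernel_double_cosets (Cgroup_in_D (leqnn n)) (sign_hom_eta (m := m)) mem_Egroup
  eta_bit_onto (C_gelfand_trick _) (C_gelfand_trick _) algC).
rewrite card_triv_eta card_eta_eta card_triv_triv.
have := congr1 (fun k => k%:R : rat) card_even; rewrite /= natrM natrD => e.
have -> : (a_num m)%:R = 2 * #|even_bipartitions m|%:R - (d_num m)%:R :> rat by rewrite e addrK.
rewrite natrD [(_ + num_part m)%:R]natrD natrM; set a := _%:R; set b := _%:R; set c := _%:R.
by field.
Qed.

Lemma even_special_hecke (R : realType) : exists2 r : nat, r%:R = r_num m
  & hecke_isomorphic_to G (Egroup m) (fun=> 1 : R[i]) r (d_num m).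
Proof.
have := kernel_hecke (Cgroup_in_D (leqnn n)) (sign_hom_eta (m := m)) mem_Egroup
  eta_bit_onto (C_gelfand_trick _) (C_gelfand_trick _) R[i].
have := card_rank1 (Cgroup_in_D (leqnn n)) (sign_hom_eta (m := m)) mem_Egroup
  eta_bit_onto (C_gelfand_trick _) (C_gelfand_trick _) algC.
rewrite card_triv_eta card_eta_eta card_triv_triv => sumE hk; eexists; last exact: hk.
(* This bound makes the truncated subtraction exact, so that it casts to a difference of
   rationals. *)
have le : (2 * d_num m <= #|even_bipartitions m| + num_part m)%N by rewrite -sumE leq_addl.
rewrite natrB // natrM natrD /r_num.
have := congr1 (fun k => k%:R : rat) card_even; rewrite /= natrM natrD => e.
have -> : (a_num m)%:R = 2 * #|even_bipartitions m|%:R - (d_num m)%:R :> rat by rewrite e addrK.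
set a := _%:R; set b := _%:R; set c := _%:R.
by field.
Qed.

End EvenSpecial.

Lemma pair_gelfand m : gelfand_pair (Dgroup (2 * m)) (Cgroup (2 * m) m).
Proof.
have CD := Cgroup_in_D (leqnn (2 * m)); split=> //; first exact: rpred1.
apply: (gelfand_trick_multiplicity_free CD _ _ (C_gelfand_trick (fun=> false))) => //.
by move=> h Ch; rewrite cfun1E Ch.
Qed.

Theorem corollary5p6 :
  [/\ (forall n k q : nat, n = (2 * k + q)%N -> (4 <= n)%N ->
         linear_gelfand_triple (Dgroup n) (layer_char n k)),
      (forall m : nat, (2 <= m)%N ->
         gelfand_pair (Dgroup (2 * m)) (Cgroup (2 * m) m)),
      (forall m : nat, (2 <= m)%N ->
         gelfand_pair (Dgroup (2 * m)) (Egroup m) <-> odd m),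
      (forall m : nat, (2 <= m)%N ->
         (forall R : realType, exists2 r : nat, r%:R = r_num m
            & hecke_isomorphic_to (Dgroup (2 * m)) (Egroup m)
                (fun=> 1 : R[i]) r (d_num m))
         /\ #|double_cosets (Dgroup (2 * m)) (Egroup m)|%:R
              = ((a_num m)%:R + 2 * (num_part m)%:R + 5 * (d_num m)%:R) / 2
              :> rat)
    & (forall (R : realType) (r : nat), (1 <= r)%N ->
         exists s : nat,
           hecke_isomorphic_to (Dgroup (2 * (2 * r))) (Egroup (2 * r))
             (fun=> 1 : R[i]) s (num_part r))].
Proof.
split=> [n k q nE _|m _|m m2|m m2|R r r1].
- by apply: layer_gelfand; rewrite nE leq_addr.
- exact: pair_gelfand.
- exact: even_special_gelfand.
- by split=> [R|]; [apply: even_special_hecke | apply: even_special_double_cosets].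
have m2 : (2 <= 2 * r)%N by rewrite leq_pmulr.
have dE : d_num (2 * r) = num_part r by rewrite /d_num oddM /= mul2n doubleK.
have [s _] := even_special_hecke m2 R.
by rewrite dE => hk; exists s.
Qed.
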